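(* In the setting and under standing assumptions (A) of the context (in which $\Sigma$ is invertible), let $\Lambda:=1+\|\Sigma^{-1}\|+\|\Gamma\|$, let $\varepsilon\in\big(0,\Lambda\sqrt D\min\{1,2\|\Sigma^{-1}\|\}\big)$ and $\delta\in(0,1)$. If \[ m\ge\frac{10}{3}KR''\log(56n/\delta)\,\frac{\Lambda^2D}{\varepsilon^2}\max\{1,2\|\Sigma^{-1}\|\}^4, \] then with probability at least $1-\delta$ the matrix $\widehat\Sigma_\Omega$ is invertible and \[ \Big|K_{n,\Omega}-\|W\iota_n\Sigma^{-1}\Gamma\|\Big|<\varepsilon,\qquad K_{n,\Omega}:=\|W\iota_n\widehat\Sigma_\Omega^{-1}\widehat\Gamma_\Omega\|. \]
   Context: Let $\mathcal H$ be a separable complex Hilbert space, $\ell^2=\ell^2(\mathbb N)$ with canonical basis $(e_j)$; $a\otimes b$ denotes $x\mapsto\langle x,b\rangle a$; $\iota_n:\mathbb C^n\to\ell^2$, $\iota_n(x_1,\dots,x_n)=(x_1,\dots,x_n,0,\dots)$. $(s_k)_{k\in\mathbb N}$ is a frame for its closed span $\mathcal S$ (bounds $0<A\le B$: $A\|h\|^2\le\sum_k|\langle h,s_k\rangle|^2\le B\|h\|^2$, $h\in\mathcal S$); $(w_k)_{k\in\mathbb N}$ is a Riesz basis for its closed span $\mathcal W$ with bounds $0<C\le D$: $C\|x\|^2\le\|\sum_kx_kw_k\|^2\le D\|x\|^2$, $x\in\ell^2$. Synthesis operators $Sx=\sum_kx_ks_k$, $Wx=\sum_kx_kw_k$; $U:=S^*W$.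 Fix $n$, $\mathcal W_n:=\operatorname{span}\{w_1,\dots,w_n\}$, $P_{\mathcal W_n^\perp}$ the orthogonal projection onto $\mathcal W_n^\perp$. $\Sigma:=\iota_n^*U^*U\iota_n$, $v_j:=\iota_n^*U^*e_j$, $u_j:=P_{\mathcal W_n^\perp}s_j$, $\Gamma:=\iota_n^*U^*S^*P_{\mathcal W_n^\perp}:\mathcal H\to\mathbb C^n$. $p$ a probability distribution on $\mathbb N$, $\operatorname{supp}(p)=\{j:p_j>0\}$, $R:=\sup_{j\in\operatorname{supp}(p)}\|v_j\|^2/p_j$, $R':=\sup_{j\in\operatorname{supp}(p)}\|u_j\|^2/p_j$, $R'':=\max\{R,R'\}$, $T:=\sum_{j\in\operatorname{supp}(p)}u_j\otimes u_j$, $K:=\max\{\|\Sigma\|,\|T\|\}$. $i_1,\dots,i_m$ i.i.d. with law $p$, $\Omega=\{i_1,\dots,i_m\}$, $Q_\Omega:=\frac1m\sum_t\frac{e_{i_t}\otimes e_{i_t}}{p_{i_t}}$, $\widehat\Sigma_\Omega:=\iota_n^*U^*Q_\Omega U\iota_n$, $\widehat\Gamma_\Omega:=\iota_n^*U^*Q_\Omega S^*P_{\mathcal W_n^\perp}$. Standing assumptions (A): (i) $\mathcal W\cap\mathcal S^\perp=\{0\}$; (ii) $R<\infty$, $R'<\infty$; (iii) $p_j>0$ whenever $v_j\neq0$. *)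

(* Defs.v *)
From HB Require Import structures.
From mathcomp Require Import all_boot all_order all_algebra.
From mathcomp Require Import all_classical all_reals all_analysis.
From mathcomp Require Import complex.
From Stdlib Require Import ClassicalEpsilon.

Set Implicit Arguments.
Unset Strict Implicit.
Unset Printing Implicit Defensive.

Import Order.TTheory GRing.Theory Num.Theory.
Local Open Scope ring_scope.

Section Defs.
Context {R : realType}.
Local Notation CC := R[i].

Definition cre (z : CC) : R := let: Complex a _ := z in a.
Definition cim (z : CC) : R := let: Complex _ b := z in b.
Definition cconj (z : CC) : CC := Complex (cre z) (- cim z).
Definition cmod2 (z : CC) : R := cre z ^+ 2 + cim z ^+ 2.
Definition cmod (z : CC) : R := Num.sqrt (cmod2 z).

Definition csum (a : nat -> CC) : CC :=
  epsilon (inhabits 0) (fun L => forall e : R, 0 < e ->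
    exists N, forall M, (N <= M)%N -> cmod (\sum_(k < M) a k - L) < e).

Definition cvnorm (n : nat) (x : 'cV[CC]_n) : R :=
  Num.sqrt (\sum_(k < n) cmod2 (x k 0)).

Definition opnorm (X Y : Type) (nX : X -> R) (nY : Y -> R) (f : X -> Y) : R :=
  sup [set nY (f x) | x in [set x | nX x <= 1]].

Section Hilbert.
Variables (H : lmodType CC) (ip : H -> H -> CC).

Definition is_inner_product :=
  [/\ forall a x y z, ip (a *: x + y) z = a * ip x z + ip y z,
      forall x y, ip y x = cconj (ip x y),
      forall x, cim (ip x x) = 0 /\ 0 <= cre (ip x x)
    & forall x, ip x x = 0 -> x = 0].

Definition hnorm (x : H) : R := Num.sqrt (cre (ip x x)).

Definition hconv (u : nat -> H) (y : H) :=
  forall e : R, 0 < e -> exists N, forall M, (N <= M)%N -> hnorm (u M - y) < e.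

Definition hcauchy (u : nat -> H) :=
  forall e : R, 0 < e -> exists N, forall M1 M2, (N <= M1)%N -> (N <= M2)%N ->
    hnorm (u M1 - u M2) < e.

Definition hlim (u : nat -> H) : H := epsilon (inhabits 0) (hconv u).

Definition is_separable_hilbert :=
  [/\ is_inner_product,
      (forall u, hcauchy u -> exists y, hconv u y)
    & exists d : nat -> H, forall h (e : R), 0 < e -> exists k, hnorm (h - d k) < e].

Definition in_cspan (s : nat -> H) (h : H) :=
  forall e : R, 0 < e -> exists N (c : nat -> CC),
    hnorm (h - \sum_(k < N) c k *: s k) < e.

Definition is_frame_cspan (s : nat -> H) (A B : R) :=
  [/\ 0 < A, A <= B &
      forall h, in_cspan s h ->
        ((A * hnorm h ^+ 2)%:E <= \sum_(0 <= k <oo) (cmod2 (ip h (s k)))%:E)%E /\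
        (\sum_(0 <= k <oo) (cmod2 (ip h (s k)))%:E <= (B * hnorm h ^+ 2)%:E)%E].

Definition is_riesz_cspan (w : nat -> H) (C D : R) :=
  [/\ 0 < C, C <= D &
      forall x : nat -> CC,
        (\sum_(0 <= k <oo) (cmod2 (x k))%:E < +oo)%E ->
        exists y, hconv (fun N => \sum_(k < N) x k *: w k) y /\
          C * fine (\sum_(0 <= k <oo) (cmod2 (x k))%:E)%E <= hnorm y ^+ 2 /\
          hnorm y ^+ 2 <= D * fine (\sum_(0 <= k <oo) (cmod2 (x k))%:E)%E].

Variables (s w : nat -> H) (n : nat).

Definition Wn (y : 'cV[CC]_n) : H := \sum_(k < n) y k 0 *: w k.

Definition Pperp (h : H) : H :=
  epsilon (inhabits 0) (fun y =>
    (forall k : 'I_n, ip y (w k) = 0) /\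
    exists c : 'I_n -> CC, h - y = \sum_(k < n) c k *: w k).

(* U = S^* W has entries U_{jk} = <w_k, s_j>.
   Sigma = iota^* U^* U iota,  Sigma_{kl} = sum_j U_{jl} conj(U_{jk}) *)
Definition Sigma : 'M[CC]_n :=
  \matrix_(k < n, l < n) csum (fun j => ip (w l) (s j) * cconj (ip (w k) (s j))).

(* Gamma = iota^* U^* S^* P : H -> C^n *)
Definition Gamma (h : H) : 'cV[CC]_n :=
  \col_(k < n) csum (fun j => ip (Pperp h) (s j) * cconj (ip (w k) (s j))).

(* v_j = iota^* U^* e_j *)
Definition vvec (j : nat) : 'cV[CC]_n := \col_(k < n) cconj (ip (w k) (s j)).

Definition uvec (j : nat) : H := Pperp (s j).

Variable p : nat -> R.

Definition is_distribution := (forall j, 0 <= p j) /\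
  (\sum_(0 <= j <oo) (p j)%:E = 1)%E.

Definition Rconst : \bar R :=
  ereal_sup [set ((cvnorm (vvec j) ^+ 2 / p j)%:E) | j in [set j | 0 < p j]].
Definition Rconst' : \bar R :=
  ereal_sup [set ((hnorm (uvec j) ^+ 2 / p j)%:E) | j in [set j | 0 < p j]].
Definition Rconst'' : R := Num.max (fine Rconst) (fine Rconst').

Definition Top (h : H) : H :=
  hlim (fun N => \sum_(j < N | 0 < p j) ip h (uvec j) *: uvec j).

Definition Kconst : R :=
  Num.max (opnorm (@cvnorm n) (@cvnorm n) (fun x => Sigma *m x))
          (opnorm hnorm hnorm Top).

Variable m : nat.

Definition Sigma_hat (om : m.-tuple nat) : 'M[CC]_n :=
  \matrix_(k < n, l < n) ((m%:R)^-1 * \sum_(t < m)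
     (Complex (p (tnth om t)) 0)^-1 * ip (w l) (s (tnth om t)) * cconj (ip (w k) (s (tnth om t)))).

Definition Gamma_hat (om : m.-tuple nat) (h : H) : 'cV[CC]_n :=
  \col_(k < n) ((m%:R)^-1 * \sum_(t < m)
     (Complex (p (tnth om t)) 0)^-1 * ip (Pperp h) (s (tnth om t)) * cconj (ip (w k) (s (tnth om t)))).

Definition K_nOmega (om : m.-tuple nat) : R :=
  opnorm hnorm hnorm (fun h => Wn (invmx (Sigma_hat om) *m Gamma_hat om h)).

Definition K_n : R := opnorm hnorm hnorm (fun h => Wn (invmx Sigma *m Gamma h)).

Definition prob_iid (E : set (m.-tuple nat)) : \bar R :=
  (\esum_(om in E) (\prod_(t < m) p (tnth om t))%:E)%E.

End Hilbert.
End Defs.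

(* Main.v *)
Require Import Defs.
From HB Require Import structures.
From mathcomp Require Import all_boot all_order all_algebra.
From mathcomp Require Import all_classical all_reals all_analysis.
From mathcomp Require Import complex.
From mathcomp Require Import ring lra.
From Stdlib Require Import ClassicalEpsilon.

(** The estimate is a matrix concentration bound whose dimension factor depends
    on [n] only, although [Gamma] acts on the infinite-dimensional space [H].

    For a symmetric [A] the exponential is replaced by [(1 + A/k)^k] with [k] a
    power of two.  The inequality [tr (XY)^k <= tr X^k Y^k] gives, up to an
    error [O(1/k)], the Golden-Thompson inequality, hence a recursion for the
    expected trace of the exponential of a sum of independent matrices.  The
    matrices are off-diagonal dilations, whose odd powers are trace free; with
    [V] the variance this gives [tr (exp S V) <= tr V + |V| tr (exp S - 1)], so
    the recursion only sees [tr V / |V|], which is of order [n].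

    Letters beyond a large [N] are merged into one letter of small mass, and
    the finitely many remaining [u_j] are replaced by their coordinates in an
    orthonormal family; thus only real matrices of finite size occur. *)

Set Implicit Arguments.
Unset Strict Implicit.
Unset Printing Implicit Defensive.

Import Order.TTheory GRing.Theory Num.Theory.
Local Open Scope ring_scope.

(** * A discrete Golden-Thompson inequality *)

(** The size of the dilations grows with [N], which depends on [eps] and [delta], so no final bound
    may contain it. The two diagonal blocks of V have the same trace, and for rank-one summands this
    trace is controlled by the sum of the squared norms of the v_j alone, a partial sum of the trace
    of Sigma, hence at most n K. The error of replacing exp by (1 + A/k)^k does contain the size; it
    disappears when k tends to infinity while the size and the number of samples stay fixed.

    Constants: with kappa = R'' K, deviation tau and Q = m tau^2 / kappa, scaling by tau / (2 kappa)
    yields a gain exp(Q/2) against a cost exp(Q/5), and 10/3 is the inverse of 1/2 - 1/5. The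
    accuracy is eps = Lambda sqrt(D) max(1, 2|Sigma^-1|)^2 tau. The failure probability delta is
    split into a quarter for Sigma, a quarter for Gamma and a half for drawing some letter beyond
    [N]. *)

Lemma trmxX (R : comPzRingType) d (A : 'M[R]_d) k : (A ^+ k)^T = A^T ^+ k.
Proof.
elim: k => [|k IH]; first by rewrite !expr0 trmx1.
by rewrite exprS exprSr -IH; exact: trmx_mul.
Qed.

Lemma mxtrace_expMC (R : comPzRingType) d (A B : 'M[R]_d) k :
  \tr ((A * B) ^+ k) = \tr ((B * A) ^+ k).
Proof.
case: k => [|k]; first by rewrite !expr0.
have E : (A * B) ^+ k.+1 = A * ((B * A) ^+ k * B).
  elim: k => [|k IH]; first by rewrite expr1 expr0 mul1r.
  by rewrite exprS IH [(B * A) ^+ k.+1]exprS !mulrA.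
by rewrite E exprSr [LHS]mxtrace_mulC; congr (\tr _); rewrite [LHS]/(_ * _) mulrA.
Qed.
Section S.
Variable R : realFieldType.

Lemma mxtrace_mul_tr m n (A : 'M[R]_(m, n)) : \tr (A *m A^T) = \sum_i \sum_j A i j ^+ 2.
Proof.
by apply: eq_bigr => i _; rewrite mxE; apply: eq_bigr => j _; rewrite mxE expr2.
Qed.

Lemma mxtrace_mul_tr_ge0 m n (A : 'M[R]_(m, n)) : 0 <= \tr (A *m A^T).
Proof.
by rewrite mxtrace_mul_tr; do 2![apply: sumr_ge0 => ? _]; exact: sqr_ge0.
Qed.

(** Twice the gap is the squared Frobenius norm of A - B^T. *)
Lemma mxtrace_amgm m n (A : 'M[R]_(m, n)) (B : 'M[R]_(n, m)) :
  \tr (A *m B) <= (\tr (A *m A^T) + \tr (B *m B^T)) / 2.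
Proof.
have := mxtrace_mul_tr_ge0 (A - B^T).
rewrite linearB /= trmxK mulmxBl !mulmxBr !linearB /=.
rewrite -trmx_mul mxtrace_tr (mxtrace_mulC B^T B); lra.
Qed.

(* Each half of the induction step uses the other half one step below. *)
Lemma golden_thompson_pow d r :
  (forall Z : 'M[R]_d, \tr (Z ^+ (2 ^ r.+1)) <= \tr ((Z * Z^T) ^+ (2 ^ r))) /\
  (forall X Y : 'M[R]_d, X^T = X -> Y^T = Y ->
     \tr ((X * Y) ^+ (2 ^ r)) <= \tr (X ^+ (2 ^ r) * Y ^+ (2 ^ r))).
Proof.
have half (t : R) : (t + t) / 2 = t by lra.
elim: r => [|r [IHZ IHXY]]; split.
- move=> Z; rewrite expn1 expn0 expr2 expr1.
  by apply: le_trans (mxtrace_amgm Z Z) _; rewrite half.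
- by move=> X Y _ _; rewrite expn0 !expr1.
- move=> Z; rewrite expnS exprM; apply: le_trans (IHZ _) _.
  have -> : Z ^+ 2 * (Z ^+ 2)^T = Z * (Z * Z^T * Z^T).
    by rewrite expr2 [(_ * _)^T]trmx_mul !mulrA.
  (* Cycling one factor [Z] turns Z^2 (Z^2)^T into the product of the symmetric matrices Z Z^T and
     Z^T Z, to which the second half applies; the two traces produced by [mxtrace_amgm] then
     coincide. *)
  rewrite mxtrace_expMC -[_ * Z^T * Z]mulrA.
  have sym (A : 'M[R]_d) : (A * A^T)^T = A * A^T by rewrite [LHS]trmx_mul trmxK.
  have symV (A : 'M[R]_d) : (A^T * A)^T = A^T * A by rewrite [LHS]trmx_mul trmxK.
  apply: le_trans (IHXY _ _ (sym Z) (symV Z)) _.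
  apply: le_trans (mxtrace_amgm _ _) _.
  rewrite !trmxX sym symV.
  have E (A : 'M[R]_d) k : A ^+ k *m A ^+ k = A ^+ (2 * k) by rewrite mul2n -addnn exprD.
  by rewrite !E -!expnS (mxtrace_expMC Z^T Z) half.
- move=> X Y sX sY.
  apply: le_trans (IHZ _) _.
  have -> : X * Y * (X * Y)^T = X * (Y ^+ 2 * X).
    by rewrite [(_ * _)^T]trmx_mul sX sY expr2 !mulrA.
  rewrite mxtrace_expMC -mulrA -expr2 mxtrace_expMC.
  apply: le_trans (IHXY _ _ _ _) _; rewrite ?trmxX ?sX ?sY //.
  by rewrite -!exprM -expnS.
Qed.
End S.

(** * Euclidean norms and operator norm bounds for real matrices *)

Section Norms.
Variable R : realFieldType.

Definition dotv d (x y : 'cV[R]_d) : R := \sum_i x i 0 * y i 0.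
Definition sqn d (x : 'cV[R]_d) : R := dotv x x.

Lemma dotvC d (x y : 'cV[R]_d) : dotv x y = dotv y x.
Proof. by apply: eq_bigr => i _; rewrite mulrC. Qed.

Lemma dotvDl d (x y z : 'cV[R]_d) : dotv (x + y) z = dotv x z + dotv y z.
Proof. by rewrite -big_split; apply: eq_bigr => i _; rewrite mxE mulrDl. Qed.

Lemma dotvZl d a (x z : 'cV[R]_d) : dotv (a *: x) z = a * dotv x z.
Proof. by rewrite mulr_sumr; apply: eq_bigr => i _; rewrite mxE mulrA. Qed.

Lemma dotvE d (x y : 'cV[R]_d) : dotv x y = \tr (x *m y^T).
Proof. by apply: eq_bigr => i _; rewrite mxE big_ord1 mxE. Qed.

Lemma dotv_mulmxl m n (A : 'M[R]_(m, n)) x y : dotv (A *m x) y = dotv x (A^T *m y).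
Proof. by rewrite !dotvE trmx_mul trmxK -mulmxA mxtrace_mulC mulmxA. Qed.

Lemma sqn_ge0 d (x : 'cV[R]_d) : 0 <= sqn x.
Proof. by apply: sumr_ge0 => i _; rewrite -expr2 sqr_ge0. Qed.

Lemma sqn0 d : sqn (0 : 'cV[R]_d) = 0.
Proof. by apply: big1 => i _; rewrite mxE mul0r. Qed.

Lemma sqn_eq0 d (x : 'cV[R]_d) : (sqn x == 0) = (x == 0).
Proof.
apply/eqP/eqP => [x0|->]; last exact: sqn0.
apply/matrixP => i j; rewrite (ord1 j) mxE.
have := x0 => /psumr_eq0P H; apply/eqP; rewrite -sqrf_eq0 expr2; apply/eqP.
by apply: H => // k _; rewrite -expr2 sqr_ge0.
Qed.

Lemma sqnZ d a (x : 'cV[R]_d) : sqn (a *: x) = a ^+ 2 * sqn x.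
Proof. by rewrite /sqn dotvZl dotvC dotvZl mulrA. Qed.

Lemma sqnD d (x y : 'cV[R]_d) : sqn (x + y) = sqn x + 2 * dotv x y + sqn y.
Proof. by rewrite /sqn dotvDl !(dotvC _ (_ + _)) !dotvDl (dotvC y x); ring. Qed.

Lemma dotv_cauchy d (x y : 'cV[R]_d) : dotv x y ^+ 2 <= sqn x * sqn y.
Proof.
have [/eqP|y0] := eqVneq (sqn y) 0.
  rewrite sqn_eq0 => /eqP->; rewrite sqn0 mulr0 /dotv big1 ?expr0n // => i _.
  by rewrite mxE mulr0.
have := sqn_ge0 (sqn y *: x + - dotv x y *: y).
rewrite sqnD !sqnZ dotvZl [dotv x (_ *: _)]dotvC dotvZl (dotvC y x).
have -> : forall a b c : R, a ^+ 2 * c + 2 * (a * (- b * b)) + (- b) ^+ 2 * a = a * (c * a - b ^+ 2).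
  by move=> a b c; ring.
by rewrite pmulr_rge0 ?subr_ge0 // lt_neqAle eq_sym y0 sqn_ge0.
Qed.

(** An operator norm bound by |c|, kept in squared form because an ordered field need not contain
    square roots. *)
Definition lip m n (A : 'M[R]_(m, n)) (c : R) := forall z, sqn (A *m z) <= c ^+ 2 * sqn z.

Lemma lip1 d : lip (1%:M : 'M[R]_d) 1.
Proof. by move=> z; rewrite mul1mx expr1n mul1r. Qed.

Lemma lipM m n q (A : 'M[R]_(m, n)) (B : 'M[R]_(n, q)) a b :
  lip A a -> lip B b -> lip (A *m B) (a * b).
Proof.
move=> hA hB z; rewrite -mulmxA; apply: le_trans (hA _) _.
by rewrite exprMn -[_ * _ * sqn z]mulrA ler_wpM2l ?sqr_ge0.
Qed.

(** Minkowski's inequality without square roots; [c] stands for the squared norm of the common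
    argument. *)
Lemma sqnD_le d (x y : 'cV[R]_d) a b c : 0 <= a -> 0 <= b -> 0 <= c ->
  sqn x <= a ^+ 2 * c -> sqn y <= b ^+ 2 * c -> sqn (x + y) <= (a + b) ^+ 2 * c.
Proof.
move=> a0 b0 c0 hx hy.
have h : dotv x y <= a * b * c.
  rewrite (le_trans (ler_norm _)) // -(@ler_pXn2r _ 2) ?nnegrE ?mulr_ge0 //.
  rewrite -normrX ger0_norm ?sqr_ge0 // (le_trans (dotv_cauchy _ _)) //.
  have -> : (a * b * c) ^+ 2 = (a ^+ 2 * c) * (b ^+ 2 * c) by ring.
  by rewrite ler_pM ?sqn_ge0.
rewrite sqnD; lra.
Qed.

Lemma lipD m n (A B : 'M[R]_(m, n)) a b : 0 <= a -> 0 <= b ->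
  lip A a -> lip B b -> lip (A + B) (a + b).
Proof. by move=> a0 b0 hA hB z; rewrite mulmxDl sqnD_le ?sqn_ge0. Qed.

Lemma lipZ m n (A : 'M[R]_(m, n)) a c : lip A a -> lip (c *: A) (c * a).
Proof. by move=> hA z; rewrite -scalemxAl sqnZ exprMn -[_ * _ * sqn z]mulrA ler_wpM2l ?sqr_ge0. Qed.

Lemma lip0 m n c : lip (0 : 'M[R]_(m, n)) c.
Proof. by move=> z; rewrite mul0mx sqn0 mulr_ge0 ?sqr_ge0 ?sqn_ge0. Qed.

Lemma lipX d (A : 'M[R]_d) a k : lip A a -> lip (A ^+ k) (a ^+ k).
Proof.
by move=> hA; elim: k => [|k IH]; [exact: lip1|rewrite !exprS; exact: lipM].
Qed.

Lemma lip_sum m n (I : finType) (P : pred I) (A : I -> 'M[R]_(m, n)) (a : I -> R) :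
  (forall i, P i -> 0 <= a i) -> (forall i, P i -> lip (A i) (a i)) ->
  lip (\sum_(i | P i) A i) (\sum_(i | P i) a i).
Proof.
move=> a0 hA.
suff [] : 0 <= \sum_(i | P i) a i /\ lip (\sum_(i | P i) A i) (\sum_(i | P i) a i) by [].
apply: (big_ind2 (fun x y => 0 <= x /\ lip y x)) => [|x1 x2 y1 y2 [? ?] [? ?]|i Pi].
- by split=> //; exact: lip0.
- by split; [exact: addr_ge0|exact: lipD].
- by split; [exact: a0|exact: hA].
Qed.

Lemma sqn_delta d (i : 'I_d) : sqn (delta_mx i 0 : 'cV[R]_d) = 1.
Proof.
rewrite /sqn /dotv (bigD1 i) //= mxE !eqxx mulr1 big1 ?addr0 // => j ji.
by rewrite mxE (negbTE ji) mul0r.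
Qed.

Lemma lip_mxtrace d (A : 'M[R]_d) a : 0 <= a -> lip A a -> `|\tr A| <= d%:R * a.
Proof.
move=> a0 hA; apply: le_trans (ler_norm_sum _ _ _) _.
rewrite -[d in d%:R]card_ord mulr_natl -sumr_const.
apply: ler_sum => i _.
rewrite -(@ler_pXn2r _ 2) ?nnegrE ?normr_ge0 // -normrX ger0_norm ?sqr_ge0 //.
have := hA (delta_mx i 0); rewrite sqn_delta mulr1; apply: le_trans.
rewrite -colE /sqn /dotv (bigD1 i) //= mxE -expr2 lerDl.
by apply: sumr_ge0 => j _; rewrite -expr2 sqr_ge0.
Qed.

Lemma lip_le m n (A : 'M[R]_(m, n)) a b : 0 <= a -> a <= b -> lip A a -> lip A b.
Proof.
move=> a0 ab hA z; apply: le_trans (hA z) _.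
by rewrite ler_wpM2r ?sqn_ge0 // lerXn2r // nnegrE // (le_trans a0).
Qed.

Lemma sqn_tr m n (A : 'M[R]_(m, n)) : \tr (A^T *m A) = \sum_j sqn (A *m delta_mx j 0).
Proof.
apply: eq_bigr => j _; rewrite -colE mxE; apply: eq_bigr => i _.
by rewrite !mxE.
Qed.

(** A mean value estimate. The exponent [k] in place of k - 1 on the right is harmless since 1 <=
    x. *)
Lemma subX_le (x y : R) k : 0 <= y -> y <= x -> 1 <= x -> x ^+ k - y ^+ k <= k%:R * (x - y) * x ^+ k.
Proof.
move=> y0 yx x1; elim: k => [|k IH]; first by rewrite !expr0 subrr mulr0n !mul0r.
have -> : x ^+ k.+1 - y ^+ k.+1 = x * (x ^+ k - y ^+ k) + (x - y) * y ^+ k.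
  by rewrite !exprS; ring.
have h1 : x * (x ^+ k - y ^+ k) <= k%:R * (x - y) * x ^+ k.+1.
  by rewrite exprS mulrCA ler_wpM2l // (le_trans _ x1).
have h2 : (x - y) * y ^+ k <= (x - y) * x ^+ k.+1.
  rewrite ler_wpM2l ?subr_ge0 // (@le_trans _ _ (x ^+ k)) //.
    by rewrite lerXn2r // nnegrE // (le_trans y0).
  by rewrite exprS ler_peMl // exprn_ge0 // (le_trans _ x1).
rewrite -natr1; lra.
Qed.

(** The noncommuting matrices satisfy the recursion of the scalars g and e, so the difference of
    powers is bounded by its scalar counterpart. It will measure the cost of dropping the
    second-order term of (1 + A/k)(1 + B/k). *)
Lemma lip_subX d (G E : 'M[R]_d) (g e : R) k : 0 <= g -> 0 <= e ->
  lip G g -> lip E e -> lip ((G + E) ^+ k - G ^+ k) ((g + e) ^+ k - g ^+ k).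
Proof.
move=> g0 e0 hG hE; elim: k => [|k IH].
  by rewrite !expr0 !subrr; exact: lip0.
have -> : (G + E) ^+ k.+1 - G ^+ k.+1 = (G + E) *m ((G + E) ^+ k - G ^+ k) + E *m G ^+ k.
  rewrite [_ *m (_ - _)]mulrBr [E *m _]/(E * _) !exprS mulrDl [(G + E) * G ^+ k]mulrDl.
  by rewrite opprD addrA addrNK.
have -> : (g + e) ^+ k.+1 - g ^+ k.+1 = (g + e) * ((g + e) ^+ k - g ^+ k) + e * g ^+ k.
  by rewrite !exprS; ring.
have le : g ^+ k <= (g + e) ^+ k by rewrite lerXn2r ?nnegrE ?addr_ge0 // lerDl.
have ge : 0 <= g + e by rewrite addr_ge0.
apply: lipD; rewrite ?mulr_ge0 ?subr_ge0 ?exprn_ge0 //.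
  by apply: lipM => //; exact: lipD.
by apply: lipM => //; exact: lipX.
Qed.
End Norms.

(** * Polynomial approximations of the exponential *)

Section Fk.
Variable R : realType.

Definition expk d k (A : 'M[R]_d) := (1 + k%:R^-1 *: A) ^+ k.

Definition expk_coef k j : R := 'C(k, j)%:R * k%:R^-1 ^+ j.

Lemma expk_coef_ge0 k j : 0 <= expk_coef k j.
Proof. by rewrite mulr_ge0 ?exprn_ge0 ?invr_ge0. Qed.

Lemma scalemxX d a (A : 'M[R]_d) k : (a *: A) ^+ k = a ^+ k *: A ^+ k.
Proof.
elim: k => [|k IH]; first by rewrite !expr0 scale1r.
by rewrite !exprS IH /GRing.mul /= -scalemxAr -scalemxAl scalerA mulrC.
Qed.

Lemma expkE d k (A : 'M[R]_d) : expk k A = \sum_(j < k.+1) expk_coef k j *: A ^+ j.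
Proof.
rewrite /expk exprDn_comm; last exact/commr_sym/commr1.
apply: eq_bigr => j _; rewrite expr1n mul1r scalemxX -scaler_nat scalerA.
by [].
Qed.

Lemma expk_scalarE k (x : R) : (1 + k%:R^-1 * x) ^+ k = \sum_(j < k.+1) expk_coef k j * x ^+ j.
Proof.
rewrite exprDn; apply: eq_bigr => j _.
by rewrite expr1n mul1r exprMn -mulr_natl mulrA.
Qed.

Lemma expk_scalar_le k (x : R) : (0 < k)%N -> - k%:R <= x -> (1 + k%:R^-1 * x) ^+ k <= expR x.
Proof.
move=> k0 hx; have k0' : (0 : R) < k%:R by rewrite ltr0n.
have h : 0 <= 1 + k%:R^-1 * x.
  by rewrite -(pmulr_rge0 _ k0') mulrDr mulr1 mulVKf ?gt_eqF //; lra.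
have -> : expR x = expR (k%:R^-1 * x) ^+ k.
  by rewrite -expRM_natl mulVKf ?gt_eqF.
by rewrite lerXn2r ?nnegrE ?expR_ge0 // expR_ge1Dx.
Qed.

(** Put y = x/k. Since (1 + y)(1 - y + y^2) = 1 + y^3 >= 1, and exp(-u) >= 1 - u for u = y - y^2,
    one gets exp(y - y^2) <= 1 + y. The k-th power loses the factor exp(-k y^2) >= 1 - x^2/k. *)
Lemma expk_scalar_ge k (x : R) : (0 < k)%N -> 0 <= x ->
  expR x * (1 - x ^+ 2 / k%:R) <= (1 + k%:R^-1 * x) ^+ k.
Proof.
move=> k0 x0; have k0' : (0 : R) < k%:R by rewrite ltr0n.
set y := k%:R^-1 * x; have y0 : 0 <= y by rewrite mulr_ge0 // invr_ge0 ltW.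
have h : expR (y - y ^+ 2) <= 1 + y.
  have : 1 - (y - y ^+ 2) <= expR (- (y - y ^+ 2)) by exact: expR_ge1Dx.
  rewrite expRN => h.
  have e0 := expR_gt0 (y - y ^+ 2).
  have : (1 - (y - y ^+ 2)) * expR (y - y ^+ 2) <= 1.
    by rewrite -(@ler_pM2r _ (expR (y - y ^+ 2))^-1) ?invr_gt0 // -mulrA divff ?gt_eqF // mulr1 mul1r.
  move=> h1; have [h2|h2] := leP (expR (y - y ^+ 2)) (1 + y) => //.
  have q0 : 0 < 1 - (y - y ^+ 2) by nra.
  have h3 : 0 < (1 - (y - y ^+ 2)) * (expR (y - y ^+ 2) - (1 + y)) by rewrite mulr_gt0 // subr_gt0.
  have : 0 <= y ^+ 3 by rewrite exprn_ge0.
  nra.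
have -> : expR x * (1 - x ^+ 2 / k%:R) = expR (k%:R * y) * (1 - k%:R * y ^+ 2).
  by rewrite /y; congr (expR _ * (1 - _)); field; rewrite gt_eqF.
apply: (@le_trans _ _ (expR (y - y ^+ 2) ^+ k)); last first.
  by rewrite lerXn2r ?nnegrE ?expR_ge0 ?addr_ge0.
rewrite -expRM_natl [leRHS]/= [k%:R * (y - _)]mulrBr expRD ler_pM2l ?expR_gt0 //.
exact: expR_ge1Dx.
Qed.

(** The trace inequality bounds tr (XY)^k for X = 1 + A/k and Y = 1 + B/k, whereas XY = 1 + (A +
    B)/k + AB/k^2. Removing the term AB/k^2 by [lip_subX] changes the k-th power by O(1/k) in
    operator norm, and the trace costs a factor [d]. *)
Lemma expk_add_le d r (A B : 'M[R]_d) (a b : R) : A^T = A -> B^T = B ->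
  0 <= a -> 0 <= b -> lip A a -> lip B b ->
  \tr (expk (2 ^ r) (A + B)) <=
  \tr (expk (2 ^ r) A * expk (2 ^ r) B) +
  d%:R * (a * b) * expR (a + b + a * b) / (2 ^ r)%:R.
Proof.
move=> sA sB a0 b0 hA hB; set k := (2 ^ r)%N.
have k0n : (0 < k)%N by rewrite expn_gt0.
have k0 : (0 : R) < k%:R by rewrite ltr0n.
set X := 1 + k%:R^-1 *: A; set Y := 1 + k%:R^-1 *: B.
have sX : X^T = X by rewrite linearD linearZ /= sA trmx1.
have sY : Y^T = Y by rewrite linearD linearZ /= sB trmx1.
have GT := (golden_thompson_pow R d r).2 X Y sX sY; rewrite -/k in GT.
set G := 1 + k%:R^-1 *: (A + B); set E := k%:R^-1 ^+ 2 *: (A * B).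
have XY : X * Y = G + E.
  rewrite mulrDl mul1r mulrDr mulr1 /G /E scalerDr -!addrA; congr (_ + _).
  rewrite addrCA; congr (_ + (_ + _)).
  by rewrite /GRing.mul /= -scalemxAr -scalemxAl scalerA.
set u := a + b + a * b.
have u0 : 0 <= u by rewrite /u !addr_ge0 // mulr_ge0.
set g := 1 + k%:R^-1 * (a + b); set e := k%:R^-1 ^+ 2 * (a * b).
have ki0 : 0 <= k%:R^-1 :> R by rewrite invr_ge0 ltW.
have g1 : 1 <= g by rewrite lerDl mulr_ge0 // addr_ge0.
have g0 : 0 <= g by exact: le_trans g1.
have e0 : 0 <= e by rewrite mulr_ge0 ?exprn_ge0 // mulr_ge0.
have lG : lip G g.
  by apply: lipD; rewrite ?mulr_ge0 ?addr_ge0 //; [exact: lip1|apply/lipZ/lipD].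
have lE : lip E e by apply/lipZ/lipM.
have ge0 : 0 <= g + e by exact: addr_ge0.
have le1 : g ^+ k <= (g + e) ^+ k by apply: lerXn2r; rewrite ?nnegrE // lerDl.
have := lip_mxtrace _ (lip_subX k g0 e0 lG lE).
rewrite subr_ge0 => /(_ le1); rewrite -XY linearB /= => h1.
have : \tr ((X * Y) ^+ k) - \tr (G ^+ k) >= - (d%:R * ((g + e) ^+ k - g ^+ k)).
  by move: h1; rewrite ler_norml => /andP[].
have : (g + e) ^+ k - g ^+ k <= a * b * expR u / k%:R.
  have gge : g <= g + e by rewrite lerDl.
  apply: le_trans (subX_le k g0 gge (le_trans g1 gge)) _.
  have -> : k%:R * (g + e - g) = a * b / k%:R.
    by rewrite /e /g; field; rewrite gt_eqF.
  rewrite -!mulrA [_^-1 * (_ ^+ _)]mulrC !mulrA ler_wpM2r // ler_wpM2l ?mulr_ge0 //.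
  apply: le_trans (expk_scalar_le k0n _); last first.
    by apply: le_trans u0; rewrite oppr_le0 ltW.
  apply: lerXn2r; rewrite ?nnegrE //; first by rewrite addr_ge0 // mulr_ge0.
  rewrite /g /e /u -addrA lerD2l (mulrDr _ (a + b)) lerD2l ler_wpM2r ?mulr_ge0 //.
  by rewrite expr2 ler_piMl // invf_le1 // ler1n.
move=> h2 h3.
have h4 : d%:R * ((g + e) ^+ k - g ^+ k) <= d%:R * (a * b * expR u / k%:R) by rewrite ler_wpM2l.
have -> : d%:R * (a * b) * expR u / k%:R = d%:R * (a * b * expR u / k%:R) by rewrite !mulrA.
rewrite /expk -/X -/Y -/G; lra.
Qed.
End Fk.

(** * Second-order trace bounds and the cancellation of odd powers *)

Section Core.
Variable R : realType.

Lemma mxtrace_quad m n (M : 'M[R]_m) (B : 'M[R]_(m, n)) :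
  \tr (B^T *m M *m B) = \sum_j dotv (B *m delta_mx j 0) (M *m (B *m delta_mx j 0)).
Proof.
apply: eq_bigr => j _; rewrite -colE -mulmxA mxE; apply: eq_bigr => i _.
by rewrite !mxE; congr (_ * _); apply: eq_bigr => l _; rewrite !mxE.
Qed.

Lemma mxtrace_quad_le m n (M : 'M[R]_m) (B : 'M[R]_(m, n)) c : 0 <= c -> lip M c ->
  \tr (B^T *m M *m B) <= c * \tr (B^T *m B).
Proof.
move=> c0 hM; rewrite mxtrace_quad sqn_tr mulr_sumr; apply: ler_sum => j _.
set y := B *m _; rewrite (le_trans (ler_norm _)) //.
rewrite -(@ler_pXn2r _ 2) ?nnegrE ?normr_ge0 ?mulr_ge0 ?sqn_ge0 //.
rewrite -normrX ger0_norm ?sqr_ge0 // (le_trans (dotv_cauchy _ _)) //.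
by rewrite exprMn expr2 [sqn y ^+ 2]expr2 mulrCA ler_wpM2l ?sqn_ge0 // -expr2.
Qed.

(** exp(-1/16) >= 15/16 raised to the eighth power gives exp(1/2) <= (16/15)^8 < 1.68. *)
Lemma expR_half_le : expR (2^-1 : R) <= 17 / 10.
Proof.
have h : 15 / 16 <= expR (- (16^-1) : R) by apply: le_trans (expR_ge1Dx _); lra.
have : (15 / 16) ^+ 8 <= expR (- (16^-1) : R) ^+ 8 by rewrite lerXn2r ?nnegrE ?expR_ge0 //; lra.
rewrite -expRM_natl (_ : 8%:R * - 16^-1 = - 2^-1); last by lra.
rewrite expRN => h1; have e0 := expR_gt0 (2^-1 : R).
have : (15 / 16) ^+ 8 * expR (2^-1 : R) <= 1.
  by rewrite -(@ler_pM2r _ (expR (2^-1 : R))^-1) ?invr_gt0 // -mulrA divff ?gt_eqF // mulr1 mul1r.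
lra.
Qed.

Lemma expk_coef0 k : expk_coef R k 0 = 1.
Proof. by rewrite /expk_coef bin0 expr0 mulr1. Qed.

Lemma expk_coef1 k : (0 < k)%N -> expk_coef R k 1 = 1.
Proof. by move=> k0; rewrite /expk_coef bin1 expr1 divff // pnatr_eq0 -lt0n. Qed.

(** The trace form of exp X <= 1 + X + (4/5) X^2 for |X| <= 1/2, where 4/5 = 4 (17/10 - 3/2). The
    even exponent makes [expk K S] the square of a symmetric [G]; the remainder X M X then appears
    as (XG)^T M (XG), and a norm bound on [M] passes through the trace. *)
Lemma expk_bernstein d k (S X : 'M[R]_d) : S^T = S -> X^T = X -> lip X 2^-1 ->
  \tr (expk k.+1.*2 S * expk k.+1.*2 X) <=
  \tr (expk k.+1.*2 S) + \tr (expk k.+1.*2 S * X) + 4 / 5 * \tr (expk k.+1.*2 S * (X * X)).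
Proof.
move=> sS sX hX; set K := k.+1.*2.
set G := (1 + K%:R^-1 *: S) ^+ k.+1.
have FG : expk K S = G * G by rewrite /expk /G -exprD addnn.
have sG : G^T = G by rewrite trmxX linearD linearZ /= sS trmx1.
set M := \sum_(j < k.*2.+1) expk_coef R K j.+2 *: X ^+ j.
have FX : expk K X = 1 + X + X * M * X.
  rewrite expkE big_ord_recl big_ord_recl /= expk_coef0 expk_coef1 //.
  rewrite !scale1r expr0 expr1 addrA; congr (_ + _).
  rewrite mulr_sumr mulr_suml; apply: eq_bigr => j _.
  rewrite /bump /= !add1n exprS exprSr /GRing.mul /= -scalemxAr -scalemxAl mulmxA.
  by [].
set c := \sum_(j < k.*2.+1) expk_coef R K j.+2 * 2^-1 ^+ j.
have c0 j : 0 <= expk_coef R K j.+2 * 2^-1 ^+ j.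
  by rewrite mulr_ge0 ?expk_coef_ge0 // exprn_ge0.
have lM : lip M c.
  by apply: lip_sum => // j _; apply/lipZ/lipX.
(* [c / 4] is the tail of [(1 + x/K)^K] at [x = 1/2], at most [e^(1/2) - 3/2]. *)
have c45 : c <= 4 / 5.
  have := @expk_scalar_le R K 2^-1 isT; rewrite expk_scalarE.
  rewrite big_ord_recl big_ord_recl /= expk_coef0 expk_coef1 // expr0 expr1.
  have -> : \sum_(i < k.*2.+1) expk_coef R K (bump 0 (bump 0 i)) * 2^-1 ^+ bump 0 (bump 0 i) = c / 4.
    rewrite mulr_suml; apply: eq_bigr => j _; rewrite /bump /= !add1n !exprS.
    by field.
  have K0 : 0 <= K%:R :> R by rewrite ler0n.
  have := expR_half_le; move=> h1 h2.
  have : 1 * 1 + (1 * 2^-1 + c / 4) <= expR (2^-1 : R) by apply: h2; lra.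
  lra.
have {}lM : lip M (4 / 5) by apply: lip_le c45 lM; apply: sumr_ge0 => j _.
rewrite FX !mulrDr mulr1 !raddfD /= -!addrA !lerD2l.
have -> : \tr (expk K S * (X * M * X)) = \tr ((X *m G)^T *m M *m (X *m G)).
  by rewrite trmx_mul sX sG FG /GRing.mul /= !mulmxA [RHS]mxtrace_mulC !mulmxA.
have -> : \tr (expk K S * (X * X)) = \tr ((X *m G)^T *m (X *m G)).
  by rewrite trmx_mul sX sG FG /GRing.mul /= !mulmxA [RHS]mxtrace_mulC !mulmxA.
apply: mxtrace_quad_le => //; lra.
Qed.

Section Flip.
Variables (d : nat) (J : 'M[R]_d).
Hypothesis JJ : J * J = 1.

(** Conjugation by the involution [J] preserves the trace but sends [A] to its opposite. *)
Lemma mxtrace_anticomm (A : 'M[R]_d) : J * A = - (A * J) -> \tr A = 0.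
Proof.
move=> h; have : \tr A = - \tr A.
  rewrite -{1}[A]mul1r -JJ -mulrA h mulrN raddfN /=.
  congr (- _); transitivity (\tr (J * (J * A)));
    first by rewrite (mulrA J A J); exact: (mxtrace_mulC (J * A) J).
  by rewrite mulrA JJ mul1r.
lra.
Qed.

Variable S : 'M[R]_d.
Hypotheses (sS : S^T = S) (JS : J * S = - (S * J)).

Lemma anticommX j : J * S ^+ j = (-1) ^+ odd j *: (S ^+ j * J).
Proof.
elim: j => [|j IH]; first by rewrite !expr0 mulr1 mul1r scale1r.
rewrite exprS mulrA JS mulNr -(mulrA S J) IH /=.
rewrite /GRing.mul /= -scalemxAr mulmxA; case: (odd j) => /=; rewrite ?expr0 ?expr1.
  by rewrite scaleN1r opprK scale1r.
by rewrite scale1r scaleN1r.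
Qed.

Lemma mxtrace_odd (V : 'M[R]_d) j : J * V = V * J -> odd j -> \tr (S ^+ j * V) = 0.
Proof.
move=> JV oj; apply: mxtrace_anticomm.
by rewrite mulrA anticommX oj expr1 scaleN1r mulNr -!mulrA JV.
Qed.

Lemma mxtraceX_odd j : odd j -> \tr (S ^+ j) = 0.
Proof. by move=> oj; rewrite -[S ^+ j]mulr1 mxtrace_odd // mulr1 mul1r. Qed.

Lemma trX i : (S ^+ i)^T = S ^+ i. Proof. by rewrite trmxX sS. Qed.

Lemma mxtraceX_even i : \tr (S ^+ i.*2) = \sum_j sqn (S ^+ i *m delta_mx j 0).
Proof. by rewrite -sqn_tr trX -addnn exprD. Qed.

Lemma mxtraceX_ge0 j : 0 <= \tr (S ^+ j).
Proof.
have [oj|ej] := boolP (odd j); first by rewrite mxtraceX_odd.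
rewrite -(even_halfK ej) mxtraceX_even; apply: sumr_ge0 => l _; exact: sqn_ge0.
Qed.

Lemma expk_mxtrace_sub k : \tr (expk k S) - d%:R =
  \sum_(j < k) expk_coef R k j.+1 * \tr (S ^+ j.+1).
Proof.
rewrite expkE big_ord_recl /= expk_coef0 scale1r expr0 raddfD /= mxtrace1 addrC addKr.
by rewrite raddf_sum /=; apply: eq_bigr => j _; rewrite mxtraceZ.
Qed.

Lemma expk_mxtrace_sub_ge0 k : 0 <= \tr (expk k S) - d%:R.
Proof.
rewrite expk_mxtrace_sub; apply: sumr_ge0 => j _.
by rewrite mulr_ge0 ?expk_coef_ge0 ?mxtraceX_ge0.
Qed.

(* The odd powers of [S] contribute nothing since [S] anticommutes with [J]. *)
Lemma expk_mxtrace_mul_le k (V : 'M[R]_d) v mu : J * V = V * J ->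
  (forall z, dotv z (V *m z) <= v * sqn z) -> \tr V <= mu * v ->
  \tr (expk k S * V) <= mu * v + v * (\tr (expk k S) - d%:R).
Proof.
move=> JV hV trV; rewrite expk_mxtrace_sub expkE mulr_suml raddf_sum big_ord_recl /=.
have E (c : R) (A : 'M[R]_d) : (c *: A) * V = c *: (A * V) by rewrite -[LHS]scalemxAl.
rewrite expk_coef0 scale1r expr0 mul1r lerD // mulr_sumr ler_sum // => j _.
rewrite E mxtraceZ mulrCA ler_wpM2l ?expk_coef_ge0 //.
set l := bump 0 j; rewrite -[j.+1]/l.
have [ol|el] := boolP (odd l); first by rewrite mxtrace_odd // mxtraceX_odd // mulr0.
rewrite -(even_halfK el) mxtraceX_even -addnn exprD -mulrA.
have -> : \tr (S ^+ l./2 * (S ^+ l./2 * V)) = \tr ((S ^+ l./2)^T *m V *m S ^+ l./2).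
  by rewrite trX /GRing.mul /= [RHS]mxtrace_mulC !mulmxA.
by rewrite mxtrace_quad mulr_sumr ler_sum.
Qed.

End Flip.
End Core.

(** * Matrix Bernstein inequality with intrinsic dimension *)

Lemma big_tuple_cons (V : nmodType) (I : finType) t (f : t.+1.-tuple I -> V) :
  \sum_om f om = \sum_i \sum_(om : t.-tuple I) f [tuple of i :: om].
Proof.
rewrite pair_bigA /=.
rewrite (reindex (fun x : I * t.-tuple I => [tuple of x.1 :: x.2])) //=.
exists (fun om => (thead om, [tuple of behead om])) => [[i om] _|om _] /=.
  by congr (_, _); apply: val_inj.
by rewrite -tuple_eta.
Qed.

Lemma sum_tuple_prod (R : comNzRingType) (I : finType) (q : I -> R) t :
  \sum_(om : t.-tuple I) \prod_j q (tnth om j) = (\sum_i q i) ^+ t.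
Proof.
elim: t => [|t IH].
  rewrite (big_pred1 [tuple]); last by move=> om; rewrite (tuple0 om) /= eqxx.
  by rewrite big_ord0 expr0.
rewrite big_tuple_cons exprS -IH mulr_suml; apply: eq_bigr => i _.
rewrite mulr_sumr; apply: eq_bigr => om _.
by rewrite big_ord_recl tnth0; congr (_ * _); apply: eq_bigr => j _; rewrite tnthS.
Qed.

Section Matrix_Bernstein.
Variable R : realType.

(** This replaces an eigenvector argument. For symmetric [S], Cauchy-Schwarz gives |S^(i+1) z|^2 <=
    |S^i z| |S^(i+2) z|, so the growth ratios of the norms never decrease and the first ratio bounds
    all of them from below. *)
Lemma sqnX_growth d (S : 'M[R]_d) z (x : R) i : S^T = S -> 0 < sqn z ->
  x ^+ 2 * sqn z <= sqn (S *m z) -> 0 < x ->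
  (x ^+ 2) ^+ i * sqn z <= sqn (S ^+ i *m z).
Proof.
move=> sS z0 hz x0; have x20 : 0 < x ^+ 2 by rewrite exprn_gt0.
suff [] : 0 < sqn (S ^+ i *m z) /\ (x ^+ 2) ^+ i * sqn z <= sqn (S ^+ i *m z) /\
    x ^+ 2 * sqn (S ^+ i *m z) <= sqn (S ^+ i.+1 *m z) by move=> _ [].
elim: i => [|i [p0 [IH1 IH2]]]; first by rewrite !expr0 mul1mx mul1r expr1.
have p1 : 0 < sqn (S ^+ i.+1 *m z) by apply: lt_le_trans IH2; rewrite mulr_gt0.
split=> //; split.
  by apply: le_trans IH2; rewrite exprS -mulrA ler_pM2l.
have cs := dotv_cauchy (S ^+ i *m z) (S ^+ i.+2 *m z).
have E : dotv (S ^+ i *m z) (S ^+ i.+2 *m z) = sqn (S ^+ i.+1 *m z).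
  have -> : S ^+ i.+2 *m z = S^T *m (S ^+ i.+1 *m z) by rewrite sS mulmxA [S ^+ i.+2]exprS.
  by rewrite -dotv_mulmxl mulmxA [S ^+ i.+1]exprS.
rewrite E in cs; set a := sqn (S ^+ i *m z) in cs p0 IH2 *; set b := sqn (S ^+ i.+1 *m z) in cs p1 IH2 *.
rewrite -(ler_pM2l p0); apply: le_trans cs.
by rewrite mulrA [a * _]mulrC expr2 ler_pM2r.
Qed.

(** tr S^(2i) is the squared Frobenius norm of S^i, which dominates |S^i z|^2 / |z|^2. *)
Lemma mxtrace_even_ge d (S : 'M[R]_d) z (x : R) i : S^T = S -> 0 < sqn z ->
  x ^+ 2 * sqn z <= sqn (S *m z) -> 0 < x -> x ^+ i.*2 <= \tr (S ^+ i.*2).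
Proof.
move=> sS z0 hz x0; have := sqnX_growth i sS z0 hz x0.
set T := S ^+ i; have sT : T^T = T by rewrite trX.
have -> : S ^+ i.*2 = T *m T^T by rewrite sT -addnn exprD.
rewrite -exprM mul2n => h; rewrite -(ler_pM2r z0); apply: le_trans h _.
rewrite mxtrace_mul_tr mulr_suml; apply: ler_sum => l _.
have := dotv_cauchy (row l T)^T z.
have -> : dotv (row l T)^T z = (T *m z) l 0.
  by rewrite mxE; apply: eq_bigr => j _; rewrite !mxE.
rewrite -expr2; move=> h1; apply: (le_trans h1); rewrite ler_wpM2r ?sqn_ge0 //.
by apply: ler_sum => j _; rewrite !mxE expr2.
Qed.

(** Odd powers have trace zero, so only the even part of (1 + x/k)^k is available. It is at least
    half of the whole since (1 - x/k)^k >= 0 for even [k]; the -1 is the constant term, which is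
    removed together with [d]. *)
Lemma expk_mxtrace_ge d (J S : 'M[R]_d) z (x : R) k : S^T = S -> J * J = 1 ->
  J * S = - (S * J) -> 0 < sqn z -> x ^+ 2 * sqn z <= sqn (S *m z) -> 0 < x ->
  ~~ odd k ->
  (1 + k%:R^-1 * x) ^+ k / 2 - 1 <= \tr (expk k S) - d%:R.
Proof.
move=> sS JJ JS z0 hz x0 ek.
have h : \sum_(j < k.+1 | ~~ odd j) expk_coef R k j * x ^+ j - 1 <= \tr (expk k S) - d%:R.
  rewrite expk_mxtrace_sub // big_mkcond big_ord_recl /= expk_coef0 expr0 mulr1.
  rewrite [1 + _]addrC addrK; apply: ler_sum => j _; rewrite /bump /= add1n.
  case: ifP => ej; last by rewrite mulr_ge0 ?expk_coef_ge0 // (mxtraceX_ge0 JJ).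
  rewrite ler_wpM2l ?expk_coef_ge0 //.
  have ej' : ~~ odd j.+1 by [].
  by rewrite -(even_halfK ej') (mxtrace_even_ge _ sS z0).
apply: le_trans h; rewrite lerD2r.
have h1 := expk_scalarE k x; have := expk_scalarE k (- x).
have : 0 <= (1 + k%:R^-1 * - x) ^+ k.
  by rewrite -(even_halfK ek) -mul2n exprM exprn_ge0 ?sqr_ge0.
rewrite h1 => h2 h3; rewrite h3 in h2.
rewrite (bigID (fun j : 'I_k.+1 => ~~ odd j)) /=.
rewrite (bigID (fun j : 'I_k.+1 => ~~ odd j)) /= in h2.
move: h2.
rewrite (eq_bigr (fun j : 'I_k.+1 => expk_coef R k j * x ^+ j)); last first.
  by move=> j /negPf oj; rewrite exprNn -signr_odd oj expr0 mul1r.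
rewrite [X in _ + X](eq_bigr (fun j : 'I_k.+1 => - (expk_coef R k j * x ^+ j))); last first.
  by move=> j; rewrite negbK => oj; rewrite exprNn -signr_odd oj expr1 mulN1r mulrN.
rewrite sumrN; lra.
Qed.

Variables (d : nat) (I : finType) (p : I -> R) (X : I -> 'M[R]_d) (J : 'M[R]_d).
Hypotheses (p_ge0 : forall i, 0 <= p i) (p_sum : \sum_i p i = 1).
Hypotheses (symX : forall i, (X i)^T = X i) (JJ : J * J = 1).
Hypotheses (JX : forall i, J * X i = - (X i * J)) (lipX2 : forall i, lip (X i) 2^-1).
Hypothesis EX : \sum_i p i *: X i = 0.
Variables (v mu : R).
Hypotheses (v_ge0 : 0 <= v) (mu_ge0 : 0 <= mu).
Hypothesis varX : forall z, \sum_i p i * sqn (X i *m z) <= v * sqn z.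
Hypothesis trX2 : \sum_i p i * \tr (X i * X i) <= mu * v.

Definition tsum t (om : t.-tuple I) := \sum_j X (tnth om j).
Definition tprob t (om : t.-tuple I) := \prod_j p (tnth om j).

Lemma tsum_cons t i (om : t.-tuple I) : tsum [tuple of i :: om] = tsum om + X i.
Proof.
rewrite /tsum big_ord_recl tnth0 addrC; congr (_ + _); apply: eq_bigr => j _.
by congr X; rewrite tnthS.
Qed.

Lemma tprob_cons t i (om : t.-tuple I) : tprob [tuple of i :: om] = p i * tprob om.
Proof.
rewrite /tprob big_ord_recl tnth0; congr (_ * _); apply: eq_bigr => j _.
by congr p; rewrite tnthS.
Qed.

Lemma tprob_ge0 t (om : t.-tuple I) : 0 <= tprob om.
Proof. exact: prodr_ge0. Qed.

Lemma tprob_sum t : \sum_(om : t.-tuple I) tprob om = 1.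
Proof. by rewrite sum_tuple_prod p_sum expr1n. Qed.

Lemma tsum_sym t (om : t.-tuple I) : (tsum om)^T = tsum om.
Proof. by rewrite /tsum raddf_sum; apply: eq_bigr => j _; exact: symX. Qed.

Lemma tsum_anticomm t (om : t.-tuple I) : J * tsum om = - (tsum om * J).
Proof.
by rewrite /tsum mulr_sumr mulr_suml -sumrN; apply: eq_bigr => j _.
Qed.

Lemma tsum_lip t (om : t.-tuple I) : lip (tsum om) (t%:R / 2).
Proof.
have -> : t%:R / 2 = \sum_(j < t) 2^-1 :> R by rewrite sumr_const card_ord mulr_natl.
by apply: lip_sum => // j _.
Qed.

(** The expected trace of exp - 1. Without the subtraction the recursion over [t] would start at
    [d]; with it the recursion starts at 0 and is driven by [mu]. *)
Definition mgf k t := \sum_(om : t.-tuple I) tprob om * (\tr (expk k (tsum om)) - d%:R).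

(** Averaging over one new letter kills the linear term by [EX]. The quadratic term is handled by
    [expk_mxtrace_mul_le], as [J] anticommutes with each X_i and therefore commutes with X_i^2. The
    norm of [S] enters the error term only: for a = t/2 and b = 1/2 one has ab <= t and a + b + ab
    <= t + 1. *)
Lemma mgf_step r t (S : 'M[R]_d) : S^T = S -> J * S = - (S * J) -> lip S (t%:R / 2) ->
  \sum_i p i * (\tr (expk (2 ^ r.+1) (S + X i)) - d%:R) <=
  (1 + 4 / 5 * v) * (\tr (expk (2 ^ r.+1) S) - d%:R) + 4 / 5 * (mu * v) +
   d%:R * t%:R * expR (t.+1%:R) / (2 ^ r.+1)%:R.
Proof.
move=> sS JS lS; set k := (2 ^ r.+1)%N.
have kE : k = ((2 ^ r).-1).+1.*2 by rewrite prednK ?expn_gt0 // /k expnS mul2n.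
set err := d%:R * t%:R * expR (t.+1%:R) / _.
set F := expk k S; set V := \sum_i p i *: (X i * X i).
have t0 : 0 <= t%:R :> R by rewrite ler0n.
have step i : \tr (expk k (S + X i)) <=
    \tr F + \tr (F * X i) + 4 / 5 * \tr (F * (X i * X i)) + err.
  have h : \tr (expk k (S + X i)) <= \tr (F * expk k (X i)) + err.
    have t2 : 0 <= t%:R / 2 :> R by lra.
    have half0 : 0 <= 2^-1 :> R by lra.
    apply: le_trans (expk_add_le _ sS (symX i) t2 half0 lS (lipX2 i)) _.
    have e1 : t%:R / 2 + 2^-1 + t%:R / 2 / 2 <= t.+1%:R :> R by rewrite -[t.+1%:R]natr1; lra.
    rewrite lerD2l ler_wpM2r ?invr_ge0 //.
    have e2 : d%:R * (t%:R / 2 / 2) <= d%:R * t%:R :> R by rewrite ler_wpM2l //; lra.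
    apply: ler_pM => //; rewrite ?expR_ge0 ?ler_expR //.
  apply: le_trans h _; rewrite lerD2r.
  by have := expk_bernstein (2 ^ r).-1 sS (symX i) (lipX2 i); rewrite -kE.
have mulZr (c : R) (A : 'M[R]_d) : F * (c *: A) = c *: (F * A) by rewrite -[LHS]scalemxAr.
have sumstep : \sum_i p i * (\tr (expk k (S + X i)) - d%:R) <=
    \tr F - d%:R + 4 / 5 * \tr (F * V) + err.
  apply: (@le_trans _ _ (\sum_i (p i * (\tr F - d%:R + err) + p i * \tr (F * X i)
      + 4 / 5 * (p i * \tr (F * (X i * X i)))))).
    apply: ler_sum => i _; have := ler_wpM2l (p_ge0 i) (step i); lra.
  rewrite !big_split /= -mulr_suml p_sum mul1r -mulr_sumr.
  have -> : \sum_i p i * \tr (F * X i) = 0.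
    transitivity (\tr (F * (\sum_i p i *: X i))); last by rewrite EX mulr0 raddf0.
    rewrite mulr_sumr raddf_sum; apply: eq_bigr => i _.
    by rewrite mulZr /= mxtraceZ.
  have -> : \sum_i p i * \tr (F * (X i * X i)) = \tr (F * V).
    rewrite mulr_sumr raddf_sum; apply: eq_bigr => i _.
    by rewrite mulZr /= mxtraceZ.
  lra.
apply: le_trans sumstep _.
have JV : J * V = V * J.
  rewrite mulr_sumr mulr_suml; apply: eq_bigr => i _.
  rewrite /GRing.mul /= -scalemxAr -scalemxAl; congr (_ *: _).
  rewrite -/(X i * X i) -[_ *m _]/(J * (X i * X i)) -[RHS]/(X i * X i * J).
  by rewrite (mulrA J) JX mulNr -(mulrA (X i) J) JX mulrN opprK mulrA.
have hV z : dotv z (V *m z) <= v * sqn z.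
  apply: le_trans (varX z); rewrite /V mulmx_suml.
  have -> : dotv z (\sum_i (p i *: (X i * X i)) *m z) = \sum_i dotv z ((p i *: (X i * X i)) *m z).
    rewrite dotvC /dotv exchange_big; apply: eq_bigr => j _ /=.
    by rewrite summxE mulr_suml; apply: eq_bigr => i _; rewrite mulrC.
  apply: ler_sum => i _; rewrite -scalemxAl dotvC dotvZl ler_wpM2l //.
  by rewrite [_ * _]/(_ *m _) -mulmxA dotv_mulmxl symX.
have trV : \tr V <= mu * v.
  by apply: le_trans trX2; rewrite raddf_sum; apply: ler_sum => i _; rewrite /= mxtraceZ.
have := expk_mxtrace_mul_le JJ sS JS k JV hV trV; rewrite -/F; lra.
Qed.

(** With b = 1 + (4/5) v, one step reads a' + mu <= b (a + mu) + e, since (4/5) mu v = (b - 1) mu.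
    The errors e increase with [t], so the last one, multiplied by t b^t, covers all of them. *)
Lemma mgf_le r t : mgf (2 ^ r.+1) t <=
  (1 + 4 / 5 * v) ^+ t * (mu + t%:R * (d%:R * t%:R * expR (t.+1%:R) / (2 ^ r.+1)%:R)) - mu.
Proof.
have b1 : 1 <= 1 + 4 / 5 * v by rewrite lerDl mulr_ge0 // divr_ge0.
set k := (2 ^ r.+1)%N.
set e := fun t : nat => d%:R * t%:R * expR (t.+1%:R) / k%:R : R.
have e_ge0 u : 0 <= e u by rewrite /e mulr_ge0 ?invr_ge0 // mulr_ge0 ?expR_ge0 // mulr_ge0.
have e_mono u : e u <= e u.+1.
  rewrite /e ler_wpM2r ?invr_ge0 // ler_pM ?expR_ge0 ?mulr_ge0 ?ler_expR ?ler_nat //.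
  by rewrite ler_wpM2l // ler_nat.
rewrite -/(e t).
elim: t => [|t IH].
  rewrite /mgf big1 ?expr0 ?mul1r ?mul0r ?addr0 ?subrr ?lexx // => om _.
  by rewrite /tsum big_ord0 /expk scaler0 addr0 expr1n mxtrace1 subrr mulr0.
have rec : mgf k t.+1 <= (1 + 4 / 5 * v) * mgf k t + 4 / 5 * (mu * v) + e t.
  rewrite /mgf big_tuple_cons exchange_big /=.
  apply: (@le_trans _ _ (\sum_(om : t.-tuple I) (tprob om * ((1 + 4 / 5 * v) *
     (\tr (expk k (tsum om)) - d%:R)) + tprob om * (4 / 5 * (mu * v) + e t)))).
    apply: ler_sum => om _; rewrite -mulrDr.
    have := mgf_step r (tsum_sym om) (tsum_anticomm om) (tsum_lip om).
    rewrite -addrA -/(e t) => /(ler_wpM2l (tprob_ge0 om)); apply: le_trans.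
    rewrite mulr_sumr; apply: ler_sum => i _.
    by rewrite tprob_cons tsum_cons mulrCA mulrA.
  rewrite big_split /= -mulr_suml tprob_sum mul1r mulr_sumr addrA.
  by rewrite !lerD2r; apply: ler_sum => om _; rewrite mulrCA.
set b := 1 + 4 / 5 * v in rec IH b1 *.
have h1 : b * mgf k t <= b * (b ^+ t * (mu + t%:R * e t) - mu).
  by rewrite ler_wpM2l // (le_trans _ b1).
have h2 : e t <= b ^+ t.+1 * e t by rewrite ler_peMl // exprn_ege1.
have h3 : b ^+ t.+1 * (mu + t%:R * e t + e t) <= b ^+ t.+1 * (mu + t.+1%:R * e t.+1).
  rewrite ler_wpM2l ?exprn_ge0 ?(le_trans _ b1) // -addrA lerD2l -natr1 mulrDl mul1r.
  by rewrite lerD // ler_wpM2l.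
have h4 : b * mu = mu + 4 / 5 * (mu * v) by rewrite /b; ring.
move: h1; rewrite exprS in h2 h3 *; rewrite mulrBr mulrA; lra.
Qed.

(** Markov's inequality: outside [E] the contribution is nonnegative, again because the odd traces
    vanish. *)
Lemma mgf_tail k (x : R) t (E : pred (t.-tuple I)) : 0 < x -> ~~ odd k ->
  (forall om, E om -> exists2 z, 0 < sqn z & x ^+ 2 * sqn z <= sqn (tsum om *m z)) ->
  (\sum_(om | E om) tprob om) * ((1 + k%:R^-1 * x) ^+ k / 2 - 1) <= mgf k t.
Proof.
move=> x0 ek hE; rewrite /mgf [leRHS](bigID E) /= mulr_suml -[leLHS]addr0 lerD //.
  apply: ler_sum => om /hE[z z0 hz]; rewrite ler_wpM2l ?tprob_ge0 //.
  exact: expk_mxtrace_ge (tsum_sym om) JJ (tsum_anticomm om) z0 hz x0 ek.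
apply: sumr_ge0 => om _; rewrite mulr_ge0 ?tprob_ge0 //.
by apply: (expk_mxtrace_sub_ge0 JJ); [exact: tsum_sym|exact: tsum_anticomm].
Qed.

Lemma le_of_le_pow2 (a b c : R) : (forall r, a <= b + c / (2 ^ r.+1)%:R) -> a <= b.
Proof.
move=> h; rewrite leNgt; apply/negP => ab.
have ab0 : 0 < a - b by rewrite subr_gt0.
have [N hN] : exists N : nat, c / (a - b) < N%:R.
  by exists (Num.trunc (c / (a - b))).+1; exact: truncnS_gt.
have := h N; rewrite -lerBlDl ler_pdivlMr ?ltr0n ?expn_gt0 // => h1.
have : c < (a - b) * (2 ^ N.+1)%:R.
  rewrite mulrC -ltr_pdivrMr //; apply: lt_le_trans hN _.
  by rewrite ler_nat (leq_trans (leqnSn _)) // ltnW // ltn_expl.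
by rewrite ltNge h1.
Qed.

(** Upper and lower bounds for the approximate exponential agree with the true ones up to O(1/k);
    for fixed [d] and [t] the limit over k = 2^(r+1) removes every term containing [d]. *)
Theorem matrix_bernstein (x : R) t (E : pred (t.-tuple I)) : 0 < x ->
  (forall om, E om -> exists2 z, 0 < sqn z & x ^+ 2 * sqn z <= sqn (tsum om *m z)) ->
  (\sum_(om | E om) tprob om) * (expR x / 2 - 1) <= mu * expR (4 / 5 * v * t%:R).
Proof.
move=> x0 hE; set P := \sum_(om | E om) tprob om.
have P0 : 0 <= P by apply: sumr_ge0 => om _; exact: tprob_ge0.
set b := (1 + 4 / 5 * v) ^+ t.
have hb : b <= expR (4 / 5 * v * t%:R).
  have b0 : 0 <= 1 + 4 / 5 * v by rewrite addr_ge0 // mulr_ge0 // divr_ge0.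
  by rewrite mulrC expRM_natl; apply: lerXn2r; rewrite ?nnegrE ?expR_ge0 ?expR_ge1Dx.
apply: (@le_trans _ _ (b * mu)); last by rewrite mulrC ler_wpM2l.
(* The numerators of the two 1/k errors: the first from [expk_scalar_ge], the second from
   [mgf_le]. *)
apply: (@le_of_le_pow2 _ _ (P * expR x * x ^+ 2 / 2 + b * t%:R * (d%:R * t%:R * expR (t.+1%:R)))) => r.
have ek : ~~ odd (2 ^ r.+1) by rewrite oddX.
have h1 := mgf_tail x0 ek hE; have h2 := mgf_le r t.
have k0 : (0 < 2 ^ r.+1)%N by rewrite expn_gt0.
have h3 := expk_scalar_ge k0 (ltW x0).
have k0' : (0 : R) < (2 ^ r.+1)%:R by rewrite ltr0n.
set k := (2 ^ r.+1)%N in h1 h2 h3 k0' *.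
have h4 : P * (expR x * (1 - x ^+ 2 / k%:R) / 2 - 1) <= P * ((1 + k%:R^-1 * x) ^+ k / 2 - 1).
  by rewrite ler_wpM2l //; lra.
have := le_trans h4 (le_trans h1 h2); rewrite -/b => h5.
have E1 : P * (expR x * (1 - x ^+ 2 / k%:R) / 2 - 1) =
    P * (expR x / 2 - 1) - (P * expR x * x ^+ 2 / 2) / k%:R.
  by field; rewrite gt_eqF.
have E2 : b * (mu + t%:R * (d%:R * t%:R * expR (t.+1%:R) / k%:R)) =
    b * mu + (b * t%:R * (d%:R * t%:R * expR (t.+1%:R))) / k%:R.
  by field; rewrite gt_eqF.
have h6 (a c : R) : a <= c - mu -> a <= c by move=> /le_trans; apply; rewrite gerBl.
have {}h5 := h6 _ _ h5.
rewrite E1 E2 in h5; rewrite [in leRHS]mulrDl; lra.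
Qed.
End Matrix_Bernstein.

(** * Deviation of averages of rectangular matrices *)

Section Dilation.
Variable R : realType.

Lemma sqn_col_mx n1 n2 (a : 'cV[R]_n1) (b : 'cV[R]_n2) : sqn (col_mx a b) = sqn a + sqn b.
Proof.
rewrite /sqn /dotv big_split_ord /=; congr (_ + _); apply: eq_bigr => i _.
  by rewrite !col_mxEu.
by rewrite !col_mxEd.
Qed.

Definition dilation n1 n2 (W : 'M[R]_(n1, n2)) : 'M[R]_(n1 + n2) := block_mx 0 W W^T 0.

Lemma dilation_mul n1 n2 (W : 'M[R]_(n1, n2)) (a : 'cV[R]_n1) (b : 'cV[R]_n2) :
  dilation W *m col_mx a b = col_mx (W *m b) (W^T *m a).
Proof. by rewrite mul_block_col !mul0mx addr0 add0r. Qed.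

Lemma dilation_sum n1 n2 (I : finType) (W : I -> 'M[R]_(n1, n2)) :
  dilation (\sum_i W i) = \sum_i dilation (W i).
Proof.
rewrite /dilation raddf_sum /=; apply: (big_ind3 (fun x y z => block_mx 0 x y 0 = z)) => //.
  by rewrite -block_mx0.
by move=> x1 x2 y1 y2 z1 z2 <- <-; rewrite add_block_mx !addr0.
Qed.

Lemma dilationZ n1 n2 c (W : 'M[R]_(n1, n2)) : dilation (c *: W) = c *: dilation W.
Proof. by rewrite /dilation scale_block_mx !scaler0 linearZ. Qed.

(** Centering lowers the second moment by the squared norm of the mean, so the bounds on [Z] also
    serve for [W]. *)
Lemma sum_sqn_centered n (I : finType) (p : I -> R) (f : I -> 'cV[R]_n) : \sum_i p i = 1 ->
  \sum_i p i * sqn (f i - \sum_j p j *: f j) <= \sum_i p i * sqn (f i).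
Proof.
move=> p1; set g : 'cV[R]_n := \sum_j p j *: f j.
have -> : \sum_i p i * sqn (f i - g) =
    \sum_i p i * sqn (f i) + - 2 * (\sum_i p i * dotv (f i) g) + (\sum_i p i) * sqn g.
  rewrite mulr_sumr mulr_suml -!big_split /=; apply: eq_bigr => i _.
  rewrite -scaleN1r sqnD sqnZ [dotv _ (_ *: _)]dotvC dotvZl (dotvC g); ring.
have -> : \sum_i p i * dotv (f i) g = sqn g.
  rewrite [in RHS]/sqn {2}/g /dotv.
  under eq_bigr do rewrite mulr_sumr.
  rewrite exchange_big; apply: eq_bigr => k _ /=.
  rewrite summxE mulr_suml; apply: eq_bigr => i _; rewrite mxE; ring.
rewrite p1 mul1r; have := sqn_ge0 g; lra.
Qed.

Variables (n1 n2 : nat) (I : finType) (p : I -> R) (Z : I -> 'M[R]_(n1, n2)).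
Hypotheses (p_ge0 : forall i, 0 <= p i) (p_sum : \sum_i p i = 1).
Variables (L kap nu tau : R).
Hypotheses (L_ge0 : 0 <= L) (kap_gt0 : 0 < kap) (nu_ge0 : 0 <= nu) (tau_gt0 : 0 < tau).
Hypotheses (lipZ_ : forall i, lip (Z i) L) (lipZT : forall i, lip (Z i)^T L).
Hypothesis varZ : forall y, \sum_i p i * sqn (Z i *m y) <= kap * sqn y.
Hypothesis varZT : forall x, \sum_i p i * sqn ((Z i)^T *m x) <= kap * sqn x.
Hypothesis trZ : \sum_i p i * \tr ((Z i)^T *m Z i) <= nu * kap.
Hypothesis tauL : L * tau <= kap / 2.

Let G := \sum_i p i *: Z i.
Let W i := Z i - G.
(** Centering doubles the norm bound, and lam * 2L = L tau / kap <= 1/2 by [tauL], as required of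
    the summands. With variance lam^2 kap the gain t lam tau and the cost (4/5) lam^2 kap t become t
    tau^2 / kap times 1/2 and 1/5. *)
Let lam := tau / (2 * kap).
Let X i := lam *: dilation (W i).
(** This sign matrix anticommutes with every matrix whose diagonal blocks vanish. *)
Let J : 'M[R]_(n1 + n2) := block_mx 1%:M 0 0 (- 1%:M).

(** The squared dilation has diagonal blocks W W^T and W^T W of equal trace. This is why 2 nu bounds
    the trace ratio and neither [n1] nor [n2] appears in the conclusion. *)
Theorem rect_bernstein t (E : pred (t.-tuple I)) : (0 < t)%N ->
  (forall om, E om -> exists2 y, 0 < sqn y &
     tau ^+ 2 * sqn y <= sqn ((t%:R^-1 *: (\sum_j Z (tnth om j)) - G) *m y)) ->
  (\sum_(om | E om) \prod_j p (tnth om j)) * (expR (t%:R * tau ^+ 2 / kap / 2) / 2 - 1) <=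
  2 * nu * expR (t%:R * tau ^+ 2 / kap / 5).
Proof.
move=> t0 hE.
have kap0 : kap != 0 by rewrite gt_eqF.
have lam0 : 0 < lam by rewrite divr_gt0 // mulr_gt0.
have symX i : (X i)^T = X i.
  by rewrite /X linearZ /= /dilation tr_block_mx !trmx0 trmxK.
have JJ : J * J = 1.
  rewrite [_ * _]mulmx_block !mul0mx !mulmx0 !addr0 !add0r mul1mx mulmxN mulNmx opprK mulmx1.
  by rewrite -scalar_mx_block.
have JX i : J * X i = - (X i * J).
  change (J *m (lam *: dilation (W i)) = - ((lam *: dilation (W i)) *m J)).
  rewrite -scalemxAr -scalemxAl -scalerN.
  congr (_ *: _); rewrite /J /dilation !mulmx_block.
  rewrite !mul0mx !mulmx0 !addr0 !add0r !mul1mx !mulmx1 mulmxN mulmx1 mulNmx mul1mx.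
  by rewrite opp_block_mx !oppr0 opprK.
have lipG : lip G L.
  have -> : L = \sum_i p i * L by rewrite -mulr_suml p_sum mul1r.
  by apply: lip_sum => i _; [rewrite mulr_ge0|apply: lipZ].
have GT : G^T = \sum_i p i *: (Z i)^T.
  by rewrite raddf_sum /=; apply: eq_bigr => i _; rewrite linearZ.
have lipGT : lip G^T L.
  have -> : L = \sum_i p i * L by rewrite -mulr_suml p_sum mul1r.
  by rewrite GT; apply: lip_sum => i _; [rewrite mulr_ge0|apply: lipZ].
have lipN m n (A : 'M[R]_(m, n)) a : lip A a -> lip (- A) a.
  by move=> h z; rewrite mulNmx -scaleN1r sqnZ sqrrN expr1n mul1r.
have lipW i : lip (W i) (L + L) by apply: lipD => //; exact: lipN.
have lipWT i : lip (W i)^T (L + L).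
  by rewrite /W linearB /=; apply: lipD => //; exact: lipN.
have lipX2 i : lip (X i) 2^-1.
  have h : lip (X i) (lam * (L + L)).
    apply: lipZ => z; rewrite -[z]vsubmxK dilation_mul !sqn_col_mx mulrDr addrC.
    by apply: lerD; [exact: lipWT|exact: lipW].
  apply: lip_le h; first by rewrite mulr_ge0 ?(ltW lam0) // addr_ge0.
  have -> : lam * (L + L) = (L * tau) / kap by rewrite /lam; field.
  by rewrite ler_pdivrMr // [leRHS]mulrC.
have EW : \sum_i p i *: W i = 0.
  under eq_bigr do rewrite /W scalerBr.
  by rewrite sumrB -scaler_suml p_sum scale1r subrr.
have EX : \sum_i p i *: X i = 0.
  have -> : \sum_i p i *: X i = lam *: dilation (\sum_i p i *: W i).
    rewrite dilation_sum scaler_sumr; apply: eq_bigr => i _.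
    by rewrite dilationZ !scalerA mulrC.
  by rewrite EW /dilation trmx0 block_mx0 scaler0.
have varW y : \sum_i p i * sqn (W i *m y) <= kap * sqn y.
  apply: le_trans (varZ y); apply: le_trans (sum_sqn_centered _ p_sum).
  have -> // : \sum_j p j *: (Z j *m y) = G *m y.
    by rewrite mulmx_suml; apply: eq_bigr => j _; rewrite scalemxAl.
  by apply: ler_sum => i _; rewrite mulmxBl.
have varWT x : \sum_i p i * sqn ((W i)^T *m x) <= kap * sqn x.
  apply: le_trans (varZT x); apply: le_trans (sum_sqn_centered _ p_sum).
  have -> // : \sum_j p j *: ((Z j)^T *m x) = G^T *m x.
    by rewrite GT mulmx_suml; apply: eq_bigr => j _; rewrite scalemxAl.
  by apply: ler_sum => i _; rewrite linearB /= mulmxBl.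
set v := lam ^+ 2 * kap.
have v0 : 0 <= v by rewrite mulr_ge0 ?sqr_ge0 // ltW.
have varX z : \sum_i p i * sqn (X i *m z) <= v * sqn z.
  rewrite -[z]vsubmxK sqn_col_mx.
  have -> : \sum_i p i * sqn (X i *m col_mx (usubmx z) (dsubmx z)) =
     lam ^+ 2 * (\sum_i p i * sqn (W i *m dsubmx z) + \sum_i p i * sqn ((W i)^T *m usubmx z)).
    rewrite -big_split mulr_sumr; apply: eq_bigr => i _ /=.
    by rewrite -scalemxAl sqnZ dilation_mul sqn_col_mx; ring.
  rewrite /v -mulrA ler_wpM2l ?sqr_ge0 // mulrDr addrC.
  by apply: lerD; [exact: varWT|exact: varW].
have trW : \sum_i p i * \tr ((W i)^T *m W i) <= nu * kap.
  apply: le_trans trZ.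
  have E1 (A : I -> 'M[R]_(n1, n2)) : \sum_i p i * \tr ((A i)^T *m A i) =
      \sum_j \sum_i p i * sqn (A i *m delta_mx j 0).
    rewrite exchange_big; apply: eq_bigr => i _ /=.
    by rewrite sqn_tr mulr_sumr.
  rewrite !E1; apply: ler_sum => j _.
  apply: le_trans (sum_sqn_centered _ p_sum).
  have GE : \sum_l p l *: (Z l *m delta_mx j 0) = G *m (delta_mx j 0 : 'cV_n2).
    by rewrite mulmx_suml; apply: eq_bigr => l _; rewrite scalemxAl.
  rewrite GE.
  by apply: ler_sum => i _; rewrite mulmxBl.
have trX2 : \sum_i p i * \tr (X i * X i) <= (2 * nu) * v.
  have -> : \sum_i p i * \tr (X i * X i) = lam ^+ 2 * (2 * \sum_i p i * \tr ((W i)^T *m W i)).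
    rewrite !mulr_sumr; apply: eq_bigr => i _.
    change (X i * X i) with ((lam *: dilation (W i)) *m (lam *: dilation (W i))).
    rewrite -scalemxAl -scalemxAr !mxtraceZ /dilation mulmx_block.
    rewrite !mul0mx !mulmx0 !addr0 !add0r mxtrace_block [\tr (W i *m _)]mxtrace_mulC.
    by ring.
  have -> : 2 * nu * v = lam ^+ 2 * (2 * (nu * kap)) by rewrite /v; ring.
  by rewrite ler_wpM2l ?sqr_ge0 // ler_wpM2l.
have t0R : (0 : R) < t%:R by rewrite ltr0n.
have x0 : 0 < t%:R * lam * tau by apply: mulr_gt0 => //; exact: mulr_gt0.
have nu20 : 0 <= 2 * nu by rewrite mulr_ge0.
have hE' om : E om -> exists2 z, 0 < sqn z &
    (t%:R * lam * tau) ^+ 2 * sqn z <= sqn (tsum X om *m z).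
  (* The dilation of W sends (0, y) to (W y, 0), so a vector stretched by W is stretched equally by
     the dilation. *)
  move=> /hE[y y0 hy]; exists (col_mx 0 y); first by rewrite sqn_col_mx sqn0 add0r.
  have -> : tsum X om = lam *: dilation (\sum_j W (tnth om j)).
    by rewrite dilation_sum scaler_sumr.
  rewrite -scalemxAl dilation_mul mulmx0 sqnZ !sqn_col_mx !sqn0 add0r addr0.
  have -> : \sum_j W (tnth om j) = t%:R *: (t%:R^-1 *: (\sum_j Z (tnth om j)) - G).
    rewrite scalerBr scalerA divff ?pnatr_eq0 -?lt0n // scale1r /W sumrB.
    by rewrite sumr_const card_ord scaler_nat.
  rewrite -scalemxAl sqnZ.
  have -> : (t%:R * lam * tau) ^+ 2 * sqn y = lam ^+ 2 * (t%:R ^+ 2 * (tau ^+ 2 * sqn y)) by ring.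
  by rewrite ler_wpM2l ?sqr_ge0 // ler_wpM2l ?sqr_ge0.
have := matrix_bernstein p_ge0 p_sum symX JJ JX lipX2 EX v0 nu20 varX trX2 x0 hE'.
have -> : t%:R * lam * tau = t%:R * tau ^+ 2 / kap / 2 by rewrite /lam; field.
have -> : 4 / 5 * v * t%:R = t%:R * tau ^+ 2 / kap / 5 by rewrite /v /lam; field.
by [].
Qed.
End Dilation.

(** * Complex vectors and inner product spaces *)

Section ComplexNumbers.
Variable R : realType.
Local Notation CC := R[i].
Implicit Types x y z : CC.

Lemma complex_ext x y : cre x = cre y -> cim x = cim y -> x = y.
Proof. by case: x y => [a b] [c d] /= -> ->. Qed.
Lemma creD x y : cre (x + y) = cre x + cre y. Proof. by case: x y => [a b] [c d]. Qed.
Lemma cimD x y : cim (x + y) = cim x + cim y. Proof. by case: x y => [a b] [c d]. Qed.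
Lemma creN x : cre (- x) = - cre x. Proof. by case: x. Qed.
Lemma cimN x : cim (- x) = - cim x. Proof. by case: x. Qed.
Lemma cre0 : cre (0 : CC) = 0. Proof. by []. Qed.
Lemma cim0 : cim (0 : CC) = 0. Proof. by []. Qed.
Lemma creM x y : cre (x * y) = cre x * cre y - cim x * cim y.
Proof. by case: x y => [a b] [c d]. Qed.
Lemma cimM x y : cim (x * y) = cre x * cim y + cim x * cre y.
Proof. by case: x y => [a b] [c d]. Qed.
Lemma cre_sum (I : Type) (r : seq I) (P : pred I) (F : I -> CC) :
  cre (\sum_(i <- r | P i) F i) = \sum_(i <- r | P i) cre (F i).
Proof. exact: (big_morph _ creD cre0). Qed.
Lemma cim_sum (I : Type) (r : seq I) (P : pred I) (F : I -> CC) :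
  cim (\sum_(i <- r | P i) F i) = \sum_(i <- r | P i) cim (F i).
Proof. exact: (big_morph _ cimD cim0). Qed.

Lemma cconjD x y : cconj (x + y) = cconj x + cconj y.
Proof. by apply: complex_ext; rewrite /= ?creD ?cimD ?opprD. Qed.
Lemma cconjM x y : cconj (x * y) = cconj x * cconj y.
Proof. by apply: complex_ext; rewrite /= ?creM ?cimM /=; ring. Qed.
Lemma cconjK x : cconj (cconj x) = x.
Proof. by apply: complex_ext; rewrite /= ?opprK. Qed.
Lemma cconj0 : cconj (0 : CC) = 0. Proof. by apply: complex_ext; rewrite /= ?oppr0. Qed.
Lemma cconj_sum (I : Type) (r : seq I) (P : pred I) (F : I -> CC) :
  cconj (\sum_(i <- r | P i) F i) = \sum_(i <- r | P i) cconj (F i).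
Proof. exact: (big_morph _ cconjD cconj0). Qed.
Lemma cmod2_ge0 x : 0 <= cmod2 x. Proof. by rewrite addr_ge0 ?sqr_ge0. Qed.
Lemma cmod2_conj x : cmod2 (cconj x) = cmod2 x. Proof. by rewrite /cmod2 /= sqrrN. Qed.
Lemma cmod2_0 : cmod2 (0 : CC) = 0. Proof. by rewrite /cmod2 /= expr0n addr0. Qed.
Lemma cmod2N x : cmod2 (- x) = cmod2 x. Proof. by rewrite /cmod2 creN cimN !sqrrN. Qed.
Lemma cmod2_eq0 x : cmod2 x = 0 -> x = 0.
Proof.
move=> h; have := sqr_ge0 (cre x); have := sqr_ge0 (cim x); rewrite /cmod2 in h.
move=> h1 h2; have e1 : cre x ^+ 2 = 0 by lra.
have e2 : cim x ^+ 2 = 0 by lra.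
by apply: complex_ext => /=; apply/eqP; rewrite -sqrf_eq0; apply/eqP.
Qed.
Lemma mulc_conj x : x * cconj x = Complex (cmod2 x) 0.
Proof. by apply: complex_ext; rewrite /= ?creM ?cimM /cmod2 /=; ring. Qed.
Lemma complex_invr (r : R) : (Complex r 0)^-1 = Complex r^-1 0 :> CC.
Proof.
apply: complex_ext; rewrite /= expr0n addr0 ?mul0r ?oppr0 ?mul0r //.
have [->|r0] := eqVneq r 0; first by rewrite mul0r invr0.
by rewrite expr2 invfM mulrA divff // mul1r.
Qed.
Lemma natr_complex k : k%:R = Complex k%:R 0 :> CC.
Proof.
elim: k => [|k IH] //; rewrite -natr1 IH; apply: complex_ext; rewrite ?creD ?cimD /= ?addr0 //.
by rewrite -natr1.
Qed.
Lemma cmodE x : cmod x ^+ 2 = cmod2 x. Proof. by rewrite sqr_sqrtr ?cmod2_ge0. Qed.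
Lemma cre_le_cmod x : `|cre x| <= cmod x.
Proof. by rewrite -sqrtr_sqr ler_wsqrtr // /cmod2 lerDl sqr_ge0. Qed.
Lemma cim_le_cmod x : `|cim x| <= cmod x.
Proof. by rewrite -sqrtr_sqr ler_wsqrtr // /cmod2 lerDr sqr_ge0. Qed.
End ComplexNumbers.

Section InnerProduct.
Variables (R : realType) (H : lmodType R[i]) (ip : H -> H -> R[i]).
Hypothesis ipP : is_inner_product ip.
Local Notation CC := R[i].
Implicit Types x y z : H.

Definition hsq x : R := cre (ip x x).

Lemma ipDl x y z : ip (x + y) z = ip x z + ip y z.
Proof. by case: ipP => h _ _ _; have := h 1 x y z; rewrite scale1r mul1r. Qed.
Lemma ip0l z : ip 0 z = 0.
Proof. by apply: (addIr (ip 0 z)); rewrite -ipDl addr0 add0r. Qed.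
Lemma ipZl a x z : ip (a *: x) z = a * ip x z.
Proof. by case: ipP => h _ _ _; rewrite -[a *: x]addr0 h ip0l addr0. Qed.
Lemma ipC x y : ip y x = cconj (ip x y). Proof. by case: ipP. Qed.
Lemma ipDr x y z : ip z (x + y) = ip z x + ip z y.
Proof. by rewrite ipC ipDl cconjD -!ipC. Qed.
Lemma ipZr a x z : ip z (a *: x) = cconj a * ip z x.
Proof. by rewrite ipC ipZl cconjM -ipC. Qed.
Lemma ip0r z : ip z 0 = 0. Proof. by rewrite ipC ip0l cconj0. Qed.
Lemma ipNl x z : ip (- x) z = - ip x z.
Proof. by rewrite -scaleN1r ipZl mulN1r. Qed.
Lemma ipBl x y z : ip (x - y) z = ip x z - ip y z.
Proof. by rewrite ipDl ipNl. Qed.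
Lemma ip_suml (I : Type) (r : seq I) (P : pred I) (F : I -> H) z :
  ip (\sum_(i <- r | P i) F i) z = \sum_(i <- r | P i) ip (F i) z.
Proof. exact: (big_morph (fun x => ip x z) (fun x y => ipDl x y z) (ip0l z)). Qed.
Lemma ip_sumr (I : Type) (r : seq I) (P : pred I) (F : I -> H) z :
  ip z (\sum_(i <- r | P i) F i) = \sum_(i <- r | P i) ip z (F i).
Proof. exact: (big_morph (ip z) (fun x y => ipDr x y z) (ip0r z)). Qed.

Lemma hsq_ge0 x : 0 <= hsq x. Proof. by case: ipP => _ _ h _; case: (h x). Qed.
Lemma ip_self x : ip x x = Complex (hsq x) 0.
Proof. by case: ipP => _ _ h _; apply: complex_ext => //=; case: (h x). Qed.
Lemma hsq_eq0 x : hsq x = 0 -> x = 0.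
Proof. by case: ipP => _ _ _ h h0; apply: h; rewrite ip_self h0. Qed.
Lemma hsq0 : hsq 0 = 0. Proof. by rewrite /hsq ip0l. Qed.
Lemma hsqZ a x : hsq (a *: x) = cmod2 a * hsq x.
Proof.
by rewrite /hsq ipZl ipZr ip_self !creM !cimM /= /cmod2; ring.
Qed.
Lemma hsqD x y : hsq (x + y) = hsq x + 2 * cre (ip x y) + hsq y.
Proof. by rewrite /hsq ipDl !ipDr !creD (ipC x y) /=; ring. Qed.
Lemma hsqN x : hsq (- x) = hsq x.
Proof. by rewrite -scaleN1r hsqZ /cmod2 /= oppr0; ring. Qed.

Lemma ip_cauchy x y : cmod2 (ip x y) <= hsq x * hsq y.
Proof.
have [y0|y0] := eqVneq (hsq y) 0.
  by rewrite (hsq_eq0 y0) ip0r cmod2_0 hsq0 mulr0.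
have := hsq_ge0 (Complex (hsq y) 0 *: x + - ip x y *: y).
rewrite hsqD !hsqZ ipZl ipZr cmod2N.
have -> : cre (Complex (hsq y) 0 * (cconj (- ip x y) * ip x y)) = - (hsq y * cmod2 (ip x y)).
  by rewrite !creM !cimM /= creN cimN /cmod2; ring.
have -> : cmod2 (Complex (hsq y) 0) = hsq y ^+ 2 by rewrite /cmod2 /= expr0n addr0.
have -> : forall a b c : R, c ^+ 2 * a + 2 * - (c * b) + b * c = c * (a * c - b) by move=> a b c; ring.
by rewrite pmulr_rge0 ?subr_ge0 // lt_neqAle eq_sym y0 hsq_ge0.
Qed.

Lemma hnorm_ge0 x : 0 <= hnorm ip x. Proof. exact: sqrtr_ge0. Qed.
Lemma hnormE x : hnorm ip x ^+ 2 = hsq x. Proof. by rewrite sqr_sqrtr ?hsq_ge0. Qed.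
Lemma hnorm0 : hnorm ip 0 = 0. Proof. by rewrite /hnorm ip0l sqrtr0. Qed.
Lemma hnorm_eq0 x : hnorm ip x = 0 -> x = 0.
Proof. by move=> h; apply: hsq_eq0; rewrite -hnormE h expr0n. Qed.
Lemma hnormN x : hnorm ip (- x) = hnorm ip x.
Proof. by rewrite /hnorm -!/(hsq _) hsqN. Qed.
Lemma hnormB x y : hnorm ip (x - y) = hnorm ip (y - x).
Proof. by rewrite -opprB hnormN. Qed.
Lemma hnormZ a x : hnorm ip (a *: x) = cmod a * hnorm ip x.
Proof. by rewrite /hnorm -!/(hsq _) hsqZ sqrtrM ?cmod2_ge0. Qed.
Lemma le_hnorm x c : 0 <= c -> (hnorm ip x <= c) = (hsq x <= c ^+ 2).
Proof. by move=> c0; rewrite -hnormE ler_pXn2r // nnegrE ?hnorm_ge0. Qed.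

Lemma cmod_ip x y : cmod (ip x y) <= hnorm ip x * hnorm ip y.
Proof.
rewrite -(@ler_pXn2r _ 2) ?nnegrE ?sqrtr_ge0 ?mulr_ge0 ?hnorm_ge0 //.
by rewrite cmodE exprMn !hnormE ip_cauchy.
Qed.

Lemma hnormD x y : hnorm ip (x + y) <= hnorm ip x + hnorm ip y.
Proof.
rewrite le_hnorm ?addr_ge0 ?hnorm_ge0 // hsqD sqrrD !hnormE lerD2r lerD2l.
have := le_trans (le_trans (ler_norm _) (cre_le_cmod (ip x y))) (cmod_ip x y).
by rewrite mulr2n; lra.
Qed.

Lemma hnorm_sum (I : Type) (r : seq I) (P : pred I) (F : I -> H) :
  hnorm ip (\sum_(i <- r | P i) F i) <= \sum_(i <- r | P i) hnorm ip (F i).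
Proof.
apply: (big_ind2 (fun (u : H) (a : R) => hnorm ip u <= a)) => [|x1 x2 y1 y2 h1 h2|//].
  by rewrite hnorm0.
by apply: le_trans (hnormD _ _) _; apply: lerD.
Qed.

Lemma hnormBD x y : `|hnorm ip x - hnorm ip y| <= hnorm ip (x - y).
Proof.
rewrite ler_norml; apply/andP; split.
  have := hnormD (y - x) x; rewrite subrK hnormB; lra.
have := hnormD (x - y) y; rewrite subrK; lra.
Qed.
End InnerProduct.

(** * Real coordinates of complex vectors and rank-one maps *)

Section CVector.
Variable R : realType.
Local Notation CC := R[i].

Definition cdot n (x y : 'cV[CC]_n) : CC := \sum_k x k 0 * cconj (y k 0).

Lemma cdot_inner n : is_inner_product (@cdot n).
Proof.
split=> [a x y z|x y|x|x].
- rewrite /cdot mulr_sumr -big_split; apply: eq_bigr => k _ /=.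
  by rewrite !mxE mulrDl mulrA.
- by rewrite /cdot cconj_sum; apply: eq_bigr => k _; rewrite cconjM cconjK mulrC.
- rewrite /cdot cre_sum cim_sum; split.
    by apply: big1 => k _; rewrite mulc_conj.
  by apply: sumr_ge0 => k _; rewrite mulc_conj cmod2_ge0.
- move=> h; have : cre (cdot x x) = 0 by rewrite h.
  rewrite /cdot cre_sum => /psumr_eq0P h0; apply/matrixP => k j; rewrite (ord1 j) mxE.
  apply: cmod2_eq0; have := h0 _ k isT; rewrite mulc_conj /=; apply => l _.
  by rewrite mulc_conj /= cmod2_ge0.
Qed.

Lemma hsq_cdot n (x : 'cV[CC]_n) : hsq (@cdot n) x = \sum_k cmod2 (x k 0).
Proof. by rewrite /hsq cre_sum; apply: eq_bigr => k _; rewrite mulc_conj. Qed.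

Lemma cvnormE n (x : 'cV[CC]_n) : cvnorm x = hnorm (@cdot n) x.
Proof. by rewrite /hnorm -/(hsq _ _) hsq_cdot. Qed.

Definition realify n (x : 'cV[CC]_n) : 'cV[R]_(n + n) :=
  col_mx (map_mx (@cre R) x) (map_mx (@cim R) x).

Lemma realify_surj n (Y : 'cV[R]_(n + n)) : exists y : 'cV[CC]_n, Y = realify y.
Proof.
exists (\col_k Complex (usubmx Y k 0) (dsubmx Y k 0)); rewrite -[LHS]vsubmxK /realify.
by congr col_mx; apply/matrixP => k j; rewrite !(ord1 j) !mxE.
Qed.

Lemma dotv_realify n (x y : 'cV[CC]_n) : dotv (realify x) (realify y) = cre (cdot x y).
Proof.
rewrite /dotv big_split_ord cre_sum /= -big_split /=; apply: eq_bigr => k _.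
by rewrite !col_mxEu !col_mxEd !mxE creM /=; ring.
Qed.

Lemma dotv_realify_i n (x y : 'cV[CC]_n) :
  dotv (realify x) (realify (Complex 0 1 *: y)) = cim (cdot x y).
Proof. by rewrite dotv_realify (ipZr (@cdot_inner n)) creM /=; ring. Qed.

Lemma sqn_realify n (x : 'cV[CC]_n) : sqn (realify x) = hsq (@cdot n) x.
Proof. exact: dotv_realify. Qed.

Lemma realifyD n (x y : 'cV[CC]_n) : realify (x + y) = realify x + realify y.
Proof. by rewrite add_col_mx; congr col_mx; apply/matrixP => k j; rewrite !mxE ?creD ?cimD. Qed.

Lemma realify0 n : realify (0 : 'cV[CC]_n) = 0.
Proof. by rewrite -[RHS]col_mx0; congr col_mx; apply/matrixP => k j; rewrite !mxE. Qed.

Lemma realify_sum n (I : Type) (r : seq I) (P : pred I) (F : I -> 'cV[CC]_n) :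
  realify (\sum_(i <- r | P i) F i) = \sum_(i <- r | P i) realify (F i).
Proof. exact: (big_morph _ (@realifyD n) (@realify0 n)). Qed.

Lemma realifyZ n c (x : 'cV[CC]_n) :
  realify (c *: x) = cre c *: realify x + cim c *: realify (Complex 0 1 *: x).
Proof.
rewrite !scale_col_mx add_col_mx; congr col_mx; apply/matrixP => k j; rewrite !mxE ?creM ?cimM /=; ring.
Qed.

Lemma realifyZr n r (x : 'cV[CC]_n) : realify (Complex r 0 *: x) = r *: realify x.
Proof. by rewrite realifyZ /= scale0r addr0. Qed.

(** The real matrix of the complex map sending y to c <y,b> a. Pairing with b gives the real part of
    <y,b>, pairing with ib its imaginary part, which multiplies ia. *)
Definition rank1 n1 n2 (c : R) (a : 'cV[CC]_n1) (b : 'cV[CC]_n2) : 'M[R]_(n1 + n1, n2 + n2) :=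
  c *: (realify a *m (realify b)^T +
        realify (Complex 0 1 *: a) *m (realify (Complex 0 1 *: b))^T).

Lemma rank1_tr n1 n2 c (a : 'cV[CC]_n1) (b : 'cV[CC]_n2) : (rank1 c a b)^T = rank1 c b a.
Proof. by rewrite /rank1 linearZ linearD /= !trmx_mul !trmxK. Qed.

Lemma rank1E n1 n2 c (a : 'cV[CC]_n1) (b : 'cV[CC]_n2) y :
  rank1 c a b *m realify y = realify (Complex c 0 *: (cdot y b *: a)).
Proof.
have E n (u v : 'cV[R]_n) : u^T *m v = (dotv v u)%:M.
  rewrite [LHS]mx11_scalar mxE; congr (_%:M); apply: eq_bigr => i _.
  by rewrite mxE mulrC.
rewrite realifyZr realifyZ -scalemxAl mulmxDl -!mulmxA !E !mul_mx_scalar.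
by rewrite dotv_realify dotv_realify_i.
Qed.

Lemma sqn_rank1 n1 n2 c (a : 'cV[CC]_n1) (b : 'cV[CC]_n2) y :
  sqn (rank1 c a b *m realify y) = c ^+ 2 * (cmod2 (cdot y b) * hsq (@cdot n1) a).
Proof.
rewrite rank1E sqn_realify !(hsqZ (@cdot_inner n1)).
by rewrite {1}/cmod2 /= expr0n addr0.
Qed.

(** The two real rank-one terms are orthogonal and of equal Frobenius norm, which produces the
    factor 2. *)
Lemma rank1_frob n1 n2 c (a : 'cV[CC]_n1) (b : 'cV[CC]_n2) :
  \tr ((rank1 c a b)^T *m rank1 c a b) = 2 * (c ^+ 2 * (hsq (@cdot n1) a * hsq (@cdot n2) b)).
Proof.
have E m n (u w : 'cV[R]_m) (v z : 'cV[R]_n) : \tr ((u *m v^T)^T *m (w *m z^T)) = dotv u w * dotv v z.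
  rewrite trmx_mul trmxK -mulmxA mxtrace_mulC -!mulmxA.
  have -> : z^T *m v = (dotv v z)%:M.
    by rewrite [LHS]mx11_scalar mxE; congr (_%:M); apply: eq_bigr => i _; rewrite mxE mulrC.
  rewrite mul_mx_scalar -scalemxAr mxtraceZ mulrC; congr (_ * _).
  by rewrite mxtrace_mulC -dotvE dotvC.
rewrite /rank1; set M1 := realify a *m _; set M2 := realify (_ *: a) *m _.
have -> : (c *: (M1 + M2))^T = c *: (M1^T + M2^T) by rewrite linearZ linearD.
rewrite -scalemxAl -scalemxAr scalerA mxtraceZ mulmxDl !mulmxDr /M1 /M2.
rewrite !raddfD /= !E !dotv_realify.
rewrite !(ipZr (@cdot_inner _)) !(ipZl (@cdot_inner _)) !(ip_self (@cdot_inner _)).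
rewrite !creM !cimM /=; ring.
Qed.
End CVector.

(** * Importance sampling of sums of rank-one maps *)

Section ComplexBernstein.
Variable R : realType.
Local Notation CC := R[i].
Local Notation csq x := (hsq (@cdot R _) x).
Variables (n1 n2 : nat) (I : finType) (p : I -> R).
Variables (a : I -> 'cV[CC]_n1) (b : I -> 'cV[CC]_n2) (L K tau : R).
Hypotheses (p_ge0 : forall i, 0 <= p i) (p_sum : \sum_i p i = 1).
Hypotheses (L_gt0 : 0 < L) (K_gt0 : 0 < K) (tau_gt0 : 0 < tau) (tauK : tau <= K / 2).
Hypotheses (a_le : forall i, csq (a i) <= L * p i) (b_le : forall i, csq (b i) <= L * p i).
Hypothesis aK : forall x, \sum_i cmod2 (cdot x (a i)) <= K * csq x.
Hypothesis bK : forall y, \sum_i cmod2 (cdot y (b i)) <= K * csq y.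

(** The left side is the trace of the sum of the a_i (x) a_i, evaluated on the [n1] basis vectors
    with [aK]. The dimension enters the final estimate here, through the side of the v_j. *)
Lemma sum_csq_le : \sum_i csq (a i) <= n1%:R * K.
Proof.
have E i : csq (a i) = \sum_k cmod2 (cdot (delta_mx k 0) (a i)).
  rewrite hsq_cdot; apply: eq_bigr => k _.
  rewrite /cdot (bigD1 k) //= mxE !eqxx mul1r big1 ?addr0 ?cmod2_conj // => l lk.
  by rewrite mxE (negPf lk) mul0r.
under eq_bigr do rewrite E.
rewrite exchange_big /= -[n1 in n1%:R]card_ord mulr_natl -sumr_const.
apply: ler_sum => k _; apply: le_trans (aK _) _.
rewrite hsq_cdot (bigD1 k) //= mxE !eqxx big1 ?addr0 => [|l lk].
  by rewrite /cmod2 /= expr1n expr0n addr0 mulr1.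
by rewrite mxE (negPf lk) cmod2_0.
Qed.

Lemma inv_weight_le i (c r : R) : 0 <= c -> c <= L * p i -> 0 <= r -> (p i)^-1 * c * r <= L * r.
Proof.
move=> c0 hc r0; rewrite ler_wpM2r //.
(* The inverse of 0 is 0, so a letter of mass zero contributes a zero matrix. *)
have [p0|p0] := eqVneq (p i) 0; first by rewrite p0 invr0 mul0r ltW.
have pp : 0 < p i by rewrite lt_neqAle eq_sym p0 p_ge0.
by rewrite mulrC ler_pdivrMr.
Qed.

Let Z i := rank1 (p i)^-1 (a i) (b i).

Lemma weight_inv_sq i : p i * (p i)^-1 ^+ 2 = (p i)^-1.
Proof.
have [->|p0] := eqVneq (p i) 0; first by rewrite invr0 mul0r.
by rewrite expr2 mulrA divff // mul1r.
Qed.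

(** The weight 1/p_i leaves a second moment |<y,b_i>|^2 |a_i|^2 / p_i, at most L |<y,b_i>|^2, so the
    variance is at most L K. The factor 4 collects two doublings: real coordinates double the trace,
    and the dilation has two equal blocks. *)
Theorem complex_bernstein t (E : pred (t.-tuple I)) : (0 < t)%N ->
  (forall om, E om -> exists2 y, 0 < csq y &
     tau ^+ 2 * csq y <= csq (Complex (t%:R^-1) 0 *: (\sum_j Complex (p (tnth om j))^-1 0 *:
          (cdot y (b (tnth om j)) *: a (tnth om j))) - \sum_i cdot y (b i) *: a i)) ->
  (\sum_(om | E om) \prod_j p (tnth om j)) * (expR (t%:R * tau ^+ 2 / (L * K) / 2) / 2 - 1) <=
  4 * n1%:R * expR (t%:R * tau ^+ 2 / (L * K) / 5).
Proof.
move=> t0 hE.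
have csq0 n (x : 'cV[CC]_n) : 0 <= csq x by exact: hsq_ge0 (cdot_inner R n) _.
have lip_gen m1 m2 i (u : 'cV[CC]_m1) (w : 'cV[CC]_m2) :
    csq u <= L * p i -> csq w <= L * p i -> lip (rank1 (p i)^-1 u w) L.
  move=> hu hw Y; have [y ->] := realify_surj Y.
  rewrite sqn_rank1 sqn_realify.
  have cs := ip_cauchy (cdot_inner R m2) y w.
  have p0 : 0 <= (p i)^-1 by rewrite invr_ge0.
  apply: (@le_trans _ _ ((p i)^-1 ^+ 2 * (csq y * csq w * csq u))).
    by rewrite ler_wpM2l ?sqr_ge0 // ler_wpM2r.
  have -> : (p i)^-1 ^+ 2 * (csq y * csq w * csq u) = (p i)^-1 * csq w * ((p i)^-1 * csq u * csq y) by ring.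
  apply: le_trans (inv_weight_le (csq0 _ w) hw _) _; first by rewrite !mulr_ge0.
  by rewrite expr2 -[L * L * _]mulrA ler_wpM2l ?(ltW L_gt0) // inv_weight_le.
have lipZ_ i : lip (Z i) L by exact: lip_gen.
have lipZT i : lip (Z i)^T L by rewrite rank1_tr; exact: lip_gen.
have var_gen m1 m2 (u : I -> 'cV[CC]_m1) (w : I -> 'cV[CC]_m2) :
    (forall i, csq (u i) <= L * p i) ->
    (forall y, \sum_i cmod2 (cdot y (w i)) <= K * csq y) ->
    forall Y, \sum_i p i * sqn (rank1 (p i)^-1 (u i) (w i) *m Y) <= L * K * sqn Y.
  move=> hu hw Y; have [y ->] := realify_surj Y.
  rewrite sqn_realify -mulrA; apply: (@le_trans _ _ (\sum_i L * cmod2 (cdot y (w i)))).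
    apply: ler_sum => i _; rewrite sqn_rank1 mulrA weight_inv_sq.
    rewrite [cmod2 _ * _]mulrC mulrA; apply: inv_weight_le => //; exact: cmod2_ge0.
  by rewrite -mulr_sumr ler_wpM2l // ltW.
have varZ := var_gen _ _ a b a_le bK.
have varZT x : \sum_i p i * sqn ((Z i)^T *m x) <= L * K * sqn x.
  under eq_bigr do rewrite rank1_tr; exact: var_gen.
have trZ : \sum_i p i * \tr ((Z i)^T *m Z i) <= (2 * n1%:R) * (L * K).
  apply: (@le_trans _ _ (\sum_i 2 * L * csq (a i))).
    apply: ler_sum => i _; rewrite rank1_frob mulrCA [p i * _]mulrA weight_inv_sq -mulrA.
    by rewrite ler_wpM2l // [csq (a i) * _]mulrC mulrA inv_weight_le.
  rewrite -mulr_sumr.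
  have -> : 2 * n1%:R * (L * K) = 2 * L * (n1%:R * K) by ring.
  by rewrite ler_wpM2l ?sum_csq_le // mulr_ge0 // ltW.
have LK : 0 < L * K by rewrite mulr_gt0.
have tauL : L * tau <= L * K / 2 by rewrite -mulrA ler_wpM2l // ltW.
have nu0 : 0 <= 2 * n1%:R :> R by rewrite mulr_ge0.
have GE y : (\sum_i p i *: Z i) *m realify y = realify (\sum_i cdot y (b i) *: a i).
  rewrite mulmx_suml realify_sum; apply: eq_bigr => i _.
  rewrite -scalemxAl rank1E realifyZr scalerA.
  (* For p_i = 0 the sampled term is lost, but then a_i = 0 by [a_le]; the sampling stays
     unbiased. *)
  have [p0|p0] := eqVneq (p i) 0; last by rewrite divff // scale1r.
  have : csq (a i) = 0 by apply/eqP; rewrite eq_le csq0 andbT (le_trans (a_le i)) // p0 mulr0.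
  by move=> /(hsq_eq0 (cdot_inner R n1)) ->; rewrite scaler0 realify0 scaler0.
have hE' om : E om -> exists2 y, 0 < sqn y &
     tau ^+ 2 * sqn y <= sqn ((t%:R^-1 *: (\sum_j Z (tnth om j)) - \sum_i p i *: Z i) *m y).
  move=> /hE[y y0 hy]; exists (realify y); first by rewrite sqn_realify.
  rewrite mulmxBl GE -scalemxAl mulmx_suml.
  under eq_bigr do rewrite rank1E.
  have realifyB (u v : 'cV[CC]_n1) : realify u - realify v = realify (u - v).
    by apply: (addIr (realify v)); rewrite -realifyD !subrK.
  by rewrite -realify_sum -realifyZr realifyB !sqn_realify.
have := rect_bernstein p_ge0 p_sum (ltW L_gt0) LK nu0 tau_gt0 lipZ_ lipZT varZ varZT trZ tauL t0 hE'.
by rewrite mulrA (_ : 2 * 2 = 4 :> R); last by lra.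
Qed.
End ComplexBernstein.

(** * Orthogonal families and Bessel's inequality *)

Section GramSchmidt.
Variables (R : realType) (H : lmodType R[i]) (ip : H -> H -> R[i]).
Hypothesis ipP : is_inner_product ip.
Local Notation CC := R[i].
Local Notation hsq := (hsq ip).

(** The u_j may be linearly dependent, so each f_i is either a unit vector or zero; the equation
    <f_i,f_i> f_i = f_i covers both cases. A vanishing residual yields f_N = 0, and beyond the
    processed indices the family is zero. *)
Lemma gram_schmidt (u : nat -> H) N : exists f : nat -> H,
  [/\ forall i j : nat, i != j -> ip (f i) (f j) = 0,
      forall i, ip (f i) (f i) *: f i = f i,
      forall i, hsq (f i) <= 1,
      forall j, (j < N)%N -> u j = \sum_(i < N) ip (u j) (f i) *: f i &
      forall i, exists c : nat -> CC, f i = \sum_(k < N) c k *: u k].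
Proof.
elim: N => [|N [f [f_orth f_unit f_le f_exp f_span]]].
  exists (fun _ => 0); split=> // [i j _|i|i|i].
  - by rewrite (ip0l ipP).
  - by rewrite scaler0.
  - by rewrite (hsq0 ipP).
  - by exists (fun _ => 0); rewrite big_ord0.
set g := u N - \sum_(i < N) ip (u N) (f i) *: f i.
have gf i : (i < N)%N -> ip g (f i) = 0.
  move=> iN; rewrite (ipBl ipP) (ip_suml ipP) (bigD1 (Ordinal iN)) //= big1 ?addr0.
    rewrite (ipZl ipP); have := congr1 (ip (u N)) (f_unit i).
    by rewrite (ipZr ipP) (ip_self ipP) /cconj /= oppr0 mulrC => ->; rewrite subrr.
  by move=> j ji; rewrite (ipZl ipP) f_orth ?mulr0.
set r : R := Num.sqrt (hsq g); set fN : H := if hsq g == 0 then 0 else Complex r^-1 0 *: g.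
have gfN : ip g fN *: fN = g.
  rewrite /fN; case: eqP => [/(hsq_eq0 ipP) ->|/eqP g0]; first by rewrite scaler0.
  have r0 : r != 0 by rewrite sqrtr_eq0 -ltNge lt_neqAle eq_sym g0 hsq_ge0.
  have rr : r ^+ 2 = hsq g by rewrite sqr_sqrtr ?hsq_ge0.
  rewrite (ipZr ipP) (ip_self ipP) -rr scalerA -[RHS]scale1r; congr (_ *: _).
  apply: complex_ext; rewrite !(creM, cimM) /= ?mulr0 ?mul0r ?subr0 ?addr0 ?oppr0 ?mulr0 ?mul0r ?subr0 ?addr0.
    by field.
  by ring.
have fNN : ip fN fN *: fN = fN.
  rewrite {1}/fN; case: eqP => [g0|_]; first by rewrite (ip0l ipP) scale0r /fN g0 eqxx.
  by rewrite (ipZl ipP) -scalerA gfN /fN; case: eqP => [/(hsq_eq0 ipP) ->|_] //; rewrite scaler0.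
have fNle : hsq fN <= 1.
  have := congr1 (ip fN) fNN; rewrite (ipZr ipP) (ip_self ipP) => /(congr1 (@cre R)).
  rewrite creM /= oppr0 mul0r subr0 -expr2.
  by move=> h; have := hsq_ge0 ipP fN; nra.
have ffN i : (i < N)%N -> ip fN (f i) = 0.
  move=> iN; rewrite /fN; case: eqP => _; first by rewrite (ip0l ipP).
  by rewrite (ipZl ipP) gf ?mulr0.
have fNf i : (i < N)%N -> ip (f i) fN = 0 by move=> iN; rewrite (ipC ipP) ffN // cconj0.
pose f' i := if (i < N)%N then f i else if i == N then fN else 0.
have f'E (i : 'I_N) : f' i = f i by rewrite /f' ltn_ord.
have f'N : f' N = fN by rewrite /f' ltnn eqxx.
exists f'; split.
- move=> i j ij; rewrite /f'.
  case: (ltnP i N) => iN; case: (ltnP j N) => jN.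
  + exact: f_orth.
  + by case: eqP => _; rewrite ?(ip0r ipP) // (ipC ipP) ffN // cconj0.
  + by case: eqP => _; rewrite ?(ip0l ipP) // ffN.
  + case: eqP => iE; last by rewrite (ip0l ipP).
    case: eqP => jE; last by rewrite (ip0r ipP).
    by rewrite iE jE eqxx in ij.
- move=> i; rewrite /f'; case: ltnP => _ //; case: eqP => _ //.
  by rewrite scaler0.
- move=> i; rewrite /f'; case: ltnP => _ //; case: eqP => _ //.
  by rewrite (hsq0 ipP).
- move=> j; rewrite ltnS leq_eqVlt big_ord_recr /= f'N.
  under eq_bigr do rewrite f'E.
  case/orP => [/eqP ->|jN].
    have -> : ip (u N) fN = ip g fN.
      rewrite (ipBl ipP) (ip_suml ipP) big1 ?subr0 // => i _.
      by rewrite (ipZl ipP) fNf ?mulr0.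
    by rewrite gfN /g addrC subrK.
  rewrite -f_exp // [in X in _ + X](f_exp j jN) (ip_suml ipP) big1 ?scale0r ?addr0 // => i _.
  by rewrite (ipZl ipP) fNf ?mulr0.
- have ext i (c : nat -> CC) : f i = \sum_(k < N) c k *: u k ->
      f i = \sum_(k < N.+1) (if (k < N)%N then c k else 0) *: u k.
    move=> ->; rewrite big_ord_recr /= ltnn scale0r addr0.
    by apply: eq_bigr => k _; rewrite ltn_ord.
  have spanf i : exists c : nat -> CC, f i = \sum_(k < N.+1) c k *: u k.
    by have [c /ext h] := f_span i; exists (fun k => if (k < N)%N then c k else 0).
  have span_g : exists c : nat -> CC, g = \sum_(k < N.+1) c k *: u k.
    have /choice[c hc] := f_span.
    exists (fun k => if k == N then 1 else - \sum_(i < N) ip (u N) (f i) * c i k).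
    rewrite big_ord_recr /= eqxx scale1r addrC; congr (_ + _).
    transitivity (- \sum_(i < N) \sum_(k < N) (ip (u N) (f i) * c i k) *: u k).
      congr (- _); apply: eq_bigr => i _; rewrite {2}hc scaler_sumr.
      by apply: eq_bigr => k _; rewrite scalerA.
    rewrite exchange_big -sumrN; apply: eq_bigr => k _ /=.
    by rewrite ltn_eqF // scaleNr scaler_suml.
  move=> i; rewrite /f'; case: ltnP => _ //; case: eqP => _; last first.
    by exists (fun _ => 0); rewrite big1 // => k _; rewrite scale0r.
  have [c hc] := span_g; rewrite /fN; case: eqP => _.
    by exists (fun _ => 0); rewrite big1 // => k _; rewrite scale0r.
  exists (fun k => Complex r^-1 0 * c k); rewrite hc scaler_sumr.
  by apply: eq_bigr => k _; rewrite scalerA.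
Qed.

Variables (f : nat -> H) (N : nat).
Hypothesis f_orth : forall i j : nat, i != j -> ip (f i) (f j) = 0.
Hypothesis f_unit : forall i, ip (f i) (f i) *: f i = f i.
Hypothesis f_le : forall i, hsq (f i) <= 1.

Lemma hsq_ortho_sum (c : 'I_N -> CC) :
  hsq (\sum_(i < N) c i *: f i) = \sum_(i < N) cmod2 (c i) * hsq (f i).
Proof.
transitivity (cre (ip (\sum_(i < N) c i *: f i) (\sum_(i < N) c i *: f i))) => //.
rewrite (ip_suml ipP) cre_sum; apply: eq_bigr => i _.
rewrite (ip_sumr ipP) (bigD1 i) //= big1 ?addr0 => [|j ji].
  by rewrite -[RHS](hsqZ ipP).
by rewrite (ipZl ipP) (ipZr ipP) f_orth ?mulr0 ?mulr0 // eq_sym.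
Qed.

Lemma hsq_ortho_le (c : 'I_N -> CC) :
  hsq (\sum_(i < N) c i *: f i) <= \sum_(i < N) cmod2 (c i).
Proof.
rewrite hsq_ortho_sum; apply: ler_sum => i _.
by rewrite ler_piMr ?cmod2_ge0.
Qed.

Lemma bessel h : \sum_(i < N) cmod2 (ip h (f i)) <= hsq h.
Proof.
set g := \sum_(i < N) ip h (f i) *: f i.
have hg : ip h g = Complex (\sum_(i < N) cmod2 (ip h (f i))) 0.
  apply: complex_ext; rewrite (ip_sumr ipP) ?cre_sum ?cim_sum /=.
    by apply: eq_bigr => i _; rewrite (ipZr ipP) mulrC mulc_conj.
  by apply: big1 => i _; rewrite (ipZr ipP) mulrC mulc_conj.
have gle : hsq g <= \sum_(i < N) cmod2 (ip h (f i)) by exact: hsq_ortho_le.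
have := hsq_ge0 ipP (h + - 1 *: g).
rewrite (hsqD ipP) (ipZr ipP) (hsqZ ipP) hg creM /= /cmod2 /= !oppr0; lra.
Qed.
End GramSchmidt.

(** * Reduction of an inner product space to finitely many coordinates *)

Section HilbertBernstein.
Variables (R : realType) (H : lmodType R[i]) (ip : H -> H -> R[i]).
Hypothesis ipP : is_inner_product ip.
Local Notation CC := R[i].
Local Notation csq x := (hsq (@cdot R _) x).

Lemma big_tuple_map (I J : finType) (g : I -> J) t (E : pred (t.-tuple I)) (F : t.-tuple J -> R) :
  injective g ->
  \sum_(om | [exists om0, E om0 && (om == [tuple of map g om0])]) F om =
  \sum_(om0 | E om0) F [tuple of map g om0].
Proof.
move=> gI; have hI : injective (fun om0 : t.-tuple I => [tuple of map g om0]).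
  by move=> x y /(congr1 val) /= /(inj_map gI) xy; apply: val_inj.
rewrite -[RHS](big_imset F (A := [pred om | E om])); last by move=> x y _ _; exact: hI.
apply: eq_bigl => om; apply/existsP/imsetP => [[x /andP[Ex /eqP ->]]|[x Ex ->]].
  by exists x.
by exists x; rewrite eqxx andbT.
Qed.

(** Passing from h to its coordinates in an orthonormal family spanning the u_j with j < N preserves
    every <h,u_j> and, by Bessel, does not increase the norm; a large deviation at h is thus one at
    the coordinates. Conversely y is lifted to the sum of the y_i f_i, of no larger norm, which
    carries the bound [uK] over to the coordinates. *)
Theorem hilbert_bernstein n N (v : nat -> 'cV[CC]_n) (u : nat -> H) (p : nat -> R) (L K tau : R)
  t (E : pred (t.-tuple 'I_N)) :
  (forall j, 0 <= p j) -> \sum_(j < N) p j <= 1 ->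
  0 < L -> 0 < K -> 0 < tau -> tau <= K / 2 ->
  (forall j, csq (v j) <= L * p j) -> (forall j, hsq ip (u j) <= L * p j) ->
  (forall x, \sum_(j < N) cmod2 (cdot x (v j)) <= K * csq x) ->
  (forall h, \sum_(j < N) cmod2 (ip h (u j)) <= K * hsq ip h) -> (0 < t)%N ->
  (forall om, E om -> exists2 h, 0 < hsq ip h &
     tau ^+ 2 * hsq ip h <= csq (Complex (t%:R^-1) 0 *: (\sum_j Complex (p (tnth om j))^-1 0 *:
          (ip h (u (tnth om j)) *: v (tnth om j))) - \sum_(j < N) ip h (u j) *: v j)) ->
  (\sum_(om | E om) \prod_j p (tnth om j)) * (expR (t%:R * tau ^+ 2 / (L * K) / 2) / 2 - 1) <=
  4 * n%:R * expR (t%:R * tau ^+ 2 / (L * K) / 5).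
Proof.
move=> p_ge0 p_le1 L0 K0 tau0 tauK v_le u_le vK uK t0 hE.
have [f [f_orth f_unit f_le f_exp _]] := gram_schmidt ipP u N.
pose b0 j : 'cV[CC]_N := \col_i ip (u j) (f i).
have cdot_b0 y j : cdot y (b0 j) = ip (\sum_i y i 0 *: f i) (u j).
  rewrite (ip_suml ipP); apply: eq_bigr => i _.
  by rewrite (ipZl ipP) mxE -(ipC ipP).
have cdot_coord h (j : 'I_N) : cdot (\col_i ip h (f i)) (b0 j) = ip h (u j).
  rewrite [in RHS](f_exp j) // (ip_sumr ipP); apply: eq_bigr => i _.
  by rewrite !mxE (ipZr ipP) mulrC.
have csq_coord h : csq (\col_i ip h (f i) : 'cV[CC]_N) <= hsq ip h.
  rewrite hsq_cdot; under eq_bigr do rewrite mxE.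
  exact: bessel.
(* The letter [None] carries the missing mass and contributes zero vectors. *)
pose p' (o : option 'I_N) := if o is Some j then p j else 1 - \sum_(j < N) p j.
pose a' (o : option 'I_N) := if o is Some j then v j else 0.
pose b' (o : option 'I_N) := if o is Some j then b0 j else 0.
have sumo (V : nmodType) (F : option 'I_N -> V) : \sum_o F o = F None + \sum_j F (Some j).
  rewrite (bigD1 None) //=; congr (_ + _).
  rewrite (reindex_omap Some id) //=; last by case.
  by apply: eq_bigl => j; rewrite eqxx.
have p'_ge0 o : 0 <= p' o by case: o => [j|] /=; rewrite ?subr_ge0.
have p'_sum : \sum_o p' o = 1 by rewrite sumo /= subrK.
have a'_le o : csq (a' o) <= L * p' o.
  case: o => [j|] //=; rewrite (hsq0 (cdot_inner R n)) mulr_ge0 ?subr_ge0 // ltW //.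
have b'_le o : csq (b' o) <= L * p' o.
  case: o => [j|] /=; first by apply: le_trans (u_le j); exact: csq_coord.
  by rewrite (hsq0 (cdot_inner R N)) mulr_ge0 ?subr_ge0 // ltW.
have aK x : \sum_o cmod2 (cdot x (a' o)) <= K * csq x.
  by rewrite sumo /= (ip0r (cdot_inner R n)) cmod2_0 add0r.
have bK y : \sum_o cmod2 (cdot y (b' o)) <= K * csq y.
  rewrite sumo /= (ip0r (cdot_inner R N)) cmod2_0 add0r.
  under eq_bigr do rewrite cdot_b0.
  apply: le_trans (uK _) _; rewrite ler_wpM2l ?(ltW K0) // hsq_cdot.
  exact: hsq_ortho_le.
pose E' := [pred om : t.-tuple (option 'I_N) | [exists om0, E om0 && (om == [tuple of map Some om0])]].
have hE' om : E' om -> exists2 y, 0 < csq y &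
     tau ^+ 2 * csq y <= csq (Complex (t%:R^-1) 0 *: (\sum_j Complex (p' (tnth om j))^-1 0 *:
          (cdot y (b' (tnth om j)) *: a' (tnth om j))) - \sum_o cdot y (b' o) *: a' o).
  move=> /existsP[om0 /andP[/hE[h h0 hh] /eqP ->]].
  set y : 'cV[CC]_N := \col_i ip h (f i); exists y; last first.
    rewrite sumo /= scaler0 add0r.
    under eq_bigr do rewrite tnth_map /= cdot_coord.
    under [X in _ - X]eq_bigr do rewrite cdot_coord.
    by apply: le_trans hh; rewrite ler_wpM2l ?sqr_ge0 // csq_coord.
  (* If all coordinates of h vanished, so would every <h,u_j> and hence the deviation, against the
     strictly positive lower bound. *)
  rewrite lt_neqAle eq_sym (hsq_ge0 (cdot_inner R N)) andbT; apply/eqP => y0.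
  have z j : ip h (u (nat_of_ord (j : 'I_N))) = 0.
    by rewrite -cdot_coord -/y (hsq_eq0 (cdot_inner R N) y0) (ip0l (cdot_inner R N)).
  move: hh; rewrite big1 => [|j _]; last by rewrite z scale0r scaler0.
  rewrite big1 => [|j _]; last by rewrite z scale0r.
  rewrite scaler0 subr0 (hsq0 (cdot_inner R n)) leNgt => /negP; apply.
  by rewrite mulr_gt0 // exprn_gt0.
have := complex_bernstein p'_ge0 p'_sum L0 K0 tau0 tauK a'_le b'_le aK bK t0 hE'.
rewrite /E' (big_tuple_map E (fun om => \prod_j p' (tnth om j))); last by move=> x y [].
by under eq_bigr do under eq_bigr do rewrite tnth_map /=.
Qed.
End HilbertBernstein.

(** * Limits and operator norms *)

Section Limits.
Variables (R : realType) (H : lmodType R[i]) (ip : H -> H -> R[i]).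
Hypothesis ipP : is_inner_product ip.
Implicit Types (u : nat -> H) (y z : H).

Lemma hconv_tail u y z c N : hconv ip u y ->
  (forall M, (N <= M)%N -> hnorm ip (u M - z) <= c) -> hnorm ip (y - z) <= c.
Proof.
move=> uy h; apply/ler_addgt0Pr => e e0; have [N' hN'] := uy _ e0.
have h1 := h (maxn N N') (leq_maxl _ _).
have h2 := hN' (maxn N N') (leq_maxr _ _).
have := hnormD ipP (y - u (maxn N N')) (u (maxn N N') - z).
rewrite addrA subrK (hnormB ipP y); lra.
Qed.

Lemma hconv_unique u y z : hconv ip u y -> hconv ip u z -> y = z.
Proof.
move=> uy uz; apply/eqP; rewrite -subr_eq0; apply/eqP/(hnorm_eq0 ipP)/eqP.
rewrite eq_le (hnorm_ge0 ip) andbT; apply/ler_addgt0Pr => e e0.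
have [N hN] := uz _ e0; rewrite add0r; apply: (hconv_tail (N := N)) uy _ => M NM.
by rewrite ltW ?hN.
Qed.

Lemma hlimP u : (exists y, hconv ip u y) -> hconv ip u (hlim ip u).
Proof. exact: epsilon_spec. Qed.
End Limits.

Section ComplexSeries.
Import numFieldNormedType.Exports.
Variable R : realType.
Local Notation CC := R[i].

(** The complex numbers as an inner product space, so that the lemmas on [hnorm] and [hconv] apply
    to [cmod] and to scalar series. *)
Definition cip (x y : CC^o) : CC := x * cconj y.

Lemma cip_inner : @is_inner_product R CC^o cip.
Proof.
split=> [a x y z|x y|x|x].
- by rewrite /cip mulrDl -mulrA.
- by rewrite /cip cconjM cconjK mulrC.
- by rewrite /cip mulc_conj; split=> //=; exact: cmod2_ge0.
- by rewrite /cip mulc_conj => -[] /cmod2_eq0.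
Qed.

Lemma cmod_hnorm (x : CC) : cmod x = hnorm cip x.
Proof. by rewrite /hnorm /cip mulc_conj. Qed.

Lemma cmodD (x y : CC) : cmod (x + y) <= cmod x + cmod y.
Proof. rewrite !cmod_hnorm; exact: (hnormD cip_inner). Qed.

Lemma real_series_lim (f g : nat -> R) c : (forall k, `|f k| <= g k) ->
  (forall M : nat, \sum_(k < M) g k <= c) ->
  exists l, forall e, 0 < e -> exists N : nat, forall M, (N <= M)%N -> `|\sum_(k < M) f k - l| < e.
Proof.
move=> fg gc.
have cg : cvgn (series f).
  apply: normed_cvg; apply: nondecreasing_is_cvgn.
    by apply: nondecreasing_series => k _ _; exact: normr_ge0.
  exists c => _ [M _ <-]; rewrite /= /series /= big_mkord; apply: le_trans (gc M).
  by apply: ler_sum.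
exists (limn (series f)) => e e0.
have /cvgrPdist_lt/(_ _ e0)[N _ hN] := cg.
by exists N => M NM; have := hN M NM; rewrite distrC /series /= big_mkord.
Qed.

(** [csum] is an arbitrary choice unless a limit exists; absolute convergence of real and imaginary
    parts provides one. *)
Lemma csumP (a : nat -> CC) c : (forall M : nat, \sum_(k < M) cmod (a k) <= c) ->
  @hconv R CC^o cip (fun M => \sum_(k < M) a k) (csum a).
Proof.
move=> ac.
have [l1 h1] := real_series_lim (fun k => cre_le_cmod (a k)) ac.
have [l2 h2] := real_series_lim (fun k => cim_le_cmod (a k)) ac.
pose P L := forall e : R, 0 < e -> exists N : nat, forall M, (N <= M)%N -> cmod (\sum_(k < M) a k - L) < e.
suff /(epsilon_spec (inhabits 0) P) : exists L, P L.
  by move=> h e /h[N hN]; exists N => M /hN; rewrite cmod_hnorm.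
exists (Complex l1 l2) => e e0.
have e20 : 0 < e / 2 by rewrite divr_gt0.
have [N1 hN1] := h1 _ e20; have [N2 hN2] := h2 _ e20.
exists (maxn N1 N2) => M; rewrite geq_max => /andP[/hN1 a1 /hN2 a2].
set z := _ - _; have zE : z = Complex (cre z) 0 + Complex 0 (cim z).
  by apply: complex_ext; rewrite ?creD ?cimD /= ?addr0 ?add0r.
have cz1 : cre z = \sum_(k < M) cre (a k) - l1 by rewrite creD creN cre_sum.
have cz2 : cim z = \sum_(k < M) cim (a k) - l2 by rewrite cimD cimN cim_sum.
rewrite zE (le_lt_trans (cmodD _ _)) //.
rewrite /cmod /cmod2 /= !expr0n addr0 add0r !sqrtr_sqr cz1 cz2; lra.
Qed.
End ComplexSeries.

Section OpNorm.
Variable R : realType.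

(** [sup] is meaningful on nonempty bounded sets only: [x0] gives nonemptiness, [c] bounds the
    values of g, and c + e those of f. *)
Lemma opnorm_dist (X Y : Type) (nX : X -> R) (nY : Y -> R) (f g : X -> Y) x0 c e :
  nX x0 <= 1 -> (forall x, nX x <= 1 -> nY (g x) <= c) ->
  (forall x, nX x <= 1 -> `|nY (f x) - nY (g x)| <= e) ->
  `|opnorm nX nY f - opnorm nX nY g| <= e.
Proof.
move=> hx0 gc fg.
have fc x : nX x <= 1 -> nY (f x) <= c + e.
  by move=> h; have := fg x h; have := gc x h; rewrite ler_norml; lra.
have supg : has_sup [set nY (g x) | x in [set x | nX x <= 1]].
  by split; [exists (nY (g x0)), x0|exists c => _ [x hx <-]; exact: gc].
have supf : has_sup [set nY (f x) | x in [set x | nX x <= 1]].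
  by split; [exists (nY (f x0)), x0|exists (c + e) => _ [x hx <-]; exact: fc].
have h1 : opnorm nX nY f <= opnorm nX nY g + e.
  apply: sup_le_ub; first by case: supf.
  move=> _ [x hx <-]; have := fg x hx; rewrite ler_norml.
  have : nY (g x) <= opnorm nX nY g by apply: sup_upper_bound => //; exists x.
  lra.
have h2 : opnorm nX nY g <= opnorm nX nY f + e.
  apply: sup_le_ub; first by case: supg.
  move=> _ [x hx <-]; have := fg x hx; rewrite ler_norml.
  have : nY (f x) <= opnorm nX nY f by apply: sup_upper_bound => //; exists x.
  lra.
rewrite ler_norml; lra.
Qed.

Variables (X Y : lmodType R[i]) (ipX : X -> X -> R[i]) (ipY : Y -> Y -> R[i]).
Hypotheses (ipXP : is_inner_product ipX) (ipYP : is_inner_product ipY).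
Variables (f : X -> Y) (c : R).
Hypothesis f_le : forall x, hnorm ipY (f x) <= c * hnorm ipX x.
Hypothesis fZ : forall (r : R) x, f (Complex r 0 *: x) = Complex r 0 *: f x.

(** The a priori bound [f_le] makes the supremum genuine; x is normalised by the real scalar 1/|x|,
    whence the form of [fZ]. *)
Lemma opnorm_hnorm_le x :
  hnorm ipY (f x) <= opnorm (hnorm ipX) (hnorm ipY) f * hnorm ipX x.
Proof.
have [x0|x0] := eqVneq (hnorm ipX x) 0; first by have := f_le x; rewrite x0 !mulr0.
have xp : 0 < hnorm ipX x by rewrite lt_neqAle eq_sym x0 hnorm_ge0.
set r := hnorm ipX x in xp x0 *.
have cr (s : R) : 0 <= s -> cmod (Complex s 0) = s.
  by move=> s0; rewrite /cmod /cmod2 /= expr0n addr0 sqrtr_sqr ger0_norm.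
have fx' : hnorm ipY (f (Complex r^-1 0 *: x)) = r^-1 * hnorm ipY (f x).
  by rewrite fZ (hnormZ ipYP) cr // invr_ge0 ltW.
have x'1 : hnorm ipX (Complex r^-1 0 *: x) = 1.
  by rewrite (hnormZ ipXP) cr ?invr_ge0 ?(ltW xp) // mulVf.
rewrite mulrC -ler_pdivrMl // -fx'; apply: sup_upper_bound; last first.
  by exists (Complex r^-1 0 *: x) => //=; rewrite x'1.
split; first by exists (hnorm ipY (f (Complex r^-1 0 *: x))), (Complex r^-1 0 *: x) => //=; rewrite x'1.
(* The constant [c] is not assumed nonnegative, so its absolute value serves as the upper bound on
   the unit ball. *)
exists `|c| => _ [z /= z1 <-]; apply: le_trans (f_le z) _.
have := ler_norm c; have := normr_ge0 c; have := hnorm_ge0 ipX z; nra.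
Qed.

Lemma opnorm_hnorm_ge0 : 0 <= opnorm (hnorm ipX) (hnorm ipY) f.
Proof.
rewrite (_ : 0 = hnorm ipY (f 0)); last first.
  apply/eqP; rewrite eq_le hnorm_ge0 /=.
  by have := f_le 0; rewrite (hnorm0 ipXP) mulr0.
apply: sup_upper_bound; last by exists 0 => //=; rewrite (hnorm0 ipXP).
split; first by exists (hnorm ipY (f 0)), 0 => //=; rewrite (hnorm0 ipXP).
exists `|c| => _ [z /= z1 <-]; apply: le_trans (f_le z) _.
have := ler_norm c; have := normr_ge0 c; have := hnorm_ge0 ipX z; nra.
Qed.
End OpNorm.

(** * Series dominated by the sampling distribution *)

Section Distribution.
Import numFieldNormedType.Exports.
Local Open Scope classical_set_scope.
Local Open Scope ring_scope.
Variables (R : realType) (p : nat -> R).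
Hypothesis pP : is_distribution p.

Lemma distr_ge0 j : 0 <= p j. Proof. by case: pP. Qed.

Lemma distr_sum_le1 (N : nat) : \sum_(j < N) p j <= 1.
Proof.
case: pP => p0 p1; rewrite -lee_fin -p1 -sumEFin -(big_mkord xpredT (fun j => (p j)%:E)).
by apply: nneseries_lim_ge => j _ _; rewrite lee_fin.
Qed.

Lemma distr_sum_cvg e : 0 < e -> exists N : nat, forall M, (N <= M)%N -> 1 - e < \sum_(j < M) p j.
Proof.
case: pP => p0 p1 e0.
have h : (fun M => (\sum_(0 <= j < M) (p j)%:E)%E) @ \oo --> (1%:E : \bar R).
  rewrite -p1; apply: is_cvg_nneseries => j _ _; by rewrite lee_fin.
have /fine_cvg/cvgrPdist_lt/(_ _ e0)[N _ hN] := h.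
exists N => M NM; have := hN M NM; rewrite /= sumEFin /= big_mkord ltr_norml; lra.
Qed.

Lemma distr_sum_between (N M : nat) : (N <= M)%N ->
  \sum_(j < M) p j - \sum_(j < N) p j = \sum_(N <= j < M) p j.
Proof.
move=> NM; rewrite -!(big_mkord xpredT p) (big_cat_nat _ (n := N) (p := M)) //=.
by rewrite addrAC subrr add0r.
Qed.
End Distribution.

Section Series.
Local Open Scope classical_set_scope.
Local Open Scope ring_scope.
Variables (R : realType) (H : lmodType R[i]) (ip : H -> H -> R[i]).
Hypothesis ipP : is_inner_product ip.
Variable p : nat -> R.
Hypothesis pP : is_distribution p.
Local Notation CC := R[i].

Section Dominated.
Variables (a : nat -> H) (c : R).
Hypotheses (c0 : 0 <= c) (ac : forall j, hnorm ip (a j) <= c * p j).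

(** Domination by [p] makes the remainder proportional to the mass of the discarded letters; this is
    how truncation at [N] is controlled. *)
Lemma series_diff_le (N M : nat) : (N <= M)%N ->
  hnorm ip (\sum_(j < M) a j - \sum_(j < N) a j) <= c * (1 - \sum_(j < N) p j).
Proof.
move=> NM; rewrite -!(big_mkord xpredT a) (big_cat_nat _ (n := N) (p := M)) //= addrAC subrr add0r.
apply: le_trans (hnorm_sum ipP _ _ _) _.
apply: (@le_trans _ _ (\sum_(N <= j < M) c * p j)); first by apply: ler_sum.
rewrite -mulr_sumr ler_wpM2l // -(distr_sum_between _ NM) lerD2r.
exact: distr_sum_le1.
Qed.

Lemma series_cauchy : hcauchy ip (fun M => \sum_(j < M) a j).
Proof.
move=> e e0; have e1 : 0 < e / (2 * (c + 1)) by rewrite divr_gt0 // mulr_gt0 // ltr_wpDl.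
have [N hN] := distr_sum_cvg pP e1; exists N => M1 M2 h1 h2.
have d1 := series_diff_le h1; have d2 := series_diff_le h2.
have := hnormD ipP (\sum_(j < M1) a j - \sum_(j < N) a j) (\sum_(j < N) a j - \sum_(j < M2) a j).
rewrite addrA subrK (hnormB ipP (\sum_(j < N) a j)).
have hq := hN N (leqnn N); set q := \sum_(j < N) p j in hq d1 d2.
have h3 : c * (1 - q) <= c * (e / (2 * (c + 1))) by rewrite ler_wpM2l //; lra.
have h4 : 2 * (c * (e / (2 * (c + 1)))) = e * (c / (c + 1)) by field; rewrite gt_eqF // ltr_wpDl.
have h5 : e * (c / (c + 1)) < e.
  by rewrite gtr_pMr // ltr_pdivrMr ?ltr_wpDl // mul1r ltrDl.
lra.
Qed.

Lemma series_tail y (N : nat) : hconv ip (fun M => \sum_(j < M) a j) y ->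
  hnorm ip (y - \sum_(j < N) a j) <= c * (1 - \sum_(j < N) p j).
Proof.
by move=> hy; apply: (hconv_tail ipP (N := N)) hy _ => M NM; exact: series_diff_le.
Qed.

Lemma series_le y : hconv ip (fun M => \sum_(j < M) a j) y -> hnorm ip y <= c.
Proof. by move=> /(series_tail 0); rewrite !big_ord0 !subr0 mulr1. Qed.
End Dominated.

Lemma hconvZ u y k : hconv ip u y -> hconv ip (fun M => k *: u M) (k *: y).
Proof.
move=> h e e0; have k0 : 0 < cmod k + 1 by rewrite ltr_wpDl // sqrtr_ge0.
have [N hN] := h _ (divr_gt0 e0 k0); exists N => M NM.
have := hN M NM; rewrite -scalerBr (hnormZ ipP) ltr_pdivlMr // mulrDr mulr1 mulrC.
have := hnorm_ge0 ip (u M - y); lra.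
Qed.

Lemma hconvD u1 u2 y1 y2 : hconv ip u1 y1 -> hconv ip u2 y2 ->
  hconv ip (fun M => u1 M + u2 M) (y1 + y2).
Proof.
move=> h1 h2 e e0; have e2 : 0 < e / 2 by rewrite divr_gt0.
have [N1 hN1] := h1 _ e2; have [N2 hN2] := h2 _ e2.
exists (maxn N1 N2) => M; rewrite geq_max => /andP[/hN1 a1 /hN2 a2].
by rewrite opprD addrACA (le_lt_trans (hnormD ipP _ _)) //; lra.
Qed.

Lemma hconv_cst y : hconv ip (fun=> y) y.
Proof. by move=> e e0; exists 0%N => M _; rewrite subrr (hnorm0 ipP). Qed.

Lemma hconv_sum (I : finType) (u : I -> nat -> H) (y : I -> H) :
  (forall i, hconv ip (u i) (y i)) -> hconv ip (fun M => \sum_i u i M) (\sum_i y i).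
Proof.
move=> h; rewrite (_ : (fun M => \sum_i u i M) = \sum_i (u i : nat -> H)).
  apply: (big_ind2 (fun (v : nat -> H) z => hconv ip v z)) => //.
    exact: hconv_cst.
  by move=> *; exact: hconvD.
by apply/funext => M; rewrite fct_sumE.
Qed.

(* The partial sums of the quadratic form increase with N and are bounded by <S_N x, x>. *)
Lemma sum_cmod2_le (v : nat -> H) x y (N : nat) :
  hconv ip (fun M => \sum_(j < M) ip x (v j) *: v j) y ->
  \sum_(j < N) cmod2 (ip x (v j)) <= hnorm ip y * hnorm ip x.
Proof.
move=> hy; apply/ler_addgt0Pr => e e0.
have x1 : 0 < hnorm ip x + 1 by rewrite ltr_wpDl // hnorm_ge0.
have [N' hN'] := hy _ (divr_gt0 e0 x1); set M := maxn N N'.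
have h := hN' M (leq_maxr _ _).
have mono : \sum_(j < N) cmod2 (ip x (v j)) <= \sum_(j < M) cmod2 (ip x (v j)).
  rewrite -!(big_mkord xpredT (fun j => cmod2 (ip x (v j)))) [leRHS](big_cat_nat _ (n := N)) ?leq_maxl //=.
  by rewrite lerDl; apply: sumr_ge0 => j _; exact: cmod2_ge0.
apply: le_trans mono _.
have E : cre (ip (\sum_(j < M) ip x (v j) *: v j) x) = \sum_(j < M) cmod2 (ip x (v j)).
  rewrite (ip_suml ipP) cre_sum; apply: eq_bigr => j _.
  by rewrite (ipZl ipP) (ipC ipP x) mulc_conj.
rewrite -E; apply: le_trans (le_trans (ler_norm _) (cre_le_cmod _)) _.
apply: le_trans (cmod_ip ipP _ _) _.
have := hnormD ipP (\sum_(j < M) ip x (v j) *: v j - y) y; rewrite subrK.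
move: h; rewrite ltr_pdivlMr // => h1 h2.
have := hnorm_ge0 ip x; have := hnorm_ge0 ip (\sum_(j < M) ip x (v j) *: v j - y); nra.
Qed.
End Series.

Section CVectorConv.
Variable R : realType.
Local Notation CC := R[i].

Lemma hconv_col n (u : nat -> 'cV[CC]_n) (y : 'cV[CC]_n) :
  (forall k, @hconv R CC^o (@cip R) (fun M => u M k 0) (y k 0)) -> hconv (@cdot R n) u y.
Proof.
move=> h.
have E (x : 'cV[CC]_n) : x = \sum_k (x k 0) *: delta_mx k 0.
  apply/matrixP => k j; rewrite (ord1 j) summxE (bigD1 k) //= !mxE !eqxx mulr1 big1 ?addr0 // => l lk.
  by rewrite !mxE eq_sym (negPf lk) mulr0.
rewrite [y]E (_ : u = (fun M => \sum_k (u M k 0) *: delta_mx k 0)); last by apply/funext.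
apply: hconv_sum; first exact: cdot_inner.
move=> k e e0; have [N hN] := h k e e0; exists N => M /hN.
rewrite -scalerBl (hnormZ (cdot_inner R n)) -cmod_hnorm.
have -> : hnorm (@cdot R n) (delta_mx k 0) = 1.
  rewrite /hnorm -/(hsq _ _) hsq_cdot (bigD1 k) //= mxE !eqxx big1 ?addr0 => [|l lk].
    by rewrite /cmod2 /= expr1n expr0n addr0 sqrtr1.
  by rewrite mxE (negPf lk) cmod2_0.
by rewrite mulr1.
Qed.

Lemma cmod_coord_le n (x : 'cV[CC]_n) k : cmod (x k 0) <= hnorm (@cdot R n) x.
Proof.
rewrite /hnorm -/(hsq _ _) hsq_cdot ler_wsqrtr // (bigD1 k) //= lerDl.
by apply: sumr_ge0 => j _; exact: cmod2_ge0.
Qed.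
End CVectorConv.

(** * Projections, Riesz sequences and the sampled matrices *)

Section Projection.
Variables (R : realType) (H : lmodType R[i]) (ip : H -> H -> R[i]).
Hypothesis ipP : is_inner_product ip.
Variables (w : nat -> H) (n : nat).
Local Notation CC := R[i].
Local Notation P := (Pperp ip w n).

(** [Pperp] is a choice; subtracting from h its components along a Gram-Schmidt family of the w_k
    shows that a suitable vector exists. *)
Lemma PperpP h : (forall k : 'I_n, ip (P h) (w k) = 0) /\
  exists c : 'I_n -> CC, h - P h = \sum_(k < n) c k *: w k.
Proof.
rewrite /Pperp; apply: (epsilon_spec (inhabits (0 : H)) (fun y : H => (forall k : 'I_n, ip y (w k) = 0) /\
    exists c : 'I_n -> CC, h - y = \sum_(k < n) c k *: w k)).
have [f [f_orth f_unit f_le f_exp f_span]] := gram_schmidt ipP w n.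
exists (h - \sum_(i < n) ip h (f i) *: f i); split.
  move=> k; rewrite (f_exp k) // (ip_sumr ipP) big1 // => i _; rewrite (ipZr ipP).
  rewrite (ipBl ipP) (ip_suml ipP) (bigD1 i) //= big1 ?addr0 => [|j ji].
    rewrite (ipZl ipP); have := congr1 (ip h) (f_unit i).
    by rewrite (ipZr ipP) (ip_self ipP) /cconj /= oppr0 mulrC => ->; rewrite subrr mulr0.
  by rewrite (ipZl ipP) f_orth ?mulr0.
have /choice[c hc] := f_span.
exists (fun k => \sum_(i < n) ip h (f i) * c i k); rewrite opprB addrC subrK.
under eq_bigr do rewrite {2}hc scaler_sumr.
rewrite exchange_big; apply: eq_bigr => k _ /=.
by rewrite scaler_suml; apply: eq_bigr => i _; rewrite scalerA.
Qed.

(** Both sides equal <Ph,Pg>. The projection thus moves from h onto s_j, where it produces u_j. *)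
Lemma ip_Pperp h g : ip (P h) g = ip h (P g).
Proof.
have [h1 [c hc]] := PperpP h; have [g1 [d hd]] := PperpP g.
have e1 : ip (P h) (g - P g) = 0.
  by rewrite hd (ip_sumr ipP) big1 // => k _; rewrite (ipZr ipP) h1 mulr0.
have e2 : ip (h - P h) (P g) = 0.
  by rewrite hc (ip_suml ipP) big1 // => k _; rewrite (ipZl ipP) (ipC ipP) g1 cconj0 mulr0.
have -> : ip (P h) g = ip (P h) (P g) + ip (P h) (g - P g) by rewrite -(ipDr ipP) addrC subrK.
have -> : ip h (P g) = ip (P h) (P g) + ip (h - P h) (P g) by rewrite -(ipDl ipP) addrC subrK.
by rewrite e1 e2.
Qed.
End Projection.

Section Riesz.
Variables (R : realType) (H : lmodType R[i]) (ip : H -> H -> R[i]).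
Hypothesis ipP : is_inner_product ip.
Variables (w : nat -> H) (Cw Dw : R) (n : nat).
Hypothesis rieszP : is_riesz_cspan ip w Cw Dw.
Local Notation CC := R[i].
Local Notation csq x := (hsq (@cdot R _) x).

Lemma eseries_ord (x : nat -> R) : (forall k, (n <= k)%N -> x k = 0) ->
  (\sum_(0 <= k <oo) (x k)%:E)%E = (\sum_(k < n) x k)%:E.
Proof.
move=> x0; apply: cvg_lim => //; apply: cvg_near_cst; exists n => // M /= nM.
rewrite (big_cat_nat (n := n)) //=.
have -> : (\sum_(n <= k < M) (x k)%:E = 0)%E.
  by rewrite big_nat big1 // => k /andP[nk _]; rewrite x0.
by rewrite adde0 big_mkord sumEFin.
Qed.

(** The Riesz bounds are applied to y extended by zeros, whose partial sums are stationary from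
    index [n] on. *)
Lemma Wn_bounds (y : 'cV[CC]_n) :
  Cw * csq y <= hsq ip (Wn w y) /\ hsq ip (Wn w y) <= Dw * csq y.
Proof.
case: rieszP => _ _ rieszE.
pose x k : CC := if insub k is Some i then y i 0 else 0.
have xE (k : 'I_n) : x k = y k 0 by rewrite /x valK.
have x0 k : (n <= k)%N -> x k = 0 by move=> nk; rewrite /x insubN // -leqNgt.
have sx : (\sum_(0 <= k <oo) (cmod2 (x k))%:E)%E = (csq y)%:E.
  rewrite eseries_ord => [|k /x0 ->]; last exact: cmod2_0.
  by rewrite hsq_cdot; congr (_%:E); apply: eq_bigr => k _; rewrite xE.
have [|z [hz]] := rieszE x; first by rewrite sx ltry.
rewrite sx /= hnormE //.
have -> // : z = Wn w y.
apply: (hconv_unique ipP hz) => e e0; exists n => M nM.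
rewrite -(big_mkord xpredT (fun k => x k *: w k)) (big_cat_nat (n := n)) //=.
have -> : \sum_(n <= k < M) x k *: w k = 0.
  by rewrite big_nat big1 // => k /andP[/x0 -> _]; rewrite scale0r.
rewrite addr0 big_mkord (_ : \sum_(i < n) _ = Wn w y) ?subrr ?hnorm0 //.
by apply: eq_bigr => k _; rewrite xE.
Qed.

Lemma hnorm_Wn_le (y : 'cV[CC]_n) : hnorm ip (Wn w y) <= Num.sqrt Dw * hnorm (@cdot R n) y.
Proof.
have D0 : 0 <= Dw by case: rieszP => C0 CD _; exact: ltW (lt_le_trans C0 CD).
by rewrite /hnorm -sqrtrM // ler_wsqrtr //; case: (Wn_bounds y).
Qed.

Lemma Wn_eq0 (y : 'cV[CC]_n) : Wn w y = 0 -> y = 0.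
Proof.
move=> h; have [h1 _] := Wn_bounds y; rewrite h hsq0 // in h1.
apply: (hsq_eq0 (cdot_inner R n)); apply/eqP; rewrite eq_le (hsq_ge0 (cdot_inner R n)) andbT.
by case: rieszP => C0 _ _; move: h1; rewrite pmulr_rle0.
Qed.

Lemma WnB (x y : 'cV[CC]_n) : Wn w (x - y) = Wn w x - Wn w y.
Proof. by rewrite /Wn -sumrB; apply: eq_bigr => k _; rewrite !mxE scalerBl. Qed.
End Riesz.

(** * Numerical estimates and restriction to finitely many letters *)

Section Numeric.
Local Open Scope classical_set_scope.
Local Open Scope ring_scope.
Variable R : realType.

Lemma bernoulli_ineq (q : R) m : 0 <= q <= 1 -> 1 - m%:R * (1 - q) <= q ^+ m.
Proof.
move=> /andP[q0 q1]; elim: m => [|m IH]; first by rewrite expr0 mul0r subr0.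
have h : q * (1 - m%:R * (1 - q)) <= q ^+ m.+1 by rewrite exprS ler_wpM2l.
apply: le_trans h; rewrite -natr1.
have : 0 <= m%:R * (1 - q) ^+ 2 by rewrite mulr_ge0 ?sqr_ge0.
lra.
Qed.

(** Write exp(Q/2) = y z with y = exp(3Q/10) >= t = 56n/delta and z = exp(Q/5) >= 1. Since yz >= 56,
    the subtracted 1 costs at most yz/56, leaving (1/2 - 1/56) yz = (27/56) yz. Dividing by z gives
    P <= 4 delta/27, which is below delta/4. *)
Lemma tail_numeric (P Q delta : R) n : (0 < n)%N -> 0 < delta < 1 -> 0 <= P ->
  ln (56 * n%:R / delta) <= 3 / 10 * Q ->
  P * (expR (Q / 2) / 2 - 1) <= 4 * n%:R * expR (Q / 5) -> P <= delta / 4.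
Proof.
move=> n0 /andP[d0 d1] P0 hQ hP.
have n1 : 1 <= n%:R :> R by rewrite ler1n.
set t := 56 * n%:R / delta in hQ.
have t56 : 56 <= t by rewrite ler_pdivlMr //; nra.
have t0 : 0 < t by lra.
have ey : t <= expR (3 / 10 * Q) by rewrite -[t in t <= _](lnK t0) ler_expR.
set y := expR (3 / 10 * Q) in ey; set z := expR (Q / 5) in hP.
have E : expR (Q / 2) = y * z by rewrite /y /z -expRD; congr expR; lra.
rewrite E in hP.
have z1 : 1 <= z.
  have h0 : 0 <= ln t by apply: ln_ge0; lra.
  by have := expR_ge1Dx (Q / 5); rewrite -/z; lra.
have td : t * delta = 56 * n%:R by rewrite /t divfK // gt_eqF.
have h1 : 27 / 56 * (y * z) <= y * z / 2 - 1.
  have : 56 * 1 <= y * z by rewrite ler_pM //; lra.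
  lra.
have h2 : P * (27 / 56 * (t * z)) <= 4 * n%:R * z.
  apply: le_trans hP; rewrite ler_wpM2l //; apply: le_trans h1.
  by rewrite ler_wpM2l ?divr_ge0 // ler_wpM2r //; lra.
have h3 : P * (27 / 56 * t) <= 4 * n%:R.
  have E2 : P * (27 / 56 * (t * z)) = P * (27 / 56 * t) * z by ring.
  by rewrite E2 ler_pM2r // in h2; lra.
have h4 : P * 27 * n%:R <= 4 * n%:R * delta by nra.
have : P * 27 <= 4 * delta by nra.
lra.
Qed.

(** Here x, g and S stand for |Sigma^-1|, |Gamma| and sqrt(D), and tau is the deviation that
    corresponds to eps. The bound on eps gives 2 x tau < 1 because 2x min(1, 2x) <= M^2. The factor
    2/3 leaves room to enlarge tau to 4 tau/3, as (2/3)(4/3) < 1. *)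
Lemma sample_accuracy (x g S eps : R) : 0 < x -> 0 <= g -> 0 < S -> 0 < eps ->
  let Lam := 1 + x + g in let M := Num.max 1 (2 * x) in
  eps < Lam * S * Num.min 1 (2 * x) ->
  exists tau, [/\ 0 < tau, eps = Lam * S * M ^+ 2 * tau, 2 * x * tau < 1 &
    2 * x * (1 + x * g) <= 2 / 3 * (Lam * M ^+ 2)].
Proof.
move=> x0 g0 S0 e0 Lam M he.
have Lam0 : 0 < Lam by rewrite /Lam; lra.
have LS : 0 < Lam * S by rewrite mulr_gt0.
have M1 : 1 <= M by rewrite le_max lexx.
have M20 : 0 < M ^+ 2 by rewrite exprn_gt0 // (lt_le_trans ltr01).
have D0 : 0 < Lam * S * M ^+ 2 by rewrite mulr_gt0.
exists (eps / (Lam * S * M ^+ 2)); split.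
- by rewrite divr_gt0.
- by field; rewrite !gt_eqF // (lt_le_trans ltr01).
- rewrite mulrA ltr_pdivrMr // mul1r.
  have h : 2 * x * eps < 2 * x * (Lam * S * Num.min 1 (2 * x)) by rewrite ltr_pM2l // mulr_gt0.
  apply: lt_le_trans h _.
  rewrite mulrCA ler_pM2l // /M; case: (leP 1 (2 * x)) => h1; first by nra.
  nra.
- rewrite /Lam /M; case: (leP 1 (2 * x)) => h1.
    have : 0 <= x * g by rewrite mulr_ge0 // ltW.
    have : 0 <= (x ^+ 2) * g by rewrite mulr_ge0 // exprn_ge0 // ltW.
    have : 2 * x <= 8 / 3 * x ^+ 2 * (1 + x) by nra.
    nra.
  have : x ^+ 2 * g <= 1 / 4 * g by rewrite ler_wpM2r //; nra.
  nra.
Qed.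

(** The samples with all letters below [N] are finitely many, so they form a finite partial sum of
    the nonnegative infinite one. *)
Lemma prob_iid_ge (p : nat -> R) m (E : set (m.-tuple nat)) N (G : pred (m.-tuple 'I_N)) :
  (forall j, 0 <= p j) ->
  (forall om, G om -> E [tuple of map val om]) ->
  ((\sum_(om | G om) \prod_j p (tnth om j))%:E <= prob_iid p E)%E.
Proof.
move=> p0 GE; rewrite /prob_iid.
have inj : injective (fun om : m.-tuple 'I_N => [tuple of map val om] : m.-tuple nat).
  by move=> x y /(congr1 val) /= /(inj_map val_inj) xy; apply: val_inj.
set r := [seq ([tuple of map val om] : m.-tuple nat) | om : m.-tuple 'I_N in [pred om | G om]].
have ur : uniq r by rewrite map_inj_uniq // enum_uniq.
apply: esum_ge; exists [set` r].
  split; first exact: finite_seq.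
  by move=> om /= /mapP[om0]; rewrite mem_enum => /GE h ->.
rewrite -fsbig_seq // big_map big_enum sumEFin lee_fin le_eqVlt; apply/orP; left; apply/eqP.
apply: eq_bigr => om _.
by apply: eq_bigr => j _; rewrite tnth_map.
Qed.
End Numeric.

(** * The operators of the theorem and their sampled versions *)

Section Setup.
Local Open Scope classical_set_scope.
Local Open Scope ring_scope.
Variables (R : realType) (H : lmodType R[i]) (ip : H -> H -> R[i]).
Variables (s w : nat -> H) (Cw Dw : R) (p : nat -> R) (n : nat).
Hypothesis hilb : is_separable_hilbert ip.
Hypothesis rieszP : is_riesz_cspan ip w Cw Dw.
Hypothesis inj : forall h, in_cspan ip w h -> (forall k, ip h (s k) = 0) -> h = 0.
Hypothesis pP : is_distribution p.
Hypothesis R_fin : (Rconst ip s w n p < +oo)%E.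
Hypothesis R'_fin : (Rconst' ip s w n p < +oo)%E.
Hypothesis supp_p : forall j, vvec ip s w n j != 0 -> 0 < p j.
Local Notation CC := R[i].
Local Notation csq x := (hsq (@cdot R _) x).
Local Notation v := (vvec ip s w n).
Local Notation L := (Rconst'' ip s w n p).
Local Notation K := (Kconst ip s w n p).
Let ipP : is_inner_product ip. Proof. by case: hilb. Qed.
Let cP := cdot_inner R n.

(* Outside supp p the vector u_j is unconstrained, but it only ever meets v_j = 0. *)
Definition uvec_supp j : H := if 0 < p j then uvec ip s w n j else 0.

(** [fine] is 0 at both infinities: a member of the set excludes minus infinity, and [fin] excludes
    plus infinity. *)
Lemma fine_sup_ge (f : nat -> R) j :
  (ereal_sup [set (f j)%:E | j in [set j | (0 < p j)%R]] < +oo)%E -> 0 < p j ->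
  f j <= fine (ereal_sup [set (f j)%:E | j in [set j | 0 < p j]]).
Proof.
move=> fin pj; set S := ereal_sup _ in fin *.
have h : ((f j)%:E <= S)%E by apply: ereal_sup_ubound; exists j.
rewrite -lee_fin fineK // fin_numE; apply/andP; split.
  by apply/eqP => SN; rewrite SN in h.
by apply/eqP => SN; rewrite SN in fin.
Qed.

Lemma vvec_le j : csq (v j) <= L * p j.
Proof.
have [v0|/supp_p pj] := eqVneq (v j) 0.
  rewrite v0 (hsq0 cP).
  (* Even for v_j = 0 the sign of [L] has to be justified; the nonnegative ratio at this j bounds it
     from below. *)
  have [pj0|pj] := eqVneq (p j) 0; first by rewrite pj0 mulr0.
  have pj' : 0 < p j by rewrite lt_neqAle eq_sym pj (distr_ge0 pP).
  rewrite pmulr_lge0 // le_max; apply/orP; left.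
  apply: le_trans (fine_sup_ge (f := fun j => cvnorm (v j) ^+ 2 / p j) R_fin pj').
  by rewrite divr_ge0 ?sqr_ge0 // ltW.
have := fine_sup_ge (f := fun j => cvnorm (v j) ^+ 2 / p j) R_fin pj.
rewrite /= ler_pdivrMr // cvnormE hnormE // => /le_trans; apply.
by rewrite ler_pM2r // le_max lexx.
Qed.

Lemma uvec_supp_le j : hsq ip (uvec_supp j) <= L * p j.
Proof.
rewrite /uvec_supp; case: ifP => [pj|].
  have := fine_sup_ge (f := fun j => hnorm ip (uvec ip s w n j) ^+ 2 / p j) R'_fin pj.
  rewrite /= ler_pdivrMr // hnormE // => /le_trans; apply.
  by rewrite ler_pM2r // le_max lexx orbT.
move=> /negbT; rewrite -leNgt => pj; rewrite (hsq0 ipP).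
by rewrite (_ : p j = 0) ?mulr0 //; apply/eqP; rewrite eq_le pj (distr_ge0 pP).
Qed.

Lemma vvec0 j : p j = 0 -> v j = 0.
Proof.
by move=> pj; apply/eqP/negPn/negP => /supp_p; rewrite pj ltxx.
Qed.

Lemma L_ge0 : 0 <= L.
Proof.
case: (pselect (exists j, 0 < p j)) => [[j pj]|no].
  by have := le_trans (hsq_ge0 cP _) (vvec_le j); rewrite pmulr_lge0.
have [N /(_ N (leqnn N))] := distr_sum_cvg pP (ltr01 : 0 < 1 :> R).
rewrite subrr big1 ?ltxx // => j _; apply/eqP; rewrite eq_le (distr_ge0 pP) andbT leNgt.
by apply/negP => pj; apply: no; exists j.
Qed.

Lemma ip_Pperp_conj h j k :
  ip (Pperp ip w n h) (s j) * cconj (ip (w (nat_of_ord k)) (s j)) = (ip h (uvec_supp j) *: v j) k 0.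
Proof.
rewrite !mxE /uvec_supp; case: ifP => [_|]; first by rewrite ip_Pperp.
move=> /negbT; rewrite -leNgt => pj.
have /vvec0/matrixP/(_ k 0) : p j = 0 by apply/eqP; rewrite eq_le pj (distr_ge0 pP).
by rewrite !mxE => ->; rewrite !mulr0.
Qed.

Lemma cdot_vvec y j : cdot y (v j) = ip (Wn w y) (s j).
Proof.
rewrite (ip_suml ipP); apply: eq_bigr => k _.
by rewrite (ipZl ipP) mxE cconjK.
Qed.

(** Each of the two vectors has norm at most sqrt(L p_j), so the series for Sigma, Gamma and T are
    all dominated by [p]. *)
Lemma hnorm_term_le (H1 H2 : lmodType CC) (ip1 : H1 -> H1 -> CC) (ip2 : H2 -> H2 -> CC) h y z j :
  is_inner_product ip1 -> is_inner_product ip2 -> hsq ip1 y <= L * p j -> hsq ip2 z <= L * p j ->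
  hnorm ip2 (ip1 h y *: z) <= hnorm ip1 h * L * p j.
Proof.
move=> P1 P2 hy hz; rewrite (hnormZ P2) -mulrA; have h1 := cmod_ip P1 h y.
apply: le_trans (ler_wpM2r (hnorm_ge0 _ _) h1) _; rewrite -mulrA ler_wpM2l ?hnorm_ge0 //.
have Lp : 0 <= L * p j by rewrite mulr_ge0 ?L_ge0 ?(distr_ge0 pP).
have h2 : hnorm ip1 y <= Num.sqrt (L * p j) by rewrite ler_wsqrtr.
have h3 : hnorm ip2 z <= Num.sqrt (L * p j) by rewrite ler_wsqrtr.
by apply: le_trans (ler_pM (hnorm_ge0 _ _) (hnorm_ge0 _ _) h2 h3) _; rewrite -expr2 sqr_sqrtr.
Qed.

Lemma csum_hconv (a : nat -> CC) c : (forall j, cmod (a j) <= c * p j) -> 0 <= c ->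
  @hconv R CC^o (@cip R) (fun M => \sum_(k < M) a k) (csum a).
Proof.
move=> ac c0; apply: (csumP (c := c)) => M.
apply: (@le_trans _ _ (\sum_(j < M) c * p j)); first by apply: ler_sum => j _; exact: ac.
by rewrite -mulr_sumr ler_piMr // distr_sum_le1.
Qed.

Lemma Gamma_hconv h :
  hconv (@cdot R n) (fun M => \sum_(j < M) ip h (uvec_supp j) *: v j) (Gamma ip s w n h).
Proof.
apply: hconv_col => k; rewrite mxE.
have : @hconv R CC^o (@cip R) (fun M => \sum_(j < M) (ip h (uvec_supp j) *: v j) k 0)
    (csum (fun j => (ip h (uvec_supp j) *: v j) k 0)).
  apply: (@csum_hconv _ (hnorm ip h * L)) => [j|]; last by rewrite mulr_ge0 ?hnorm_ge0 ?L_ge0.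
  apply: le_trans (cmod_coord_le (ip h (uvec_supp j) *: v j) k) _.
  exact: hnorm_term_le ipP cP (uvec_supp_le j) (vvec_le j).
under [X in csum X]funext do rewrite -ip_Pperp_conj.
by rewrite (_ : (fun M => _) = (fun M => (\sum_(j < M) ip h (uvec_supp j) *: v j) k 0)) //;
  apply/funext => M; rewrite summxE.
Qed.

Lemma Sigma_hconv y :
  hconv (@cdot R n) (fun M => \sum_(j < M) cdot y (v j) *: v j) (Sigma ip s w n *m y).
Proof.
have colE l : hconv (@cdot R n)
    (fun M => \sum_(j < M) ip (w (nat_of_ord l)) (s j) *: v j) (col l (Sigma ip s w n)).
  apply: hconv_col => k; rewrite !mxE.
  have : @hconv R CC^o (@cip R) (fun M => \sum_(j < M) (ip (w l) (s j) *: v j) k 0)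
     (csum (fun j => ip (w l) (s j) * cconj (ip (w k) (s j)))).
    under [X in csum X]funext => j.
      rewrite (_ : _ * _ = (ip (w l) (s j) *: v j) k 0); last by rewrite !mxE.
      over.
    apply: (@csum_hconv _ L) => [j|]; last exact: L_ge0.
    apply: le_trans (cmod_coord_le _ _) _; rewrite (hnormZ cP).
    apply: (@le_trans _ _ (hnorm (@cdot R n) (v j) * hnorm (@cdot R n) (v j))).
      rewrite ler_wpM2r ?hnorm_ge0 //; apply: le_trans (cmod_coord_le (v j) l).
      by rewrite mxE /cmod cmod2_conj.
    by rewrite -expr2 hnormE ?vvec_le.
  by rewrite (_ : (fun M => _) = (fun M => (\sum_(j < M) ip (w l) (s j) *: v j) k 0)) //;
    apply/funext => M; rewrite summxE.
have -> : Sigma ip s w n *m y = \sum_l y l 0 *: col l (Sigma ip s w n).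
  apply/matrixP => k j; rewrite (ord1 j) !mxE summxE; apply: eq_bigr => l _.
  by rewrite !mxE mulrC.
rewrite (_ : (fun M => _) = (fun M => \sum_l y l 0 *: \sum_(j < M) ip (w (nat_of_ord l)) (s j) *: v j)).
  apply: hconv_sum => // l; exact: hconvZ.
apply/funext => M; under [RHS]eq_bigr do rewrite scaler_sumr.
rewrite exchange_big; apply: eq_bigr => j _ /=.
rewrite cdot_vvec (ip_suml ipP) scaler_suml; apply: eq_bigr => l _.
by rewrite (ipZl ipP) scalerA.
Qed.
Lemma cvnorm_fun k : @cvnorm R k = hnorm (@cdot R k).
Proof. by apply/funext => x; rewrite cvnormE. Qed.

Lemma unitmx_inj k (A : 'M[CC]_k) : (forall y : 'cV[CC]_k, A *m y = 0 -> y = 0) -> A \in unitmx.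
Proof.
move=> h; rewrite -row_full_unit -cokermx_eq0; apply/eqP/matrixP => i j.
have /h/matrixP/(_ i 0) : A *m col j (cokermx A) = 0 by rewrite colE mulmxA mulmx_coker mul0mx.
by rewrite !mxE.
Qed.

Lemma mx_bounded k (A : 'M[CC]_k) : exists c, forall y : 'cV[CC]_k,
  hnorm (@cdot R k) (A *m y) <= c * hnorm (@cdot R k) y.
Proof.
exists (\sum_l hnorm (@cdot R k) (col l A)) => y.
have -> : A *m y = \sum_l y l 0 *: col l A.
  apply/matrixP => i j; rewrite (ord1 j) !mxE summxE; apply: eq_bigr => l _.
  by rewrite !mxE mulrC.
apply: le_trans (hnorm_sum (cdot_inner R k) _ _ _) _; rewrite mulr_suml.
apply: ler_sum => l _; rewrite (hnormZ (cdot_inner R k)) mulrC ler_wpM2l ?hnorm_ge0 //.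
exact: cmod_coord_le.
Qed.

Local Notation Sig := (Sigma ip s w n).
Local Notation Gam := (Gamma ip s w n).
Local Notation ut := (uvec_supp).
Local Notation cnorm y := (hnorm (@cdot R n) y).

Lemma mulmx_opnorm (A : 'M[CC]_n) (y : 'cV[CC]_n) :
  cnorm (A *m y) <= opnorm (@cvnorm R n) (@cvnorm R n) (mulmx A) * cnorm y.
Proof.
have [c hc] := mx_bounded A; rewrite cvnorm_fun.
by apply: (opnorm_hnorm_le cP cP hc) => r x; rewrite scalemxAr.
Qed.

Lemma mulmx_opnorm_ge0 (A : 'M[CC]_n) : 0 <= opnorm (@cvnorm R n) (@cvnorm R n) (mulmx A).
Proof. have [c hc] := mx_bounded A; rewrite cvnorm_fun; exact: opnorm_hnorm_ge0 hc. Qed.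

Lemma term_summable h : hnorm ip h * L >= 0.
Proof. by rewrite mulr_ge0 ?hnorm_ge0 ?L_ge0. Qed.

Lemma Gam_hnorm_le h : cnorm (Gam h) <= L * hnorm ip h.
Proof.
rewrite mulrC; apply: (series_le cP pP (term_summable h)) (Gamma_hconv h).
by move=> j; exact: hnorm_term_le ipP cP (uvec_supp_le j) (vvec_le j).
Qed.

Lemma GamZ (r : R) h : Gam (Complex r 0 *: h) = Complex r 0 *: Gam h.
Proof.
apply: (hconv_unique cP (Gamma_hconv _)).
have := hconvZ cP (Complex r 0) (Gamma_hconv h).
rewrite (_ : (fun M => _) = (fun M => \sum_(j < M) ip (Complex r 0 *: h) (ut j) *: v j)) //.
apply/funext => M; rewrite scaler_sumr; apply: eq_bigr => j _.
by rewrite (ipZl ipP) scalerA.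
Qed.

Lemma Gam_opnorm h : cnorm (Gam h) <= opnorm (hnorm ip) (@cvnorm R n) Gam * hnorm ip h.
Proof. rewrite cvnorm_fun; exact: (opnorm_hnorm_le ipP cP Gam_hnorm_le GamZ). Qed.

Lemma Gam_opnorm_ge0 : 0 <= opnorm (hnorm ip) (@cvnorm R n) Gam.
Proof. rewrite cvnorm_fun; exact: (opnorm_hnorm_ge0 ipP Gam_hnorm_le). Qed.

Lemma sum_vvec_le y (N : nat) : \sum_(j < N) cmod2 (cdot y (v j)) <= K * csq y.
Proof.
apply: le_trans (sum_cmod2_le cP N (Sigma_hconv y)) _.
rewrite -(hnormE cP) expr2 mulrA ler_wpM2r ?hnorm_ge0 //.
apply: le_trans (mulmx_opnorm _ _) _; rewrite ler_wpM2r ?hnorm_ge0 //.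
by rewrite le_max lexx.
Qed.

Lemma Top_hconv h : hconv ip (fun M => \sum_(j < M) ip h (ut j) *: ut j) (Top ip s w n p h).
Proof.
have E : (fun N : nat => \sum_(j < N | 0 < p j) ip h (uvec ip s w n j) *: uvec ip s w n j) =
    (fun M : nat => \sum_(j < M) ip h (ut j) *: ut j).
  apply/funext => M; rewrite big_mkcond; apply: eq_bigr => j _.
  by rewrite /uvec_supp; case: ifP => // _; rewrite scaler0.
rewrite -E; apply: hlimP; rewrite E.
case: hilb => _ complete _; apply: complete.
apply: (series_cauchy ipP pP (a := fun j => ip h (ut j) *: ut j) (term_summable h)) => j.
exact: hnorm_term_le ipP ipP (uvec_supp_le j) (uvec_supp_le j).
Qed.

Lemma Top_hnorm_le h : hnorm ip (Top ip s w n p h) <= L * hnorm ip h.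
Proof.
rewrite mulrC; apply: (series_le ipP pP (a := fun j => ip h (ut j) *: ut j) (term_summable h) _ (Top_hconv h)) => j.
exact: hnorm_term_le ipP ipP (uvec_supp_le j) (uvec_supp_le j).
Qed.

Lemma TopZ (r : R) h : Top ip s w n p (Complex r 0 *: h) = Complex r 0 *: Top ip s w n p h.
Proof.
apply: (hconv_unique ipP (Top_hconv _)).
have := hconvZ ipP (Complex r 0) (Top_hconv h).
rewrite (_ : (fun M => _) = (fun M => \sum_(j < M) ip (Complex r 0 *: h) (ut j) *: ut j)) //.
apply/funext => M; rewrite scaler_sumr; apply: eq_bigr => j _.
by rewrite (ipZl ipP) scalerA.
Qed.

Lemma sum_uvec_le h (N : nat) : \sum_(j < N) cmod2 (ip h (ut j)) <= K * hsq ip h.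
Proof.
apply: le_trans (sum_cmod2_le ipP N (Top_hconv h)) _.
rewrite -(hnormE ipP) expr2 mulrA ler_wpM2r ?hnorm_ge0 //.
apply: le_trans (opnorm_hnorm_le ipP ipP Top_hnorm_le TopZ h) _.
by rewrite ler_wpM2r ?hnorm_ge0 // le_max lexx orbT.
Qed.

Lemma in_cspan_Wn (y : 'cV[CC]_n) : in_cspan ip w (Wn w y).
Proof.
move=> e e0; exists n, (fun k => if insub k is Some i then y i 0 else 0).
set z := \sum_(k < n) _; have -> : Wn w y = z by apply: eq_bigr => k _; rewrite valK.
by rewrite subrr (hnorm0 ipP).
Qed.

(** If Sigma y = 0, then the sums of |<Wy,s_j>|^2 vanish, so Wy is orthogonal to every s_j.
    Assumption (A)(i) gives Wy = 0, and the lower Riesz bound gives y = 0. *)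
Lemma Sig_eq0 (y : 'cV[CC]_n) : Sig *m y = 0 -> y = 0.
Proof.
move=> Sy; have hc := Sigma_hconv y; rewrite Sy in hc.
apply: (Wn_eq0 ipP rieszP); apply: (inj (in_cspan_Wn y)) => j.
rewrite -cdot_vvec; apply: cmod2_eq0; apply/eqP; rewrite eq_le cmod2_ge0 andbT.
have := sum_cmod2_le cP j.+1 hc; rewrite (hnorm0 cP) mul0r; apply: le_trans.
by rewrite big_ord_recr /= lerDr; apply: sumr_ge0 => k _; exact: cmod2_ge0.
Qed.

Lemma Sig_unit : Sig \in unitmx. Proof. exact: unitmx_inj Sig_eq0. Qed.

Local Notation nSinv := (opnorm (@cvnorm R n) (@cvnorm R n) (fun x => invmx Sig *m x)).

Lemma Sig_expand (y : 'cV[CC]_n) : cnorm y <= nSinv * cnorm (Sig *m y).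
Proof. by rewrite -{1}[y](mulKmx Sig_unit); exact: mulmx_opnorm. Qed.

Hypothesis n_gt0 : (0 < n)%N.

(** This is 1 <= |Sigma^-1| |Sigma|. It converts 2 |Sigma^-1| tau < 1 into tau <= K/2, the range in
    which the Bernstein bound is valid. *)
Lemma one_le_nSinv_K : 1 <= nSinv * K.
Proof.
set y : 'cV[CC]_n := delta_mx (Ordinal n_gt0) 0.
have y0 : 0 < cnorm y.
  rewrite lt_neqAle eq_sym hnorm_ge0 andbT; apply/eqP => /(hnorm_eq0 cP)/matrixP/(_ (Ordinal n_gt0) 0).
  by rewrite !mxE !eqxx => /eqP; rewrite oner_eq0.
rewrite -(ler_pM2r y0) mul1r; apply: le_trans (Sig_expand y) _.
rewrite -mulrA ler_wpM2l ?mulmx_opnorm_ge0 //; apply: le_trans (mulmx_opnorm _ _) _.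
by rewrite ler_wpM2r ?hnorm_ge0 // le_max lexx.
Qed.

(** If [L] were 0, all v_j and hence Sigma would vanish, contradicting injectivity in positive
    dimension. *)
Lemma L_gt0 : 0 < L.
Proof.
rewrite lt_neqAle eq_sym L_ge0 andbT; apply/eqP => L0.
set y : 'cV[CC]_n := delta_mx (Ordinal n_gt0) 0.
have vz j : v j = 0.
  apply: (hsq_eq0 cP); apply/eqP; rewrite eq_le (hsq_ge0 cP) andbT.
  by have := vvec_le j; rewrite L0 mul0r.
have : y = 0.
  apply: Sig_eq0; apply: (hconv_unique cP (Sigma_hconv y)).
  rewrite (_ : (fun M => _) = (fun=> 0)); first exact: hconv_cst.
  by apply/funext => M; rewrite big1 // => j _; rewrite vz scaler0.
move=> /matrixP/(_ (Ordinal n_gt0) 0).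
by rewrite !mxE !eqxx => /eqP; rewrite oner_eq0.
Qed.

Section Sample.
Variables (m : nat) (om : m.-tuple nat).

Lemma Gamma_hatE h : Gamma_hat ip s w n p om h =
  Complex (m%:R^-1) 0 *: \sum_t Complex (p (tnth om t))^-1 0 *: (ip h (ut (tnth om t)) *: v (tnth om t)).
Proof.
apply/matrixP => k j; rewrite (ord1 j) [LHS]mxE [RHS]mxE summxE natr_complex complex_invr.
congr (_ * _); apply: eq_bigr => t _.
by rewrite -mulrA ip_Pperp_conj complex_invr [RHS]mxE.
Qed.

Lemma Sigma_hatE (y : 'cV[CC]_n) : Sigma_hat ip s w n p om *m y =
  Complex (m%:R^-1) 0 *: \sum_t Complex (p (tnth om t))^-1 0 *: (cdot y (v (tnth om t)) *: v (tnth om t)).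
Proof.
apply/matrixP => k j; rewrite (ord1 j) [LHS]mxE [RHS]mxE summxE.
under eq_bigr => l _ do rewrite mxE -mulrA mulr_suml.
rewrite -mulr_sumr natr_complex complex_invr; congr (_ * _).
rewrite exchange_big; apply: eq_bigr => t _ /=.
rewrite [RHS]mxE [X in _ * X]mxE cdot_vvec (ip_suml ipP) mulr_suml mulr_sumr.
by apply: eq_bigr => l _; rewrite mxE (ipZl ipP) complex_invr; ring.
Qed.

Local Notation g := (opnorm (hnorm ip) (@cvnorm R n) Gam).
Local Notation Sig_hat := (Sigma_hat ip s w n p om).
Local Notation Gam_hat := (Gamma_hat ip s w n p om).

(** If Sigma_hat y = 0, then |y| <= |Sigma^-1| sig |y| <= |y|/2, so y = 0. For the estimate, let yh
    and y be the sampled and exact solutions and d = |yh - y|; then Sigma (yh - y) = -(Sigma_hat -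
    Sigma) yh + (Gamma_hat - Gamma) h gives d <= x sig (d + x g + 1). Absorbing x sig d <= d/2
    leaves d <= 2x (1 + x g) sig. *)
Lemma perturbation sig eps : 0 <= sig -> nSinv * sig <= 1 / 2 ->
  Num.sqrt Dw * (2 * nSinv * (1 + nSinv * g) * sig) < eps ->
  (forall y : 'cV[CC]_n, cnorm (Sig_hat *m y - Sig *m y) <= sig * cnorm y) ->
  (forall h, cnorm (Gam_hat h - Gam h) <= sig * hnorm ip h) ->
  Sig_hat \in unitmx /\ `|K_nOmega ip s w n p om - K_n ip s w n| < eps.
Proof.
set x := nSinv; have x0 : 0 <= x by exact: mulmx_opnorm_ge0.
have g0 := Gam_opnorm_ge0; set gg := g in g0 *.
move=> sig0 xsig heps dS dG.
have unit_hat : Sig_hat \in unitmx.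
  apply: unitmx_inj => y hy; apply: (hnorm_eq0 cP); apply/eqP; rewrite eq_le hnorm_ge0 andbT.
  have h1 := Sig_expand y; have h2 := dS y; rewrite hy sub0r (hnormN cP) in h2.
  have := hnorm_ge0 (@cdot R n) y; rewrite -/x in h1; nra.
split => //; apply: le_lt_trans heps.
have D0 : 0 <= Num.sqrt Dw by exact: sqrtr_ge0.
apply: (@opnorm_dist R H H (hnorm ip) (hnorm ip) _ _ 0 (Num.sqrt Dw * (x * gg))).
- by rewrite (hnorm0 ipP).
- move=> h h1; apply: le_trans (hnorm_Wn_le ipP rieszP _) _; rewrite ler_wpM2l //.
  have e1 := mulmx_opnorm (invmx Sig) (Gam h); have e2 := Gam_opnorm h.
  rewrite -/x -/gg in e1 e2.
  have : x * cnorm (Gam h) <= x * (gg * hnorm ip h) by rewrite ler_wpM2l.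
  have : x * gg * hnorm ip h <= x * gg by rewrite ler_piMr // mulr_ge0.
  lra.
move=> h h1; apply: le_trans (hnormBD ipP _ _) _; rewrite -WnB.
apply: le_trans (hnorm_Wn_le ipP rieszP _) _; rewrite ler_wpM2l //.
set yh := invmx Sig_hat *m _; set y := invmx Sig *m _.
have hyh : Sig_hat *m yh = Gam_hat h by rewrite mulKVmx.
have hy : Sig *m y = Gam h by rewrite mulKVmx // Sig_unit.
have e4 : cnorm y <= x * gg.
  have a1 := mulmx_opnorm (invmx Sig) (Gam h); have a2 := Gam_opnorm h.
  rewrite -/x -/gg -/y in a1 a2.
  have : x * cnorm (Gam h) <= x * (gg * hnorm ip h) by rewrite ler_wpM2l.
  have : x * gg * hnorm ip h <= x * gg by rewrite ler_piMr // mulr_ge0.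
  lra.
clearbody yh y.
have e1 := Sig_expand (yh - y); rewrite -/x in e1.
have e2 : cnorm (Sig *m (yh - y)) <= sig * cnorm yh + sig * hnorm ip h.
  have -> : Sig *m (yh - y) = - (Sig_hat *m yh - Sig *m yh) + (Gam_hat h - Gam h).
    by rewrite mulmxBr hyh hy opprB addrA subrK.
  apply: le_trans (hnormD cP (- (Sig_hat *m yh - Sig *m yh)) (Gam_hat h - Gam h)) _.
  by rewrite (hnormN cP (Sig_hat *m yh - Sig *m yh)); apply: lerD; [exact: dS|exact: dG].
have e3 : cnorm yh <= cnorm (yh - y) + cnorm y by have := hnormD cP (yh - y) y; rewrite subrK.
set d := cnorm (yh - y) in e1 e3 *.
have d0 : 0 <= d by exact: hnorm_ge0.
have f1 : sig * cnorm yh <= sig * (d + x * gg) by rewrite ler_wpM2l //; lra.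
have f2 : sig * hnorm ip h <= sig by rewrite ler_piMr.
have f3 : x * cnorm (Sig *m (yh - y)) <= x * (sig * (d + x * gg) + sig) by rewrite ler_wpM2l //; lra.
have f4 : x * sig * d <= 1 / 2 * d by rewrite ler_wpM2r.
lra.
Qed.
End Sample.

(** Sigma is the sum of v_j (x) v_j and Gamma the sum of v_j (x) u_j, so one statement with a
    variable u' covers both. The terms beyond [N] contribute at most eta |h|; a deviation above tau
    + eta from the full operator is therefore one above tau from the truncated operator. *)
Lemma deviation_tail (H' : lmodType CC) (ip' : H' -> H' -> CC) (u' : nat -> H')
  (G : H' -> 'cV[CC]_n) m (Ghat : m.-tuple nat -> H' -> 'cV[CC]_n) N (tau eta : R) :
  is_inner_product ip' ->
  (forall j, hsq ip' (u' j) <= L * p j) ->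
  (forall h, \sum_(j < N) cmod2 (ip' h (u' j)) <= K * hsq ip' h) ->
  (forall h, hconv (@cdot R n) (fun M => \sum_(j < M) ip' h (u' j) *: v j) (G h)) ->
  (forall om h, Ghat om h = Complex (m%:R^-1) 0 *:
     \sum_t Complex (p (tnth om t))^-1 0 *: (ip' h (u' (tnth om t)) *: v (tnth om t))) ->
  0 < tau -> 0 <= eta -> tau <= K / 2 -> 0 < K -> (0 < m)%N -> L * (1 - \sum_(j < N) p j) <= eta ->
  (\sum_(om : m.-tuple 'I_N | `[< exists h, (tau + eta) * hnorm ip' h <
        cnorm (Ghat [tuple of map val om] h - G h) >]) \prod_j p (tnth om j)) *
   (expR (m%:R * tau ^+ 2 / (L * K) / 2) / 2 - 1) <=
  4 * n%:R * expR (m%:R * tau ^+ 2 / (L * K) / 5).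
Proof.
move=> ipP' u_le uK Gconv GhatE tau0 eta0 tauK K0 m0 hN.
apply: (hilbert_bernstein ipP' (v := v) (u := u')) => //.
- exact: distr_ge0 pP.
- exact: distr_sum_le1 pP N.
- exact: L_gt0.
- exact: vvec_le.
- by move=> x; exact: sum_vvec_le.
move=> om /asboolP[h hh].
have term_le j : hnorm (@cdot R n) (ip' h (u' j) *: v j) <= hnorm ip' h * L * p j.
  exact: hnorm_term_le ipP' cP (u_le j) (vvec_le j).
have hL0 : 0 <= hnorm ip' h * L by rewrite mulr_ge0 ?hnorm_ge0 ?L_ge0.
have tail := series_tail cP pP hL0 term_le N (Gconv h).
set GN := \sum_(j < N) _ in tail *.
have hatE : Ghat [tuple of map val om] h = Complex (m%:R^-1) 0 *: (\sum_j Complex (p (tnth om j))^-1 0 *: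
          (ip' h (u' (tnth om j)) *: v (tnth om j))).
  by rewrite GhatE; congr (_ *: _); apply: eq_bigr => t _; rewrite tnth_map.
set Gh := Ghat _ h in hh hatE.
have tri : cnorm (Gh - G h) <= cnorm (Gh - GN) + cnorm (G h - GN).
  have := hnormD cP (Gh - GN) (GN - G h); rewrite addrA subrK (hnormB cP GN); lra.
have tail' : cnorm (G h - GN) <= eta * hnorm ip' h.
  apply: le_trans tail _; rewrite -mulrA mulrC ler_wpM2r ?hnorm_ge0 //.
have main : tau * hnorm ip' h <= cnorm (Gh - GN) by lra.
exists h.
  rewrite lt_neqAle eq_sym (hsq_ge0 ipP') andbT; apply/eqP => h0.
  have hz := hsq_eq0 ipP' h0.
  have Gh0 : Gh = 0.
    by rewrite hatE big1 ?scaler0 // => t _; rewrite hz (ip0l ipP') scale0r scaler0.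
  have G0 : cnorm (G h) <= 0.
    have := series_le cP pP hL0 term_le (Gconv h).
    by rewrite hz (hnorm0 ipP') mul0r.
  move: hh; rewrite Gh0 sub0r (hnormN cP) hz (hnorm0 ipP') mulr0 -hz.
  by rewrite ltNge G0.
rewrite -hatE -(hnormE ipP') -(hnormE cP) -exprMn lerXn2r ?nnegrE ?mulr_ge0 ?hnorm_ge0 //.
exact: ltW.
Qed.

Lemma sampling_probability m (eps delta : R) :
  let Lambda := 1 + nSinv + opnorm (hnorm ip) (@cvnorm R n) Gam in
  0 < eps -> eps < Lambda * Num.sqrt Dw * Num.min 1 (2 * nSinv) ->
  0 < delta < 1 ->
  10 / 3 * K * L * ln (56 * n%:R / delta)
    * (Lambda ^+ 2 * Dw / eps ^+ 2) * (Num.max 1 (2 * nSinv)) ^+ 4 <= m%:R ->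
  ((1 - delta)%:E <= prob_iid p
     [set om : m.-tuple nat |
        Sigma_hat ip s w n p om \in unitmx /\
        (`|K_nOmega ip s w n p om - K_n ip s w n| < eps)%R])%E.
Proof.
set x := nSinv; set g := opnorm (hnorm ip) _ _ => Lambda eps0 heps hdelta hm.
have /andP[delta0 delta1] := hdelta.
have x_ge0 : 0 <= x by exact: mulmx_opnorm_ge0.
have xK : 1 <= x * K by exact: one_le_nSinv_K.
have x0 : 0 < x.
  rewrite lt_neqAle eq_sym x_ge0 andbT; apply/eqP => xz.
  by move: xK; rewrite xz mul0r ler10.
have K0 : 0 < K by rewrite -(pmulr_rgt0 _ x0) (lt_le_trans ltr01).
have L0 := L_gt0.
have D0 : 0 < Dw by case: rieszP => C0 CD _; exact: lt_le_trans C0 CD.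
have S0 : 0 < Num.sqrt Dw by rewrite sqrtr_gt0.
have g0 : 0 <= g by exact: Gam_opnorm_ge0.
have [tau [tau0 epsE xtau lamM]] := sample_accuracy x0 g0 S0 eps0 heps.
rewrite -/Lambda in epsE lamM.
set M := Num.max 1 (2 * x) in epsE lamM hm.
have M1 : 1 <= M by rewrite le_max lexx.
have M0 : 0 < M by exact: lt_le_trans M1.
have Lam0 : 0 < Lambda by rewrite /Lambda; lra.
have LK0 : 0 < L * K by rewrite mulr_gt0.
have t0 : 0 < ln (56 * n%:R / delta).
  apply: ln_gt0; rewrite ltr_pdivlMr // mul1r.
  have : 1 <= n%:R :> R by rewrite ler1n.
  lra.
have hQ : ln (56 * n%:R / delta) <= 3 / 10 * (m%:R * tau ^+ 2 / (L * K)).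
  have E : Lambda ^+ 2 * Dw / eps ^+ 2 * M ^+ 4 = (tau ^+ 2)^-1.
    rewrite epsE -{1}(sqr_sqrtr (ltW D0)).
    by field; rewrite !gt_eqF.
  rewrite -mulrA E in hm.
  have t2 : 0 < tau ^+ 2 by rewrite exprn_gt0.
  move: hm; rewrite ler_pdivrMr // => hm.
  rewrite mulrA ler_pdivlMr //; lra.
have m0 : (0 < m)%N.
  rewrite lt0n; apply/eqP => m0; move: hQ; rewrite m0 !mul0r mulr0; lra.
have mR : 0 < m%:R :> R by rewrite ltr0n.
(* The first bound keeps tau + eta <= 4 tau/3 for the accuracy, the second keeps |Sigma^-1| (tau +
   eta) <= 1/2 for the perturbation argument. *)
pose eta := Num.min (tau / 3) ((1 / 2 - x * tau) / x).
have eta0 : 0 < eta.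
  rewrite lt_min divr_gt0 //= divr_gt0 //; lra.
have eta1 : eta <= tau / 3 by rewrite ge_min lexx.
have eta2 : x * eta <= 1 / 2 - x * tau.
  by rewrite mulrC -ler_pdivlMr // ge_min lexx orbT.
(* The discarded mass is so small that one of [m] draws exceeds [N] with probability at most
   delta/2, and that the remainders of the series stay below eta. *)
pose e := Num.min (delta / (2 * m%:R)) (eta / L).
have e0 : 0 < e by rewrite lt_min !divr_gt0 // mulr_gt0.
have [N /(_ N (leqnn N)) hN] := distr_sum_cvg pP e0.
set q := \sum_(j < N) p j in hN.
have q1 : q <= 1 by exact: distr_sum_le1.
have q0 : 0 <= q by apply: sumr_ge0 => j _; exact: distr_ge0 pP j.
have hq1 : m%:R * (1 - q) <= delta / 2.
  have : 1 - q <= delta / (2 * m%:R).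
    by apply: (@le_trans _ _ e); [lra|rewrite ge_min lexx].
  rewrite ler_pdivlMr ?mulr_gt0 //; lra.
have hq2 : L * (1 - q) <= eta.
  have : 1 - q <= eta / L.
    by apply: (@le_trans _ _ e); [lra|rewrite ge_min lexx orbT].
  by rewrite ler_pdivlMr // mulrC.
have tauK : tau <= K / 2.
  have : 2 * x * tau <= x * K by apply: le_trans xK; exact: ltW.
  by rewrite -mulrA mulrCA ler_pM2l //; lra.
pose sig := tau + eta.
pose badS (om : m.-tuple 'I_N) := `[< exists y : 'cV[CC]_n, sig * cnorm y <
   cnorm (Sigma_hat ip s w n p [tuple of map val om] *m y - Sig *m y) >].
pose badG (om : m.-tuple 'I_N) := `[< exists h, sig * hnorm ip h <
   cnorm (Gamma_hat ip s w n p [tuple of map val om] h - Gam h) >].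
pose pr (om : m.-tuple 'I_N) := \prod_j p (tnth om j).
have pr0 om : 0 <= pr om by apply: prodr_ge0 => j _; exact: distr_ge0 pP _.
have PS : \sum_(om | badS om) pr om <= delta / 4.
  apply: (tail_numeric n_gt0 hdelta _ hQ); first exact: sumr_ge0.
  apply: (deviation_tail (ip' := @cdot R n) (u' := v) (G := mulmx Sig)
     (Ghat := fun om => mulmx (Sigma_hat ip s w n p om))) => //.
  - exact: vvec_le.
  - by move=> y; exact: sum_vvec_le.
  - exact: Sigma_hconv.
  - exact: Sigma_hatE.
  - exact: ltW.
have PG : \sum_(om | badG om) pr om <= delta / 4.
  apply: (tail_numeric n_gt0 hdelta _ hQ); first exact: sumr_ge0.
  apply: (deviation_tail (ip' := ip) (u' := uvec_supp) (G := Gam)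
     (Ghat := fun om => Gamma_hat ip s w n p om)) => //.
  - exact: uvec_supp_le.
  - by move=> h; exact: sum_uvec_le.
  - exact: Gamma_hconv.
  - exact: Gamma_hatE.
  - exact: ltW.
(* Good samples have all letters below [N] and both deviations at most sig. The letters alone have
   probability q^m >= 1 - m (1 - q) >= 1 - delta/2, from which the two bad events remove at most
   delta/4 each. *)
apply: le_trans (prob_iid_ge (G := fun om => ~~ badS om && ~~ badG om) (distr_ge0 pP) _); last first.
  move=> om /andP[/asboolPn nS /asboolPn nG].
  apply: (perturbation (sig := sig)).
  - by rewrite /sig addr_ge0 // ltW.
  - by rewrite -/x /sig mulrDr; lra.
  - rewrite -/x -/g epsE /sig.
    have B0 : 0 <= 2 * x * (1 + x * g) by rewrite !mulr_ge0 // addr_ge0 // mulr_ge0.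
    have LM0 : 0 < Lambda * M ^+ 2 by rewrite mulr_gt0 // exprn_gt0.
    have h1 : 2 * x * (1 + x * g) * (tau + eta) <= 2 / 3 * (Lambda * M ^+ 2) * (4 / 3 * tau).
      by apply: ler_pM => //; lra.
    have h2 : 2 / 3 * (Lambda * M ^+ 2) * (4 / 3 * tau) < Lambda * M ^+ 2 * tau.
      have : 0 < Lambda * M ^+ 2 * tau by rewrite mulr_gt0.
      lra.
    have -> : Lambda * Num.sqrt Dw * M ^+ 2 * tau = Num.sqrt Dw * (Lambda * M ^+ 2 * tau) by ring.
    by rewrite ltr_pM2l // (le_lt_trans h1 h2).
  - by move=> y; rewrite leNgt; apply/negP => hy; apply: nS; exists y.
  - by move=> h; rewrite leNgt; apply/negP => hh; apply: nG; exists h.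
rewrite lee_fin.
have total : \sum_om pr om = q ^+ m by exact: sum_tuple_prod.
have split_sum : \sum_om pr om <= \sum_(om | ~~ badS om && ~~ badG om) pr om +
    \sum_(om | badS om) pr om + \sum_(om | badG om) pr om.
  rewrite (big_mkcond (fun om => ~~ badS om && ~~ badG om)) (big_mkcond badS) (big_mkcond badG).
  rewrite -!big_split; apply: ler_sum => om _ /=.
  by have := pr0 om; case: (badS om); case: (badG om) => /=; lra.
have bern : 1 - m%:R * (1 - q) <= q ^+ m by apply: bernoulli_ineq; rewrite q0 q1.
rewrite -/pr; lra.
Qed.
End Setup.

Unset Implicit Arguments.

Theorem theorem3p5 (R : realType) (H : lmodType R[i]) (ip : H -> H -> R[i])
  (s w : nat -> H) (A B Cw Dw : R) (p : nat -> R) (n m : nat) (eps delta : R) :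
  is_separable_hilbert ip ->
  is_frame_cspan ip s A B ->
  is_riesz_cspan ip w Cw Dw ->
  (0 < n)%N ->
  (* (A)(i): W cap S^perp = {0} *)
  (forall h, in_cspan ip w h -> (forall k, ip h (s k) = 0) -> h = 0) ->
  is_distribution p ->
  (* (A)(ii) *)
  (Rconst ip s w n p < +oo)%E ->
  (Rconst' ip s w n p < +oo)%E ->
  (* (A)(iii) *)
  (forall j, vvec ip s w n j != 0 -> 0 < p j) ->
  let nSinv := opnorm (@cvnorm R n) (@cvnorm R n) (fun x => invmx (Sigma ip s w n) *m x) in
  let Lambda := 1 + nSinv + opnorm (hnorm ip) (@cvnorm R n) (Gamma ip s w n) in
  0 < eps -> eps < Lambda * Num.sqrt Dw * Num.min 1 (2 * nSinv) ->
  0 < delta < 1 ->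
  10 / 3 * Kconst ip s w n p * Rconst'' ip s w n p * ln (56 * n%:R / delta)
    * (Lambda ^+ 2 * Dw / eps ^+ 2) * (Num.max 1 (2 * nSinv)) ^+ 4 <= m%:R ->
  ((1 - delta)%:E <= prob_iid p
     [set om : m.-tuple nat |
        @Sigma_hat R H ip s w n p m om \in unitmx /\
        (`|@K_nOmega R H ip s w n p m om - K_n ip s w n| < eps)%R])%E.
Proof.
move=> hilb _ rieszP n_gt0 inj pP R_fin R'_fin supp_p nSinv Lambda eps0 heps hdelta hm.
exact: (sampling_probability hilb rieszP inj pP R_fin R'_fin supp_p n_gt0 eps0 heps hdelta hm).
Qed.
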